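(* The element $\xi_7=\xi_7^{(1)}+\xi_7^{(2)}+\xi_7^{(3)}$, with $\xi_7^{(1)},\xi_7^{(2)},\xi_7^{(3)}$ the explicit $\mathbb{Q}$-linear combinations (given in the context) of symbols of rational functions in two variables $t,u$, is a functional equation for $\mathcal{L}_7$, i.e. $$\mathcal{L}_7\big(\xi_7(t,u)\big)=0$$ for any $t,u\in\mathbb{C}$ such that $f_j(t),f_j(u)\notin\{0,\infty\}$ for $j=1,2,3$.
   Context: Put $$f_1(z)=\frac{-z}{1-z+z^2},\qquad f_2(z)=\frac{z-1}{1-z+z^2},\qquad f_3(z)=\frac{z(1-z)}{1-z+z^2},$$ $$f(z)=-f_1(z)f_2(z)f_3(z)=-\frac{z^2(1-z)^2}{(1-z+z^2)^3}.$$ For $a,b,c,d\in\mathbb{Z}$ define formal linear combinations of symbols $[\,\cdot\,]$ by $$\{a,b;c,d\}_0(t,u)=\sum_{i,j=1}^3\bigg[\frac{f(t)^a f_i(t)^{b-a}}{f(u)^c f_j(u)^{d-c}}\bigg],\qquad \{a,b;c,d\}=\{a,b;c,d\}_0(t,u)+\{c,d;a,b\}_0(t,u).$$ Set $$\begin{aligned}\xi_7^{(3)}=&-\tfrac1{18}\cdot\tfrac{609}{4}\{-1,-1;-1,-1\}-\tfrac13\cdot35\,\{-1,-1;-2,1\}+\tfrac13\cdot\tfrac{105}{8}\{-1,-1;3,-5\}\\&-\tfrac13\cdot21\,\{-1,-1;-1,4\}-\tfrac13\cdot15\,\{-1,-1;-2,5\}+\tfrac13\cdot15\,\{-1,-1;3,-4\},\end{aligned}$$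 $$\begin{aligned}\xi_7^{(2)}=&+\tfrac12\cdot700\,\{1,0;1,0\}+\tfrac12\cdot\tfrac{175}{4}\{1,-3;1,-3\}+\tfrac12\cdot28\,\{-2,3;-2,3\}\\&-35\,\{1,-3;-2,3\}-140\,\{-2,3;1,0\}+175\,\{1,0;1,-3\},\end{aligned}$$ $$\begin{aligned}\xi_7^{(1)}=&+\tfrac12\cdot700\,\{1,-2;-1,2\}+3150\,\{0,1;1,-1\}+\tfrac12\cdot1575\,\{-1,1;1,-1\}\\&-2100\,\{1,-2;0,-1\}+\tfrac12\cdot6300\,\{0,1;0,-1\}-1050\,\{-1,2;-1,1\}\\&-\tfrac12\cdot700\,\{-1,2;-1,2\}-\tfrac12\cdot1575\,\{-1,1;-1,1\}-\tfrac12\cdot6300\,\{0,1;0,1\}\\&+1050\,\{-1,2;1,-1\}+2100\,\{0,-1;-1,2\}-3150\,\{1,-1;0,-1\}.\end{aligned}$$ For complex $t,u$, $\xi_7(t,u)$ is the resulting formal $\mathbb{Q}$-linear combination of complex numbers, and $\mathcal{L}_7$ is extended linearly: $\mathcal{L}_7(\sum_\nu q_\nu[z_\nu])=\sum_\nu q_\nu\mathcal{L}_7(z_\nu)$. The one-valued 7-logarithm $\mathcal{L}_7:\mathbb{P}^1(\mathbb{C})\to\mathbb{R}$ is the case $m=7$ of the following: for $|z|\le1$, $z\notin\{0,1\}$, $$\mathcal{L}_m(z)=\Re_m\Big(\sum_{r=0}^{m-1}\frac{2^rB_r}{r!}\log^r|z|\,\mathrm{Li}_{m-r}(z)\Big),$$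 where $\Re_m$ denotes the real part for $m$ odd and the imaginary part for $m$ even, $B_r$ is the $r$-th Bernoulli number ($B_0=1,B_1=-\tfrac12,B_2=\tfrac16,\dots$), and $\mathrm{Li}_k(z)=\sum_{n\ge1}z^n/n^k$ (principal branch; $\mathrm{Li}_1(z)=-\log(1-z)$); for $m=7$ a term $r=7$ would vanish since $B_7=0$. For $|z|>1$, $\mathcal{L}_m(z)=(-1)^{m-1}\mathcal{L}_m(1/z)$, and at $0,1,\infty$ the function is extended by continuity. *)

(* Defs.v *)
From Stdlib Require Import Reals ZArith QArith Qreals List.
From Coquelicot Require Import Coquelicot.
Import ListNotations.

Local Open Scope R_scope.

(* bernoulli_list n = [B_0; ...; B_n], by
   sum_(k <= p+1) binom(p+2,k) B_k = 0; hence B_1 = -1/2. *)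
Fixpoint bernoulli_list (n : nat) : list R :=
  match n with
  | O => [1]
  | S p =>
      let l := bernoulli_list p in
      l ++ [- sum_f_R0 (fun k => Binomial.C (S (S p)) k * nth k l 0) p
            / INR (S (S p))]
  end.

Definition bernoulli (n : nat) : R := nth n (bernoulli_list n) 0.

(* The sum of the complex series is taken on real and imaginary parts.
   [Series] is the limit of the partial sums, so for k = 1 it also covers the
   conditionally convergent case |z| = 1, z <> 1. *)
Definition Li (k : nat) (z : C) : C :=
  let term (n : nat) : C := (Cpow z (S n) / Cpow (RtoC (INR (S n))) k)%C in
  (Series (fun n => Re (term n)), Series (fun n => Im (term n))).

Definition Re_parity (m : nat) (z : C) : R :=
  if Nat.odd m then Re z else Im z.

(* Relevant for |z| <= 1, z <> 0, 1. *)
Definition polylog_disc (m : nat) (z : C) : R :=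
  Re_parity m
    (sum_n (fun r : nat =>
       (RtoC (2 ^ r * bernoulli r / INR (fact r) * ln (Cmod z) ^ r)
        * Li (m - r) z)%C) (m - 1)).

(* Relevant on P^1(C) away from 0, 1 and infinity. *)
Definition polylog_generic (m : nat) (z : C) : R :=
  if Rle_dec (Cmod z) 1 then polylog_disc m z
  else (-1) ^ (m - 1) * polylog_disc m (/ z)%C.

Inductive P1 : Type :=
  | Fin : C -> P1
  | Infty : P1.

Definition C_at_infinity (P : C -> Prop) : Prop :=
  exists M : R, forall z : C, M < Cmod z -> P z.

(* The one-valued m-logarithm (m >= 1).  At 0, 1 and infinity the value is the
   limit along the punctured neighbourhoods; [lim] is a junk value when there
   is none, which for m >= 2 does not happen. *)
Definition polylog (m : nat) (x : P1) : R :=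
  match x with
  | Fin z =>
      if Ceq_dec z 0 then lim (filtermap (polylog_generic m) (locally' (0 : C)))
      else if Ceq_dec z 1
      then lim (filtermap (polylog_generic m) (locally' (1 : C)))
      else polylog_generic m z
  | Infty => lim (filtermap (polylog_generic m) C_at_infinity)
  end.

(* The list [(q_1, z_1); (q_2, z_2); ...] stands for the formal sum of the
   q_i [z_i]; repetitions are allowed, and concatenation is addition. *)
Definition formal_sum : Type := list (Q * C).

Definition scale (q : Q) (s : formal_sum) : formal_sum :=
  map (fun '(r, z) => ((q * r)%Q, z)) s.

Definition polylog_linear (m : nat) (s : formal_sum) : R :=
  fold_right (fun '(q, z) acc => Q2R q * polylog m (Fin z) + acc) 0 s.

Definition Cpowz (z : C) (n : Z) : C :=
  match n with
  | Z0 => 1%C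
  | Zpos p => Cpow z (Pos.to_nat p)
  | Zneg p => (/ Cpow z (Pos.to_nat p))%C
  end.

Section RationalFunctions.
Local Open Scope C_scope.

Definition den (z : C) : C := 1 - z + z ^ 2.

Definition f1 (z : C) : C := - z / den z.
Definition f2 (z : C) : C := (z - 1) / den z.
Definition f3 (z : C) : C := z * (1 - z) / den z.

Definition f (z : C) : C := - (f1 z * f2 z * f3 z).

Definition fs : list (C -> C) := [f1; f2; f3].

(* None of f1, f2, f3 takes the value 0 or infinity at z.  Their numerators are
   coprime to [den], so each of them has a pole at z exactly when den z = 0;
   this has to be said separately because division in [C] is total. *)
Definition fj_avoid_0_infty (z : C) : Prop :=
  den z <> 0 /\ (forall g : C -> C, In g fs -> g z <> 0).

Definition brace0 (a b c d : Z) (t u : C) : formal_sum :=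
  map (fun '(g, h) =>
         (1%Q, Cpowz (f t) a * Cpowz (g t) (b - a)
               / (Cpowz (f u) c * Cpowz (h u) (d - c))))
      (list_prod fs fs).

Definition brace (a b c d : Z) (t u : C) : formal_sum :=
  brace0 a b c d t u ++ brace0 c d a b t u.

End RationalFunctions.

Definition brace_comb (l : list (Q * (Z * Z * Z * Z))) (t u : C) : formal_sum :=
  flat_map (fun '(q, (a, b, c, d)) => scale q (brace a b c d t u)) l.

Section Xi.
Local Open Scope Z_scope.

Definition xi7_3 : C -> C -> formal_sum := brace_comb
  [ ((- ((1#18) * (609#4)))%Q, (-1, -1, -1, -1));
    ((- ((1#3) * 35))%Q,       (-1, -1, -2, 1));
    (((1#3) * (105#8))%Q,      (-1, -1, 3, -5));
    ((- ((1#3) * 21))%Q,       (-1, -1, -1, 4));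
    ((- ((1#3) * 15))%Q,       (-1, -1, -2, 5));
    (((1#3) * 15)%Q,           (-1, -1, 3, -4)) ].

Definition xi7_2 : C -> C -> formal_sum := brace_comb
  [ (((1#2) * 700)%Q,     (1, 0, 1, 0));
    (((1#2) * (175#4))%Q, (1, -3, 1, -3));
    (((1#2) * 28)%Q,      (-2, 3, -2, 3));
    ((-35)%Q,             (1, -3, -2, 3));
    ((-140)%Q,            (-2, 3, 1, 0));
    (175%Q,               (1, 0, 1, -3)) ].

Definition xi7_1 : C -> C -> formal_sum := brace_comb
  [ (((1#2) * 700)%Q,      (1, -2, -1, 2));
    (3150%Q,               (0, 1, 1, -1));
    (((1#2) * 1575)%Q,     (-1, 1, 1, -1));
    ((-2100)%Q,            (1, -2, 0, -1));
    (((1#2) * 6300)%Q,     (0, 1, 0, -1));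
    ((-1050)%Q,            (-1, 2, -1, 1));
    ((- ((1#2) * 700))%Q,  (-1, 2, -1, 2));
    ((- ((1#2) * 1575))%Q, (-1, 1, -1, 1));
    ((- ((1#2) * 6300))%Q, (0, 1, 0, 1));
    (1050%Q,               (-1, 2, 1, -1));
    (2100%Q,               (0, -1, -1, 2));
    ((-3150)%Q,            (1, -1, 0, -1)) ].

Definition xi7 (t u : C) : formal_sum := xi7_1 t u ++ xi7_2 t u ++ xi7_3 t u.

End Xi.

(* Main.v *)
(* The m-th one-valued logarithm equals, on all of C minus 0, an absolutely
   convergent series whose terms are continuous, and off 0 and 1 its
   differential is an explicit combination of one-valued logarithms of lower
   weight and of log|z|, log|1-z| and their conjugate differentials.
   Every argument x of xi_7 is, up to sign, a monomial in the six functions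
   z, 1-z, 1-z+z^2 of z = t, u, and 1-x is a product of such functions and of 51
   polynomials in t, u.  The image of xi_7 in Sym^5 (x) Lambda^2 of the resulting
   group of symbols vanishes.  Hence, by induction on the weight m = 2, ..., 7,
   all the sums of L_m(x), weighted by products of 7-m linear forms in the
   exponents of x, are constant along any path.  The path used here ends where
   1-t+t^2 and 1-u+u^2 vanish; there each x tends to 0, to infinity or to 1, and
   the coefficients of the last kind cancel, so the constant is 0. *)
Require Import Defs.
From Stdlib Require Import ssreflect Reals ZArith QArith List Lia Lra Classical Ring_polynom.
From Coquelicot Require Import Coquelicot.
Import ListNotations.

Local Open Scope R_scope.

(** * Complex-valued functions of a real variable *)

(** The weights are forced by the differential. It expresses dL_m through L_(m-1), L_(m-2) and
    L_(m-4), multiplied by powers of log|x| and by the real or imaginary part of dx/x. These are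
    linear in the exponents of x, so an induction on the bare sums of L_m(x) would not close. With 7
    - m linear forms in weight m it does: a term that lowers the weight by k brings k linear forms,
    and the remaining term has exactly five of them in front of log|x| dlog(1-x) - log|1-x| dlog x,
    which is the symbol evaluated at real vectors.

    Two obstacles shape the analysis. The defining series cannot be differentiated termwise on |z| =
    1, a circle that the arguments may cross; the differential is computed off the circle and
    carried over to it by continuity. And 1 - x may vanish on the path, where log|1-x| is
    meaningless; the factors of 1 - x restrict to polynomials in the parameter, so each is
    identically zero or has finitely many zeros, and at finitely many points continuity of the sum
    is enough. *)

Lemma C_eq (z w : C) : Re z = Re w -> Im z = Im w -> z = w.
Proof. destruct z, w; simpl; intros; subst; reflexivity. Qed.

Lemma Re_mult (z w : C) : Re (z * w)%C = Re z * Re w - Im z * Im w.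
Proof. reflexivity. Qed.
Lemma Im_mult (z w : C) : Im (z * w)%C = Re z * Im w + Im z * Re w.
Proof. reflexivity. Qed.
Lemma Re_inv (z : C) : Re (/ z)%C = Re z / (Re z ^ 2 + Im z ^ 2).
Proof. reflexivity. Qed.
Lemma Im_inv (z : C) : Im (/ z)%C = - Im z / (Re z ^ 2 + Im z ^ 2).
Proof. reflexivity. Qed.

Lemma sqr_neq_0 (z : C) : z <> 0%C -> 0 < Re z ^ 2 + Im z ^ 2.
Proof. intros H. rewrite <- Cmod2_alt. apply pow_lt, Cmod_gt_0, H. Qed.

Definition Cder (f : R -> C) (x : R) (l : C) : Prop :=
  is_derive (fun s => Re (f s)) x (Re l) /\ is_derive (fun s => Im (f s)) x (Im l).

Lemma Cder_ext_loc (f g : R -> C) (x : R) (l : C) :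
  locally x (fun s => f s = g s) -> Cder f x l -> Cder g x l.
Proof.
  intros H [H1 H2]; split.
  - apply is_derive_ext_loc with (2 := H1).
    apply: filter_imp H => s Hs; now rewrite Hs.
  - apply is_derive_ext_loc with (2 := H2).
    apply: filter_imp H => s Hs; now rewrite Hs.
Qed.

Lemma Cder_ext (f g : R -> C) (x : R) (l : C) :
  (forall s, f s = g s) -> Cder f x l -> Cder g x l.
Proof. intros H; apply Cder_ext_loc, filter_forall, H. Qed.

Lemma Cder_unique (f : R -> C) (x : R) (l l' : C) : Cder f x l -> Cder f x l' -> l = l'.
Proof.
  intros [H1 H2] [H3 H4]; apply C_eq.
  - now rewrite <- (is_derive_unique _ _ _ H1), <- (is_derive_unique _ _ _ H3).
  - now rewrite <- (is_derive_unique _ _ _ H2), <- (is_derive_unique _ _ _ H4).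
Qed.

Lemma Cder_eq (f : R -> C) (x : R) (l l' : C) : Cder f x l -> l = l' -> Cder f x l'.
Proof. intros H <-; exact H. Qed.

Lemma Cder_const (c : C) (x : R) : Cder (fun _ => c) x 0%C.
Proof. split; apply: is_derive_const. Qed.

Lemma Cder_id (x : R) : Cder RtoC x 1%C.
Proof. split; [apply: is_derive_id | apply: is_derive_const]. Qed.

Lemma Cder_plus (f g : R -> C) (x : R) (l m : C) :
  Cder f x l -> Cder g x m -> Cder (fun s => f s + g s)%C x (l + m)%C.
Proof. intros [H1 H2] [H3 H4]; split; apply: is_derive_plus; assumption. Qed.

Lemma Cder_opp (f : R -> C) (x : R) (l : C) :
  Cder f x l -> Cder (fun s => - f s)%C x (- l)%C.
Proof. intros [H1 H2]; split; apply: is_derive_opp; assumption. Qed.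

Lemma Cder_minus (f g : R -> C) (x : R) (l m : C) :
  Cder f x l -> Cder g x m -> Cder (fun s => f s - g s)%C x (l - m)%C.
Proof. intros; apply Cder_plus; [assumption | apply Cder_opp; assumption]. Qed.

Lemma is_derive_eq (f : R -> R) (x l l' : R) : is_derive f x l -> l = l' -> is_derive f x l'.
Proof. intros H <-; exact H. Qed.

Lemma is_derive_oppR (f : R -> R) (x l : R) :
  is_derive f x l -> is_derive (fun s => - f s) x (- l).
Proof. apply: is_derive_opp. Qed.

Lemma is_derive_plusR (f g : R -> R) (x l m : R) :
  is_derive f x l -> is_derive g x m -> is_derive (fun s => f s + g s) x (l + m).
Proof. apply: is_derive_plus. Qed.

Lemma is_derive_minusR (f g : R -> R) (x l m : R) :
  is_derive f x l -> is_derive g x m -> is_derive (fun s => f s - g s) x (l - m).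
Proof. apply: is_derive_minus. Qed.

Lemma is_derive_scalR (k : R) (f : R -> R) (x l : R) :
  is_derive f x l -> is_derive (fun s => k * f s) x (k * l).
Proof. apply: is_derive_scal. Qed.

Lemma is_derive_compR (f g : R -> R) (x l m : R) :
  is_derive f (g x) l -> is_derive g x m -> is_derive (fun s => f (g s)) x (m * l).
Proof. apply: is_derive_comp. Qed.

Lemma is_derive_mulR (f g : R -> R) (x l m : R) :
  is_derive f x l -> is_derive g x m -> is_derive (fun s => f s * g s) x (l * g x + f x * m).
Proof. intros H1 H2. apply (is_derive_mult f g x l m H1 H2). intros; apply Rmult_comm. Qed.

Lemma Cder_mult (f g : R -> C) (x : R) (l m : C) :
  Cder f x l -> Cder g x m -> Cder (fun s => f s * g s)%C x (l * g x + f x * m)%C.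
Proof.
  intros [H1 H2] [H3 H4]; split; simpl.
  - eapply is_derive_eq.
    + apply is_derive_minusR; apply is_derive_mulR; eassumption.
    + rewrite /Re /Im /=; ring.
  - eapply is_derive_eq.
    + apply is_derive_plusR; apply is_derive_mulR; eassumption.
    + rewrite /Re /Im /=; ring.
Qed.

Lemma is_derive_divR (f g : R -> R) (x l m : R) :
  is_derive f x l -> is_derive g x m -> g x <> 0 ->
  is_derive (fun s => f s / g s) x ((l * g x - f x * m) / g x ^ 2).
Proof. intros; apply is_derive_div; assumption. Qed.

Lemma Cder_inv (f : R -> C) (x : R) (l : C) :
  Cder f x l -> f x <> 0%C -> Cder (fun s => / f s)%C x (- l / (f x * f x))%C.
Proof.
  intros [H1 H2] Hf. pose proof (sqr_neq_0 _ Hf) as Hn.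
  assert (Hd : is_derive (fun s => Re (f s) ^ 2 + Im (f s) ^ 2) x
                 (2 * Re (f x) * Re l + 2 * Im (f x) * Im l)).
  { eapply is_derive_eq.
    - apply is_derive_plusR; apply is_derive_pow; eassumption.
    - simpl; ring. }
  assert (Hff : (f x * f x <> 0)%C) by now apply Cmult_neq_0.
  assert (E : (- l / (f x * f x) = - l * (/ f x * / f x))%C) by now field.
  rewrite E; split.
  - eapply is_derive_eq.
    + apply (is_derive_divR (fun s => Re (f s)) (fun s => Re (f s) ^ 2 + Im (f s) ^ 2));
        [exact H1 | exact Hd | lra].
    + rewrite !Re_mult !Im_mult Re_inv Im_inv.
      change (Re (- l)%C) with (- Re l); change (Im (- l)%C) with (- Im l).
      field. lra.
  - eapply is_derive_eq.
    + apply (is_derive_divR (fun s => - Im (f s)) (fun s => Re (f s) ^ 2 + Im (f s) ^ 2));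
        [apply is_derive_oppR; exact H2 | exact Hd | lra].
    + rewrite !Im_mult !Re_mult Re_inv Im_inv.
      change (Re (- l)%C) with (- Re l); change (Im (- l)%C) with (- Im l).
      field. lra.
Qed.

Lemma Cder_conj (f : R -> C) (x : R) (l : C) :
  Cder f x l -> Cder (fun s => Cconj (f s)) x (Cconj l).
Proof. intros [H1 H2]; split; [exact H1 | apply: is_derive_opp; exact H2]. Qed.

Lemma ln_Cmod (z : C) : z <> 0%C -> ln (Cmod z) = / 2 * ln (Re z ^ 2 + Im z ^ 2).
Proof.
  intros H. rewrite <- Cmod2_alt.
  assert (0 < Cmod z) by now apply Cmod_gt_0.
  rewrite /= Rmult_1_r ln_mult //. field.
Qed.

Lemma is_derive_ln_Cmod (f : R -> C) (x : R) (l : C) :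
  Cder f x l -> f x <> 0%C -> is_derive (fun s => ln (Cmod (f s))) x (Re (l / f x)%C).
Proof.
  intros [H1 H2] Hf. pose proof (sqr_neq_0 _ Hf) as Hn.
  assert (Hd : is_derive (fun s => Re (f s) ^ 2 + Im (f s) ^ 2) x
                 (2 * Re (f x) * Re l + 2 * Im (f x) * Im l)).
  { eapply is_derive_eq.
    - apply is_derive_plusR; apply is_derive_pow; eassumption.
    - simpl; ring. }
  assert (Hloc : locally x (fun s => 0 < Re (f s) ^ 2 + Im (f s) ^ 2)).
  { assert (Hc : continuous (fun s => Re (f s) ^ 2 + Im (f s) ^ 2) x)
      by (apply: ex_derive_continuous; eexists; exact Hd).
    apply Hc. apply (open_gt 0). exact Hn. }
  apply is_derive_ext_loc with (f := fun s => / 2 * ln (Re (f s) ^ 2 + Im (f s) ^ 2)).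
  { apply: filter_imp Hloc => s Hs. rewrite ln_Cmod // => E.
    rewrite E /= in Hs. lra. }
  eapply is_derive_eq.
  - apply is_derive_scalR. apply (is_derive_compR ln); [apply is_derive_ln; exact Hn | exact Hd].
  - rewrite Re_mult Re_inv Im_inv. field. lra.
Qed.

Lemma Cder_continuous (f : R -> C) (x : R) (l : C) : Cder f x l -> continuous f x.
Proof.
  intros [H1 H2].
  apply (continuous_ext (fun s => (Re (f s), Im (f s)))).
  { intros s; now destruct (f s). }
  apply: continuous_comp_2.
  - apply: ex_derive_continuous; eexists; exact H1.
  - apply: ex_derive_continuous; eexists; exact H2.
  - simpl. apply (continuous_ext (fun z => z)); [intros []; reflexivity | apply continuous_id].
Qed.

(** Splitting the interval at the points of [l] removes them one by one; only continuity is required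
    there. The number [c] is a differential at a fixed point when a total differential is proved,
    and 0 when a function is shown to be constant. *)
Lemma mean_value_except (l : list R) (f f' : R -> R) (c eps : R) : forall a b : R, a <= b ->
  (forall s, a <= s <= b -> continuous f s) ->
  (forall s, a < s < b -> ~ In s l -> is_derive f s (f' s) /\ Rabs (f' s - c) <= eps) ->
  Rabs (f b - f a - c * (b - a)) <= eps * (b - a).
Proof.
  induction l as [|r l IH]; intros a b Hab Hc Hd.
  - destruct (Req_dec a b) as [<-|Hne].
    { replace (f a - f a - c * (a - a)) with 0 by ring. rewrite Rabs_R0; lra. }
    assert (Hlt : a < b) by lra.
    (* [MVT_gen] may return an end point, where nothing is known about [f']; the candidate
       derivative is set to [c] there, which makes the estimate trivial. *)
    destruct (MVT_gen f a b (fun s => match Rle_dec s a, Rle_dec b s with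
                                right _, right _ => f' s | _, _ => c end))
      as [s [Hs E]].
    + rewrite Rmin_left // Rmax_right // => s Hs.
      destruct Rle_dec; [lra|]. destruct Rle_dec; [lra|]. apply Hd; simpl; tauto.
    + rewrite Rmin_left // Rmax_right // => s Hs. apply continuity_pt_filterlim, Hc, Hs.
    + rewrite Rmin_left // Rmax_right // in Hs.
      rewrite E -Rmult_minus_distr_r Rabs_mult (Rabs_pos_eq (b - a)); [|lra].
      apply Rmult_le_compat_r; [lra|].
      assert (0 <= eps).
      { destruct (Hd ((a + b) / 2)) as [_ H]; [lra | tauto|].
        eapply Rle_trans; [apply Rabs_pos | exact H]. }
      destruct Rle_dec; [rewrite Rminus_eq_0 Rabs_R0; lra|].
      destruct Rle_dec; [rewrite Rminus_eq_0 Rabs_R0; lra|].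
      apply Hd; simpl; tauto || lra.
  - destruct (Rlt_dec a r) as [H1|H1]; [destruct (Rlt_dec r b) as [H2|H2]|].
    + assert (A : Rabs (f r - f a - c * (r - a)) <= eps * (r - a)).
      { apply IH; [lra | intros; apply Hc; lra|].
        intros s Hs Hl; apply Hd; [lra|]. intros [|]; [lra | auto]. }
      assert (B : Rabs (f b - f r - c * (b - r)) <= eps * (b - r)).
      { apply IH; [lra | intros; apply Hc; lra|].
        intros s Hs Hl; apply Hd; [lra|]. intros [|]; [lra | auto]. }
      replace (f b - f a - c * (b - a)) with
        ((f b - f r - c * (b - r)) + (f r - f a - c * (r - a))) by ring.
      eapply Rle_trans; [apply Rabs_triang | lra].
    + apply IH; [lra | exact Hc|]. intros s Hs Hl; apply Hd; [lra|]. intros [|]; [lra | auto].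
    + apply IH; [lra | exact Hc|]. intros s Hs Hl; apply Hd; [lra|]. intros [|]; [lra | auto].
Qed.

(** * Termwise differentiation and polylogarithm series *)

Lemma is_derive_eps (f : R -> R) (x l : R) :
  (forall eps, 0 < eps -> exists d, 0 < d /\
     forall y, Rabs (y - x) < d -> Rabs (f y - f x - l * (y - x)) <= eps * Rabs (y - x)) <->
  is_derive f x l.
Proof.
  rewrite is_derive_Reals; split.
  - intros H eps He. destruct (H (eps / 2)) as [d [Hd H']]; [lra|].
    exists (mkposreal d Hd) => h Hh0 Hh.
    specialize (H' (x + h)). replace (x + h - x) with h in H' by ring.
    specialize (H' Hh).
    replace ((f (x + h) - f x) / h - l) with ((f (x + h) - f x - l * h) / h) by now field.
    rewrite Rabs_div //. apply Rlt_div_l; [now apply Rabs_pos_lt|].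
    eapply Rle_lt_trans; [exact H'|]. apply Rmult_lt_compat_r; [now apply Rabs_pos_lt | lra].
  - intros H eps He. destruct (H eps He) as [d H'].
    exists d; split; [apply cond_pos|]. intros y Hy.
    destruct (Req_dec y x) as [->|Hne].
    { rewrite !Rminus_eq_0 Rmult_0_r Rminus_eq_0 Rabs_R0; lra. }
    specialize (H' (y - x)). replace (x + (y - x)) with y in H' by ring.
    assert (Hyx : y - x <> 0) by lra.
    specialize (H' Hyx Hy).
    replace (f y - f x - l * (y - x)) with (((f y - f x) / (y - x) - l) * (y - x)) by now field.
    rewrite Rabs_mult. apply Rmult_le_compat_r; [apply Rabs_pos | lra].
Qed.

Lemma lipschitz_derive (f f' : R -> R) (M x y : R) :
  (forall s, Rmin x y <= s <= Rmax x y -> is_derive f s (f' s) /\ Rabs (f' s) <= M) ->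
  Rabs (f y - f x) <= M * Rabs (y - x).
Proof.
  assert (W : forall x y, x <= y ->
    (forall s, Rmin x y <= s <= Rmax x y -> is_derive f s (f' s) /\ Rabs (f' s) <= M) ->
    Rabs (f y - f x) <= M * (y - x)).
  { intros a b Hab H. rewrite Rmin_left // Rmax_right // in H.
    pose proof (mean_value_except [] f f' 0 M a b Hab) as A.
    replace (f b - f a) with (f b - f a - 0 * (b - a)) by ring. apply A.
    - intros s Hs. apply: ex_derive_continuous. eexists. apply H, Hs.
    - intros s Hs _. rewrite Rminus_0_r. apply H; lra. }
  intros H. destruct (Rle_dec x y) as [Hxy|Hxy].
  - rewrite (Rabs_pos_eq (y - x)); [|lra]. now apply W.
  - rewrite -(Rabs_Ropp (y - x)) -(Rabs_Ropp (f y - f x)) !Ropp_minus_distr.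
    rewrite (Rabs_pos_eq (x - y)); [|lra]. apply W; [lra|].
    now rewrite Rmin_comm Rmax_comm.
Qed.

Lemma Series_tail_small (M : nat -> R) (eps : R) : ex_series M -> 0 < eps ->
  exists N, Rabs (Series (fun k => M (S N + k)%nat)) < eps.
Proof.
  intros HM He.
  pose proof (Series_correct _ HM) as H. apply is_series_Reals in H.
  destruct (H eps He) as [N HN]. exists N.
  specialize (HN N (le_n N)). unfold Rdist in HN.
  rewrite (Series_incr_n M (S N)) // in HN; [|lia]. simpl pred in HN.
  rewrite -Rabs_Ropp.
  replace (- Series (fun k => M (S N + k)%nat)) with
    (sum_f_R0 M N - (sum_f_R0 M N + Series (fun k => M (S N + k)%nat))) by ring.
  exact HN.
Qed.

Lemma Rabs_Series_le (a M : nat -> R) :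
  (forall n, Rabs (a n) <= M n) -> ex_series M -> Rabs (Series a) <= Series M.
Proof.
  intros H HM. eapply Rle_trans.
  - apply Series_Rabs. apply: (ex_series_le _ M) HM => n.
    rewrite /norm /= /abs /= Rabs_Rabsolu. apply H.
  - apply Series_le => // n. split; [apply Rabs_pos | apply H].
Qed.

Lemma ex_series_dom (a M : nat -> R) :
  (forall n, Rabs (a n) <= M n) -> ex_series M -> ex_series a.
Proof. intros H HM. apply: (ex_series_le a M) HM => n. apply H. Qed.

Lemma is_derive_sum (f : nat -> R -> R) (l : nat -> R) (x : R) (N : nat) :
  (forall n, (n <= N)%nat -> is_derive (f n) x (l n)) ->
  is_derive (fun y => sum_f_R0 (fun n => f n y) N) x (sum_f_R0 l N).
Proof.
  induction N as [|N IH]; intros H; simpl.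
  - now apply H.
  - apply is_derive_plusR; [apply IH; intros; apply H; lia | now apply H].
Qed.

Lemma is_derive_Series (f f' : nat -> R -> R) (M : nat -> R) (x r : R) : 0 < r ->
  (forall n y, Rabs (y - x) < r -> is_derive (f n) y (f' n y) /\ Rabs (f' n y) <= M n) ->
  ex_series M ->
  (forall y, Rabs (y - x) < r -> ex_series (fun n => f n y)) ->
  is_derive (fun y => Series (fun n => f n y)) x (Series (fun n => f' n x)).
Proof.
  intros Hr Hd HM Hf.
  assert (Hx : Rabs (x - x) < r) by (rewrite Rminus_eq_0 Rabs_R0; lra).
  assert (Hf' : ex_series (fun n => f' n x)).
  { apply ex_series_dom with M => // n. now apply Hd. }
  apply is_derive_eps => eps He.
  (* The tail of [M] enters twice, through the increments of the [f n], which are Lipschitz with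
     constant [M n], and through the derivatives; hence a quarter here and a half for the partial
     sum. *)
  destruct (Series_tail_small M (eps / 4) HM) as [N HN]; [lra|].
  assert (Hs : is_derive (fun y => sum_f_R0 (fun n => f n y) N) x (sum_f_R0 (fun n => f' n x) N)).
  { apply is_derive_sum => n _. now apply Hd. }
  destruct (proj2 (is_derive_eps _ _ _) Hs (eps / 2)) as [d [Hd0 Hd1]]; [lra|].
  exists (Rmin d r); split; [now apply Rmin_pos|]. intros y Hy.
  assert (Hy1 : Rabs (y - x) < d) by (eapply Rlt_le_trans; [exact Hy | apply Rmin_l]).
  assert (Hy2 : Rabs (y - x) < r) by (eapply Rlt_le_trans; [exact Hy | apply Rmin_r]).
  assert (HN0 : (0 < S N)%nat) by lia.
  rewrite (Series_incr_n (fun n => f n y) (S N) HN0 (Hf y Hy2)).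
  rewrite (Series_incr_n (fun n => f n x) (S N) HN0 (Hf x Hx)).
  rewrite (Series_incr_n (fun n => f' n x) (S N) HN0 Hf'). simpl pred.
  set (sy := sum_f_R0 _ N). set (sx := sum_f_R0 _ N). set (s' := sum_f_R0 _ N).
  assert (E : forall A B D, sy + A - (sx + B) - (s' + D) * (y - x)
    = (sy - sx - s' * (y - x)) + (A - B - (y - x) * D)) by (intros; ring).
  rewrite E. eapply Rle_trans; [apply Rabs_triang|].
  specialize (Hd1 y Hy1). fold sy sx s' in Hd1.
  assert (T : forall g : nat -> R, ex_series g -> ex_series (fun k => g (S N + k)%nat)).
  { intros g Hg. now apply (ex_series_incr_n g (S N)). }
  pose proof (T _ (Hf y Hy2)) as Ty. pose proof (T _ (Hf x Hx)) as Tx. pose proof (T _ Hf') as T'.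
  rewrite -Series_scal_l -(Series_minus _ _ Ty Tx) -Series_minus;
    [|exact (ex_series_minus _ _ Ty Tx) | exact (ex_series_scal_l (y - x) _ T')].
  assert (B : Rabs (Series (fun n => f (S N + n)%nat y - f (S N + n)%nat x - (y - x) * f' (S N + n)%nat x))
     <= Series (fun k => (2 * Rabs (y - x)) * M (S N + k)%nat)).
  { apply Rabs_Series_le.
    - intros n. eapply Rle_trans; [apply Rabs_triang|]. rewrite Rabs_Ropp Rabs_mult.
      assert (A1 : Rabs (f (S N + n)%nat y - f (S N + n)%nat x) <= M (S N + n)%nat * Rabs (y - x)).
      { apply lipschitz_derive with (f' (S N + n)%nat) => z Hz. apply Hd.
        revert Hz Hy2. unfold Rmin, Rmax, Rabs.
        repeat destruct Rle_dec; repeat destruct Rcase_abs; lra. }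
      pose proof (proj2 (Hd (S N + n)%nat x Hx)).
      pose proof (Rabs_pos (y - x)). nra.
    - apply: (ex_series_scal_l (2 * Rabs (y - x))). now apply T. }
  rewrite Series_scal_l in B.
  assert (Series (fun k => M (S N + k)%nat) < eps / 4).
  { eapply Rle_lt_trans; [apply Rle_abs | exact HN]. }
  pose proof (Rabs_pos (y - x)).
  eapply Rle_trans; [apply (Rplus_le_compat _ _ _ _ Hd1 B)|]. nra.
Qed.

Lemma ex_series_inv_sqr : ex_series (fun n => / INR (S n) ^ 2).
Proof.
  (* A telescoping majorant: 1/N^2 <= 2 (1/N - 1/(N+1)) for N >= 1. *)
  apply ex_series_dom with (fun n => 2 * (/ INR (S n) - / INR (S (S n)))).
  - intros n. rewrite (S_INR (S n)). assert (0 < INR (S n)) by (apply lt_0_INR; lia).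
    set (x := INR (S n)) in *. assert (1 <= x) by (apply (le_INR 1); lia).
    rewrite Rabs_pos_eq; [|apply Rlt_le, Rinv_0_lt_compat; nra].
    replace (2 * (/ x - / (x + 1))) with (2 / (x * (x + 1))) by (field; lra).
    apply Rmult_le_reg_r with (x ^ 2 * (x + 1)); [nra|].
    replace (/ x ^ 2 * (x ^ 2 * (x + 1))) with (x + 1) by (field; lra).
    replace (2 / (x * (x + 1)) * (x ^ 2 * (x + 1))) with (2 * x) by (field; lra).
    lra.
  - apply: ex_series_scal_l. exists 1.
    apply is_series_Reals. intros eps He.
    destruct (archimed_cor1 eps He) as [N [HN HN0]]. exists N => n Hn.
    assert (E : forall n, sum_f_R0 (fun n => / INR (S n) - / INR (S (S n))) n = 1 - / INR (S (S n))).
    { induction n0 as [|k IH]; [simpl; field|]. rewrite tech5 IH. ring. }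
    rewrite E /Rdist. replace (1 - / INR (S (S n)) - 1) with (- / INR (S (S n))) by ring.
    rewrite Rabs_Ropp Rabs_pos_eq.
    + eapply Rle_lt_trans; [|exact HN]. apply Rinv_le_contravar; [apply lt_0_INR; lia | apply le_INR; lia].
    + apply Rlt_le, Rinv_0_lt_compat, lt_0_INR; lia.
Qed.

Definition Csum (a : nat -> C) : C := (Series (fun n => Re (a n)), Series (fun n => Im (a n))).

Lemma im_le_Cmod (z : C) : Rabs (Im z) <= Cmod z.
Proof.
  apply Rsqr_incr_0; [|apply Rabs_pos | apply Cmod_ge_0].
  rewrite -Rsqr_abs !Rsqr_pow2 Cmod2_alt. nra.
Qed.

Definition Cdom (a : nat -> C) (M : nat -> R) : Prop :=
  (forall n, Cmod (a n) <= M n) /\ ex_series M.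

Lemma Cdom_re (a : nat -> C) (M : nat -> R) : Cdom a M -> ex_series (fun n => Re (a n)).
Proof.
  intros [H1 H2]; apply ex_series_dom with M => // n.
  eapply Rle_trans; [apply re_le_Cmod | apply H1].
Qed.
Lemma Cdom_im (a : nat -> C) (M : nat -> R) : Cdom a M -> ex_series (fun n => Im (a n)).
Proof.
  intros [H1 H2]; apply ex_series_dom with M => // n.
  eapply Rle_trans; [apply im_le_Cmod | apply H1].
Qed.

Lemma Csum_ext (a b : nat -> C) : (forall n, a n = b n) -> Csum a = Csum b.
Proof. intros H; unfold Csum; f_equal; apply Series_ext => n; now rewrite H. Qed.

Lemma Csum_mult_r (a : nat -> C) (M : nat -> R) (w : C) :
  Cdom a M -> Csum (fun n => a n * w)%C = (Csum a * w)%C.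
Proof.
  intros H. pose proof (Cdom_re _ _ H) as H1. pose proof (Cdom_im _ _ H) as H2.
  apply C_eq.
  - rewrite Re_mult /=.
    rewrite -!Series_scal_r -Series_minus; [reflexivity| |]; now apply ex_series_scal_r.
  - rewrite Im_mult /=.
    rewrite -!Series_scal_r -Series_plus; [reflexivity| |]; now apply ex_series_scal_r.
Qed.

Lemma Csum_first (a : nat -> C) (M : nat -> R) :
  Cdom a M -> Csum a = (a O + Csum (fun n => a (S n)))%C.
Proof.
  intros H. apply C_eq.
  - change (Re (Csum a)) with (Series (fun n => Re (a n))). rewrite Series_incr_1 //. eapply Cdom_re, H.
  - change (Im (Csum a)) with (Series (fun n => Im (a n))). rewrite Series_incr_1 //. eapply Cdom_im, H.
Qed.

Lemma Cder_Csum (f f' : nat -> R -> C) (M N : nat -> R) (x r : R) : 0 < r ->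
  (forall n y, Rabs (y - x) < r -> Cder (f n) y (f' n y) /\ Cmod (f' n y) <= M n /\ Cmod (f n y) <= N n) ->
  ex_series M -> ex_series N ->
  Cder (fun y => Csum (fun n => f n y)) x (Csum (fun n => f' n x)).
Proof.
  intros Hr H HM HN; split.
  - apply (is_derive_Series (fun n y => Re (f n y)) (fun n y => Re (f' n y)) M x r) => //.
    + intros n y Hy. destruct (H n y Hy) as [[A _] [B _]]; split => //.
      eapply Rle_trans; [apply re_le_Cmod | exact B].
    + intros y Hy. apply (Cdom_re _ N); split => // n. now apply H.
  - apply (is_derive_Series (fun n y => Im (f n y)) (fun n y => Im (f' n y)) M x r) => //.
    + intros n y Hy. destruct (H n y Hy) as [[_ A] [B _]]; split => //.
      eapply Rle_trans; [apply im_le_Cmod | exact B].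
    + intros y Hy. apply (Cdom_im _ N); split => // n. now apply H.
Qed.

Definition Literm (k : nat) (z : C) (n : nat) : C := (Cpow z (S n) / Cpow (RtoC (INR (S n))) k)%C.

Lemma Li_Csum (k : nat) (z : C) : Li k z = Csum (Literm k z).
Proof. reflexivity. Qed.

Lemma INR_S_neq_0 (n : nat) : RtoC (INR (S n)) <> 0%C.
Proof. intros E. apply RtoC_inj in E. revert E. apply not_0_INR; lia. Qed.

Lemma Cmod_div_pow (w : C) (k n : nat) :
  Cmod (w / Cpow (RtoC (INR (S n))) k)%C <= Cmod w.
Proof.
  rewrite Cmod_div; [|apply Cpow_nz, INR_S_neq_0].
  rewrite Cmod_pow Cmod_R.
  assert (1 <= Rabs (INR (S n)) ^ k).
  { apply pow_R1_Rle. rewrite Rabs_pos_eq; [apply (le_INR 1); lia | apply pos_INR]. }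
  pose proof (Cmod_ge_0 w).
  apply Rmult_le_reg_r with (Rabs (INR (S n)) ^ k); [lra|].
  unfold Rdiv. rewrite Rmult_assoc Rinv_l; [nra | lra].
Qed.

(** The series of Li_k(z)/z. It gives the derivative of Li_(k+1) at 0 as well, which matters when
    one integrates from 0 in [Re_Li_1]. *)
Definition dLiterm (k : nat) (z : C) (n : nat) : C := (Cpow z n / Cpow (RtoC (INR (S n))) k)%C.

Lemma dLi_dom (k : nat) (z : C) : Cmod z < 1 -> Cdom (dLiterm k z) (fun n => Cmod z ^ n).
Proof.
  intros Hz; split.
  - intros n. eapply Rle_trans; [apply Cmod_div_pow|]. rewrite Cmod_pow; lra.
  - apply ex_series_geom. rewrite Rabs_pos_eq //. apply Cmod_ge_0.
Qed.

Lemma Li_dLi (k : nat) (z : C) : Cmod z < 1 -> Li k z = (Csum (dLiterm k z) * z)%C.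
Proof.
  intros Hz. rewrite Li_Csum -(Csum_mult_r _ _ _ (dLi_dom k z Hz)).
  apply Csum_ext => n. unfold Literm, dLiterm. rewrite Cpow_S /Cdiv. ring.
Qed.

Lemma Li_dom (k : nat) (z : C) : Cmod z < 1 -> Cdom (Literm k z) (fun n => Cmod z ^ n).
Proof.
  intros Hz; split.
  - intros n. eapply Rle_trans; [apply Cmod_div_pow|]. rewrite Cpow_S Cmod_mult Cmod_pow.
    pose proof (pow_le (Cmod z) n (Cmod_ge_0 z)). pose proof (Cmod_ge_0 z). nra.
  - apply ex_series_geom. rewrite Rabs_pos_eq //. apply Cmod_ge_0.
Qed.

Lemma dLi_0 (z : C) : Cmod z < 1 -> (Csum (dLiterm 0 z) * (1 - z) = 1)%C.
Proof.
  intros Hz. pose proof (Csum_first _ _ (dLi_dom 0 z Hz)) as E.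
  assert (E2 : Csum (fun n => dLiterm 0 z (S n)) = (Csum (dLiterm 0 z) * z)%C).
  { rewrite -(Csum_mult_r _ _ _ (dLi_dom 0 z Hz)). apply Csum_ext => n.
    unfold dLiterm. rewrite Cpow_S /=. field. }
  rewrite E2 in E. replace (dLiterm 0 z 0) with (RtoC 1) in E.
  - replace (RtoC 1) with (Csum (dLiterm 0 z) - Csum (dLiterm 0 z) * z)%C at 2; [ring|].
    rewrite {1}E. ring.
  - unfold dLiterm; simpl. field.
Qed.

Lemma Cder_pow (f : R -> C) (x : R) (l : C) (n : nat) :
  Cder f x l -> Cder (fun s => Cpow (f s) (S n)) x (INR (S n) * Cpow (f x) n * l)%C.
Proof.
  intros H. induction n as [|n IH].
  - eapply Cder_ext with f; [intros; simpl; ring|]. replace (INR 1 * f x ^ 0 * l)%C with l; [exact H|].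
    simpl; ring.
  - eapply Cder_ext with (fun s => f s * Cpow (f s) (S n))%C; [reflexivity|].
    replace (INR (S (S n)) * f x ^ (S n) * l)%C with
      (l * Cpow (f x) (S n) + f x * (INR (S n) * f x ^ n * l))%C; [now apply Cder_mult|].
    rewrite (S_INR (S n)) RtoC_plus !Cpow_S. ring.
Qed.

Lemma Cder_affine (z h : C) (x : R) : Cder (fun s => z + s * h)%C x h.
Proof.
  eapply Cder_eq; [apply Cder_plus; [apply Cder_const|]; apply Cder_mult; [apply Cder_id | apply Cder_const]|].
  cbv beta; ring.
Qed.

Lemma Cder_scal (k : C) (f : R -> C) (x : R) (l : C) :
  Cder f x l -> Cder (fun s => f s * k)%C x (l * k)%C.
Proof.
  intros H. replace (l * k)%C with (l * k + f x * 0)%C by ring.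
  apply (Cder_mult f (fun _ => k)); [exact H | apply Cder_const].
Qed.

Lemma Cder_Li_affine (k : nat) (z h : C) (x : R) : Cmod (z + x * h)%C < 1 ->
  Cder (fun s => Li (S k) (z + s * h)%C) x (Csum (dLiterm k (z + x * h)%C) * h)%C.
Proof.
  intros Hx. set (w := (z + x * h)%C) in *.
  (* Any [q] strictly between [Cmod w] and 1 yields a geometric majorant. The radius used below
     keeps [z + s * h] in the disc of radius [q]; its denominator [Cmod h + 1] also covers
     [h = 0]. *)
  set (q := (1 + Cmod w) / 2).
  assert (Hq : Cmod w < q < 1) by (unfold q; lra).
  pose proof (Cmod_ge_0 w) as Hw0. pose proof (Cmod_ge_0 h) as Hh0.
  assert (Hgeo : ex_series (fun n => q ^ n)).
  { apply ex_series_geom. rewrite Rabs_pos_eq; lra. }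
  rewrite -(Csum_mult_r _ _ _ (dLi_dom k w Hx)).
  apply (Cder_Csum (fun n s => Literm (S k) (z + s * h)%C n) (fun n s => dLiterm k (z + s * h)%C n * h)%C
    (fun n => q ^ n * Cmod h) (fun n => q ^ n) x ((q - Cmod w) / (Cmod h + 1))).
  - apply Rdiv_lt_0_compat; lra.
  - intros n s Hs.
    assert (Hm : Cmod (z + s * h)%C <= q).
    { replace (z + s * h)%C with (w + (RtoC (s - x)) * h)%C by (unfold w; rewrite RtoC_minus; ring).
      eapply Rle_trans; [apply Cmod_triangle|]. rewrite Cmod_mult Cmod_R.
      apply Rlt_div_r in Hs; [|lra]. pose proof (Rabs_pos (s - x)). nra. }
    pose proof (Cmod_ge_0 (z + s * h)%C) as Hm0.
    assert (Hp : forall n, Cmod (z + s * h)%C ^ n <= q ^ n) by (intros; now apply pow_incr).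
    split; [|split].
    + unfold Literm, dLiterm, Cdiv.
      pose proof (Cder_scal (/ INR (S n) ^ S k)%C _ _ _ (Cder_pow _ _ _ n (Cder_affine z h s))) as A.
      replace ((z + s * h) ^ n * / INR (S n) ^ k * h)%C with
        (INR (S n) * (z + s * h) ^ n * h * / INR (S n) ^ S k)%C; [exact A|].
      pose proof (INR_S_neq_0 n). rewrite (Cpow_S (INR (S n))).
      field. split; [|assumption]. now apply Cpow_nz.
    + rewrite Cmod_mult. apply Rmult_le_compat_r => //.
      eapply Rle_trans; [apply Cmod_div_pow|]. rewrite Cmod_pow. apply Hp.
    + eapply Rle_trans; [apply Cmod_div_pow|]. rewrite Cpow_S Cmod_mult Cmod_pow.
      specialize (Hp n). pose proof (pow_le _ n Hm0). nra.
  - now apply ex_series_scal_r.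
  - exact Hgeo.
Qed.

Lemma Li_0 (z : C) : Cmod z < 1 -> Li 0 z = (z / (1 - z))%C.
Proof.
  intros Hz. rewrite Li_dLi //. pose proof (dLi_0 z Hz) as E.
  assert (1 - z <> 0)%C.
  { intros E0. rewrite E0 Cmult_0_r in E. apply C1_nz. now rewrite E. }
  replace z with (Csum (dLiterm 0 z) * (1 - z) * z)%C at 3 by (rewrite E; ring).
  field. assumption.
Qed.

Lemma Cder_Li (k : nat) (z h : C) (x : R) : (z + x * h <> 0)%C -> Cmod (z + x * h)%C < 1 ->
  Cder (fun s => Li (S k) (z + s * h)%C) x (Li k (z + x * h)%C * (h / (z + x * h)))%C.
Proof.
  intros H0 H1. rewrite Li_dLi //.
  replace (Csum (dLiterm k (z + x * h)) * (z + x * h) * (h / (z + x * h)))%C with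
    (Csum (dLiterm k (z + x * h)) * h)%C by (now field).
  now apply Cder_Li_affine.
Qed.

(** Both sides vanish at 0 and have the same derivative along the segment from 0 to [z]. *)
Lemma Re_Li_1 (z : C) : Cmod z < 1 -> Re (Li 1 z) = - ln (Cmod (1 - z)%C).
Proof.
  intros Hz.
  assert (Hs : forall s, 0 <= s <= 1 -> Cmod (0 + s * z)%C < 1).
  { intros s Hs. rewrite Cplus_0_l Cmod_mult Cmod_R Rabs_pos_eq; [|lra].
    pose proof (Cmod_ge_0 z). nra. }
  assert (Hd : forall s, 0 <= s <= 1 ->
     is_derive (fun s : R => Re (Li 1 (0 + s * z)%C) + ln (Cmod (1 - (0 + s * z))%C)) s 0).
  { intros s Hs1. pose proof (dLi_0 _ (Hs s Hs1)) as E.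
    assert (Hn : (1 - (0 + s * z) <> 0)%C).
    { intros E0. rewrite E0 Cmult_0_r in E. apply C1_nz. now rewrite E. }
    eapply is_derive_eq.
    - apply is_derive_plusR.
      + apply (proj1 (Cder_Li_affine 0 0 z s (Hs s Hs1))).
      + apply is_derive_ln_Cmod; [|exact Hn].
        apply Cder_minus; [apply Cder_const | apply Cder_affine].
    - set (A := Csum _) in *. set (B := (1 - (0 + s * z))%C) in *.
      replace A with (/ B)%C.
      + change (Re (/ B * z)%C + Re ((0 - z) / B)%C) with (Re (/ B * z + (0 - z) / B)%C).
        replace (/ B * z + (0 - z) / B)%C with (RtoC 0) by now field. reflexivity.
      + replace (/ B)%C with (A * B * / B)%C by (rewrite E; now field). now field. }
  pose proof (mean_value_except [] (fun s : R => Re (Li 1 (0 + s * z)%C) + ln (Cmod (1 - (0 + s * z))%C))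
     (fun _ => 0) 0 0 0 1) as MV. cbv beta in MV.
  rewrite (_ : (0 + 1 * z = z)%C) in MV; [|ring].
  rewrite (_ : (0 + 0 * z = 0)%C) in MV; [|ring].
  assert (L0 : Re (Li 1 0) = 0).
  { rewrite Li_dLi; [|rewrite Cmod_0; lra]. rewrite Cmult_0_r. reflexivity. }
  rewrite L0 (_ : (1 - 0 = 1)%C) in MV; [|ring]. rewrite Cmod_1 ln_1 in MV.
  assert (T : Rabs (Re (Li 1 z) + ln (Cmod (1 - z)) - (0 + 0) - 0 * (1 - 0)) <= 0 * (1 - 0)).
  { apply MV; [lra| |].
    - intros s Hs1. apply: ex_derive_continuous; eexists; apply Hd, Hs1.
    - intros s Hs1 _; split; [apply Hd; lra|]. rewrite Rminus_0_r Rabs_R0; lra. }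
  rewrite (_ : 0 * (1 - 0) = 0) in T; [|ring].
  apply Rabs_le_between in T. lra.
Qed.

(** * The one-valued logarithm as a uniformly convergent series *)

(* [2 ^ r * B_r / r!], for [r <= 6] only. *)
Definition bcoef (r : nat) : R :=
  match r with
  | 0%nat => 1 | 1%nat => -1 | 2%nat => / 3 | 4%nat => - / 45 | 6%nat => 2 / 945 | _ => 0
  end.

(** For m <= 7 this is the Taylor polynomial of degree m - 1 of 2x/(e^(2x) - 1) = x coth x - x. *)
Definition bsum (m : nat) (x : R) : R := sum_f_R0 (fun r => bcoef r * x ^ r) (m - 1).

(** The reflection in the unit circle is used instead of the inversion 1/z. Conjugation multiplies
    L_m by (-1)^(m-1), as inversion does, so that the reflection leaves L_m unchanged for either
    parity of m. It also fixes the circle pointwise, hence the two branches fit together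
    continuously. *)
Definition into_disc (z : C) : C :=
  match Rle_dec (Cmod z) 1 with left _ => z | right _ => (/ Cconj z)%C end.

(** All contributions of z^N, N = n + 1, to L_m are collected: (log|z|)^r / N^(m-r) = (N log|z|)^r /
    N^m. The collected terms have a summable majorant up to the unit circle, which those of the
    separate series Li_1 do not. *)
Definition svlog_term (m n : nat) (z : C) : R :=
  bsum m (INR (S n) * ln (Cmod (into_disc z))) *
  Re_parity m (Cpow (into_disc z) (S n)) / INR (S n) ^ m.

Definition svlog (m : nat) (z : C) : R := Series (fun n => svlog_term m n z).

Lemma Cconj_neq_0 (z : C) : z <> 0%C -> Cconj z <> 0%C.
Proof. intros H E. apply H. apply Cmod_eq_0. rewrite -Cmod_conj E. apply Cmod_0. Qed.

Lemma into_disc_neq_0 (z : C) : z <> 0%C -> into_disc z <> 0%C.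
Proof.
  intros H. unfold into_disc. destruct Rle_dec => //.
  intros E. apply (Cconj_neq_0 _ H). apply Cmod_eq_0.
  rewrite -(Rinv_inv (Cmod (Cconj z))) -Cmod_inv; [|now apply Cconj_neq_0].
  rewrite E Cmod_0. apply Rinv_0.
Qed.

Lemma Cmod_into_disc (z : C) : Cmod (into_disc z) <= 1.
Proof.
  unfold into_disc. destruct Rle_dec => //.
  assert (Hz : z <> 0%C) by (intros E; rewrite E Cmod_0 in n; lra).
  rewrite Cmod_inv; [|now apply Cconj_neq_0]. rewrite Cmod_conj.
  rewrite -Rinv_1. apply Rinv_le_contravar; lra.
Qed.

Lemma ln_into_disc (z : C) : z <> 0%C -> ln (Cmod (into_disc z)) = - Rabs (ln (Cmod z)).
Proof.
  intros H. apply Cmod_gt_0 in H as H'. unfold into_disc. destruct Rle_dec.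
  - rewrite Rabs_left1; [ring|]. rewrite -ln_1. now apply ln_le.
  - rewrite Cmod_inv; [|now apply Cconj_neq_0]. rewrite Cmod_conj ln_Rinv // Rabs_pos_eq //.
    rewrite -ln_1. apply ln_le; lra.
Qed.

Lemma exp_pow_le (r : nat) (x : R) : x <= 0 -> exp x * Rabs x ^ r <= INR (fact r).
Proof.
  intros Hx. rewrite Rabs_left1 //.
  assert (Hf : 0 < INR (fact r)) by apply INR_fact_lt_0.
  assert (A : (- x) ^ r / INR (fact r) <= exp (- x)).
  { eapply Rle_trans; [|apply (exp_ge_taylor (- x) r); lra].
    assert (P : forall k, 0 <= (- x) ^ k / INR (fact k)).
    { intros k. apply Rdiv_le_0_compat; [apply pow_le; lra | apply INR_fact_lt_0]. }
    destruct r; [apply Rle_refl|]. rewrite tech5.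
    assert (0 <= sum_f_R0 (fun k => (- x) ^ k / INR (fact k)) r) by (apply cond_pos_sum, P).
    lra. }
  apply Rle_div_l in A => //. rewrite exp_Ropp in A.
  pose proof (exp_pos x).
  apply (Rmult_le_compat_l (exp x)) in A; [|lra].
  rewrite -Rmult_assoc Rinv_r in A; lra.
Qed.

(** On the negative axis the exponential absorbs every power of x. The extra factor 1 + |x| becomes
    the decay of L_m near 0 and infinity. *)
Lemma exp_bsum_le (m : nat) : exists K, 0 <= K /\
  forall x, x <= 0 -> exp x * Rabs (bsum m x) * (1 + Rabs x) <= K.
Proof.
  unfold bsum. induction (m - 1)%nat as [|k [K [HK IH]]].
  - exists (1 + 1). split; [lra|]. intros x Hx. simpl. rewrite !Rmult_1_r Rabs_R1.
    pose proof (exp_pow_le 0 x Hx). pose proof (exp_pow_le 1 x Hx). simpl in *. lra.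
  - exists (K + Rabs (bcoef (S k)) * (INR (fact (S k)) + INR (fact (S (S k))))).
    pose proof (Rabs_pos (bcoef (S k))) as HB.
    split.
    { pose proof (pos_INR (fact (S k))). pose proof (pos_INR (fact (S (S k)))). nra. }
    intros x Hx. rewrite tech5.
    pose proof (Rabs_triang (sum_f_R0 (fun r => bcoef r * x ^ r) k) (bcoef (S k) * x ^ S k)) as T.
    rewrite Rabs_mult -RPow_abs in T.
    specialize (IH x Hx).
    pose proof (exp_pow_le (S k) x Hx) as A. pose proof (exp_pow_le (S (S k)) x Hx) as B.
    rewrite (_ : Rabs x ^ S (S k) = Rabs x ^ S k * Rabs x) in B; [|simpl; ring].
    pose proof (exp_pos x). pose proof (Rabs_pos x).
    set (S1 := Rabs (sum_f_R0 _ k)) in *. set (S2 := Rabs (_ + _)) in *.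
    set (X := Rabs x ^ S k) in *.
    assert (exp x * S2 * (1 + Rabs x) <= exp x * (S1 + Rabs (bcoef (S k)) * X) * (1 + Rabs x)).
    { apply Rmult_le_compat_r; [lra|]. apply Rmult_le_compat_l; lra. }
    pose proof (Rmult_le_compat_l _ _ _ HB A). pose proof (Rmult_le_compat_l _ _ _ HB B). lra.
Qed.

Lemma Re_parity_le (m : nat) (z : C) : Rabs (Re_parity m z) <= Cmod z.
Proof. unfold Re_parity. destruct Nat.odd; [apply re_le_Cmod | apply im_le_Cmod]. Qed.

(** Put x = N log|w| with N = n + 1 and w the point of the disc that represents z. Then |w^N| = e^x
    and |log|z|| <= |x|, so [exp_bsum_le] gives one constant for all z and N. *)
Lemma svlog_term_bound (m : nat) : (2 <= m)%nat -> exists K, 0 <= K /\ forall (n : nat) (z : C), z <> 0%C ->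
  Rabs (svlog_term m n z) * (1 + Rabs (ln (Cmod z))) <= K * / INR (S n) ^ 2.
Proof.
  intros Hm. destruct (exp_bsum_le m) as [K [HK HB]]. exists K; split => // n z Hz.
  unfold svlog_term. set (w := into_disc z).
  pose proof (into_disc_neq_0 z Hz : w <> 0%C) as Hw.
  apply Cmod_gt_0 in Hw as Hw'.
  pose proof (ln_into_disc z Hz) as HL. fold w in HL.
  set (x := INR (S n) * ln (Cmod w)).
  assert (HN : 1 <= INR (S n)) by (apply (le_INR 1); lia).
  pose proof (Rabs_pos (ln (Cmod z))) as Hp.
  assert (Hx : x <= 0) by (unfold x; rewrite HL; nra).
  assert (Hxa : Rabs (ln (Cmod z)) <= Rabs x).
  { rewrite (Rabs_left1 x Hx). unfold x. rewrite HL. nra. }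
  assert (HE : Cmod (Cpow w (S n)) = exp x).
  { rewrite Cmod_pow -(exp_ln (Cmod w ^ S n)); [|now apply pow_lt]. now rewrite ln_pow. }
  specialize (HB x Hx).
  assert (HNm : INR (S n) ^ 2 <= INR (S n) ^ m) by (apply Rle_pow; [lra | lia]).
  assert (HN2 : 0 < INR (S n) ^ 2) by (apply pow_lt; lra).
  rewrite Rabs_div; [|apply Rgt_not_eq; lra]. rewrite Rabs_mult.
  rewrite (Rabs_pos_eq (INR (S n) ^ m)); [|lra].
  pose proof (Re_parity_le m (Cpow w (S n))) as HR. rewrite HE in HR.
  pose proof (Rabs_pos (bsum m x)). pose proof (Rabs_pos (Re_parity m (Cpow w (S n)))).
  apply Rle_trans with (exp x * Rabs (bsum m x) * (1 + Rabs x) / INR (S n) ^ m).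
  - unfold Rdiv. rewrite (Rmult_assoc (_ * _) (/ _)) (Rmult_comm (/ _)) -Rmult_assoc.
    apply Rmult_le_compat_r; [apply Rlt_le, Rinv_0_lt_compat; lra|].
    apply Rmult_le_compat; try lra; [apply Rmult_le_pos; assumption|].
    rewrite Rmult_comm. apply Rmult_le_compat_r; assumption.
  - apply Rmult_le_compat; [| |exact HB|apply Rinv_le_contravar; assumption].
    + pose proof (exp_pos x). pose proof (Rabs_pos x).
      apply Rmult_le_pos; [apply Rmult_le_pos|]; lra.
    + apply Rlt_le, Rinv_0_lt_compat; lra.
Qed.

(** This forces L_m(z) to tend to 0 as z tends to 0 or infinity, and so settles the arguments that
    degenerate at the end of the path. *)
Lemma svlog_bound (m : nat) : (2 <= m)%nat -> exists K,
  forall z : C, z <> 0%C -> Rabs (svlog m z) * (1 + Rabs (ln (Cmod z))) <= K.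
Proof.
  intros Hm. destruct (svlog_term_bound m Hm) as [K [HK H]].
  exists (Series (fun n => K * / INR (S n) ^ 2)) => z Hz.
  pose proof (Rabs_pos (ln (Cmod z))).
  rewrite -(Rabs_pos_eq (1 + Rabs (ln (Cmod z)))); [|lra].
  unfold svlog. rewrite -Rabs_mult -Series_scal_r. apply Rabs_Series_le.
  - intros n. rewrite Rabs_mult (Rabs_pos_eq (1 + _)); [|lra]. now apply H.
  - apply: ex_series_scal_l. apply ex_series_inv_sqr.
Qed.

(** * Continuity of the one-valued series *)

Lemma continuous_Series {U : UniformSpace} (f : nat -> U -> R) (M : nat -> R) (x : U) :
  locally x (fun y => forall n, Rabs (f n y) <= M n) -> ex_series M ->
  (forall n, continuous (f n) x) -> continuous (fun y => Series (fun n => f n y)) x.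
Proof.
  intros Hloc HM Hc.
  assert (Hx : forall n, Rabs (f n x) <= M n) by (apply: locally_singleton Hloc).
  apply/filterlim_locally => eps.
  destruct (Series_tail_small M (eps / 4) HM) as [N HN].
  { pose proof (cond_pos eps); lra. }
  assert (HF : continuous (fun y => sum_f_R0 (fun n => f n y) N) x).
  { clear HN. induction N as [|N IH]; simpl; [apply Hc|].
    apply: continuous_plus; [apply IH | apply Hc]. }
  assert (He2 : 0 < eps / 2) by (pose proof (cond_pos eps); lra).
  apply (proj1 (filterlim_locally _ _)) with (eps := mkposreal _ He2) in HF.
  apply: filter_imp (filter_and _ _ HF Hloc) => y [H1 H2].
  rewrite /ball /= /AbsRing_ball /abs /minus /plus /opp /= in H1 |- *.
  assert (HN0 : (0 < S N)%nat) by lia.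
  rewrite (Series_incr_n (fun n => f n y) (S N) HN0 (ex_series_dom _ _ H2 HM)).
  rewrite (Series_incr_n (fun n => f n x) (S N) HN0 (ex_series_dom _ _ Hx HM)). simpl pred.
  assert (HT : ex_series (fun k => M (S N + k)%nat)) by now apply (ex_series_incr_n M (S N)).
  pose proof (Rabs_Series_le (fun k => f (S N + k)%nat y) (fun k => M (S N + k)%nat) (fun k => H2 _) HT) as A.
  pose proof (Rabs_Series_le (fun k => f (S N + k)%nat x) (fun k => M (S N + k)%nat) (fun k => Hx _) HT) as B.
  pose proof (Rle_abs (Series (fun k => M (S N + k)%nat))).
  match goal with |- Rabs (?a + ?b + - (?c + ?d)) < _ =>
    replace (a + b + - (c + d)) with ((a + - c) + (b - d)) by ring end.
  eapply Rle_lt_trans; [apply Rabs_triang|].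
  eapply Rle_lt_trans; [apply Rplus_le_compat_l, Rabs_triang|]. rewrite Rabs_Ropp. lra.
Qed.

Definition Ccont {U : UniformSpace} (F : U -> C) (x : U) : Prop :=
  continuous (fun y => Re (F y)) x /\ continuous (fun y => Im (F y)) x.

Lemma Ccont_id (z : C_UniformSpace) : Ccont (fun w : C_UniformSpace => w) z.
Proof. destruct z as [x y]; split; [apply: continuous_fst | apply: continuous_snd]. Qed.

Lemma Ccont_const {U : UniformSpace} (c : C) (x : U) : Ccont (fun _ => c) x.
Proof. split; apply continuous_const. Qed.

Lemma Ccont_minus {U : UniformSpace} (F G : U -> C) (x : U) :
  Ccont F x -> Ccont G x -> Ccont (fun y => F y - G y)%C x.
Proof. intros [H1 H2] [H3 H4]; split; apply: continuous_minus; assumption. Qed.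

Lemma continuous_multR {U : UniformSpace} (f g : U -> R) (x : U) :
  continuous f x -> continuous g x -> continuous (fun y => f y * g y) x.
Proof. apply: continuous_mult. Qed.

Lemma Ccont_mult {U : UniformSpace} (F G : U -> C) (x : U) :
  Ccont F x -> Ccont G x -> Ccont (fun y => F y * G y)%C x.
Proof.
  intros [H1 H2] [H3 H4]; split.
  - apply: continuous_minus; apply: continuous_multR; assumption.
  - apply: continuous_plus; apply: continuous_multR; assumption.
Qed.

Lemma Ccont_pow {U : UniformSpace} (F : U -> C) (x : U) (n : nat) :
  Ccont F x -> Ccont (fun y => Cpow (F y) n) x.
Proof.
  intros H. induction n as [|n IH]; [apply Ccont_const|]. now apply (Ccont_mult F).
Qed.

Lemma continuous_powR {U : UniformSpace} (f : U -> R) (x : U) (n : nat) :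
  continuous f x -> continuous (fun y => f y ^ n) x.
Proof.
  intros H. induction n as [|n IH]; [apply continuous_const|]. now apply (continuous_multR f).
Qed.

Lemma continuous_Rinv {U : UniformSpace} (f : U -> R) (x : U) :
  continuous f x -> f x <> 0 -> continuous (fun y => / f y) x.
Proof.
  intros H Hf. apply: (continuous_comp f Rinv) H _.
  apply: ex_derive_continuous. now auto_derive.
Qed.

Lemma Ccont_inv {U : UniformSpace} (F : U -> C) (x : U) :
  Ccont F x -> F x <> 0%C -> Ccont (fun y => / F y)%C x.
Proof.
  intros [H1 H2] Hf. pose proof (sqr_neq_0 _ Hf).
  assert (Hn : continuous (fun y => / (Re (F y) ^ 2 + Im (F y) ^ 2)) x).
  { apply continuous_Rinv; [apply: continuous_plus; now apply continuous_powR | lra]. }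
  split; apply: continuous_multR => //. now apply: continuous_opp.
Qed.

Lemma Ccont_conj {U : UniformSpace} (F : U -> C) (x : U) :
  Ccont F x -> Ccont (fun y => Cconj (F y)) x.
Proof. intros [H1 H2]; split => //. now apply: continuous_opp. Qed.

Lemma continuous_Cmod {U : UniformSpace} (F : U -> C) (x : U) :
  Ccont F x -> continuous (fun y => Cmod (F y)) x.
Proof.
  intros [H1 H2].
  apply: (continuous_comp (fun y => Re (F y) ^ 2 + Im (F y) ^ 2) sqrt).
  - apply: continuous_plus; now apply continuous_powR.
  - apply continuous_sqrt.
Qed.

Lemma continuous_ln_Cmod {U : UniformSpace} (F : U -> C) (x : U) :
  Ccont F x -> F x <> 0%C -> continuous (fun y => ln (Cmod (F y))) x.
Proof.
  intros H Hx. apply: (continuous_comp (fun y => Cmod (F y)) ln).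
  - now apply continuous_Cmod.
  - apply continuous_ln. now apply Cmod_gt_0.
Qed.

Lemma Ccont_ext_loc {U : UniformSpace} (F G : U -> C) (x : U) :
  locally x (fun y => F y = G y) -> Ccont F x -> Ccont G x.
Proof.
  intros H [H1 H2]; split.
  - apply continuous_ext_loc with (2 := H1). apply: filter_imp H => y Hy; now rewrite Hy.
  - apply continuous_ext_loc with (2 := H2). apply: filter_imp H => y Hy; now rewrite Hy.
Qed.

Lemma locally_Cmod_lt (z : C_UniformSpace) (a : R) : Cmod z < a -> locally z (fun w : C_UniformSpace => Cmod w < a).
Proof. intros H. apply (continuous_Cmod _ _ (Ccont_id z) (fun r => r < a)). now apply (open_lt a). Qed.

Lemma locally_Cmod_gt (z : C_UniformSpace) (a : R) : a < Cmod z -> locally z (fun w : C_UniformSpace => a < Cmod w).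
Proof. intros H. apply (continuous_Cmod _ _ (Ccont_id z) (fun r => a < r)). now apply (open_gt a). Qed.

Lemma locally_Cmod_minus (z : C_UniformSpace) (eps : R) :
  0 < eps -> locally z (fun w : C_UniformSpace => Cmod (w - z)%C < eps).
Proof.
  intros H.
  apply (continuous_Cmod _ _ (Ccont_minus _ _ z (Ccont_id z) (Ccont_const (z : C) z)) (fun r => r < eps)).
  apply (open_lt eps). rewrite (_ : (z - z = 0)%C); [|ring]. now rewrite Cmod_0.
Qed.

(** Outside the disc the left side equals |z - z0| / |z|, because z0 times its conjugate is 1. This
    is the continuity of the reflection at points of the circle. *)
Lemma into_disc_unit (z z0 : C) : Cmod z0 = 1 -> Cmod (into_disc z - z0)%C <= Cmod (z - z0)%C.
Proof.
  intros H0. unfold into_disc. destruct Rle_dec; [apply Rle_refl|].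
  assert (Hz : z <> 0%C) by (intros E; rewrite E Cmod_0 in n; lra).
  assert (Hzc := Cconj_neq_0 _ Hz).
  assert (E : (z0 * Cconj z0 = 1)%C) by (rewrite -Cmod2_conj H0; simpl; f_equal; ring).
  assert (A : (/ Cconj z - z0 = z0 * Cconj (z0 - z) / Cconj z)%C).
  { rewrite Cminus_conj. replace (z0 * (Cconj z0 - Cconj z))%C with (1 - z0 * Cconj z)%C.
    - now field.
    - rewrite -E; ring. }
  rewrite A Cmod_div // Cmod_mult !Cmod_conj H0 Rmult_1_l.
  rewrite (_ : (z0 - z = - (z - z0))%C); [|ring]. rewrite Cmod_opp.
  pose proof (Cmod_ge_0 (z - z0)%C).
  apply Rle_div_l; [lra|]. nra.
Qed.

Lemma Ccont_into_disc (z : C) : z <> 0%C -> Ccont (U := C_UniformSpace) into_disc z.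
Proof.
  intros Hz. destruct (Rtotal_order (Cmod z) 1) as [H|[H|H]].
  - apply Ccont_ext_loc with (fun w => w); [|apply Ccont_id].
    apply: filter_imp (locally_Cmod_lt z 1 H) => w Hw. unfold into_disc. destruct Rle_dec => //; lra.
  - assert (E : into_disc z = z) by (unfold into_disc; destruct Rle_dec => //; lra).
    split; apply/filterlim_locally => eps;
      apply: filter_imp (locally_Cmod_minus z eps (cond_pos eps)) => w Hw;
      rewrite /ball /= /AbsRing_ball /abs /minus /plus /opp /= E;
      (eapply Rle_lt_trans; [|exact Hw]);
      (eapply Rle_trans; [|apply (into_disc_unit w z H)]).
    + apply (re_le_Cmod (into_disc w - z)%C).
    + apply (im_le_Cmod (into_disc w - z)%C).
  - apply Ccont_ext_loc with (fun w => / Cconj w)%C.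
    + apply: filter_imp (locally_Cmod_gt z 1 H) => w Hw. unfold into_disc. destruct Rle_dec => //; lra.
    + apply Ccont_inv; [apply Ccont_conj, Ccont_id | now apply Cconj_neq_0].
Qed.

Lemma locally_neq (z a : C) : z <> a -> locally (T := C_UniformSpace) z (fun w => w <> a).
Proof.
  intros H. assert (H' : 0 < Cmod (a - z)%C).
  { apply Cmod_gt_0. intros E. apply H. replace a with (a - z + z)%C by ring. rewrite E. ring. }
  apply: filter_imp (locally_Cmod_minus z _ H') => w Hw E. rewrite E in Hw. lra.
Qed.

Lemma continuous_Re_parity {U : UniformSpace} (m : nat) (F : U -> C) (x : U) :
  Ccont F x -> continuous (fun y => Re_parity m (F y)) x.
Proof. intros [H1 H2]. unfold Re_parity. destruct Nat.odd; assumption. Qed.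

Lemma continuous_svlog (m : nat) (z : C) : (2 <= m)%nat -> z <> 0%C ->
  continuous (T := C_UniformSpace) (svlog m) z.
Proof.
  intros Hm Hz. destruct (svlog_term_bound m Hm) as [K [HK H]].
  apply (continuous_Series (svlog_term m : nat -> C_UniformSpace -> R) (fun n => K * / INR (S n) ^ 2)).
  - apply: filter_imp (locally_neq z 0%C Hz) => w Hw n.
    eapply Rle_trans; [|apply (H n w Hw)].
    pose proof (Rabs_pos (svlog_term m n w)). pose proof (Rabs_pos (ln (Cmod w))). nra.
  - apply: ex_series_scal_l. apply ex_series_inv_sqr.
  - intros n. unfold svlog_term.
    pose proof (Ccont_into_disc z Hz) as HI.
    apply: continuous_multR; [|apply continuous_const].
    apply: continuous_multR.
    + unfold bsum. set (f := fun y : C_UniformSpace => INR (S n) * ln (Cmod (into_disc y))).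
      assert (Hf : continuous f z).
      { apply: continuous_multR; [apply continuous_const|]. apply continuous_ln_Cmod => //.
        now apply into_disc_neq_0. }
      induction (m - 1)%nat as [|k IH].
      * simpl. apply continuous_const.
      * apply continuous_ext with (fun y => sum_f_R0 (fun r => bcoef r * f y ^ r) k + bcoef (S k) * f y ^ S k);
          [reflexivity|].
        apply: continuous_plus; [exact IH|].
        apply: continuous_multR; [apply continuous_const | now apply continuous_powR].
    + apply continuous_Re_parity. now apply Ccont_pow.
Qed.

Lemma Re_parity_div_pow (m k n : nat) (w : C) :
  Re_parity m (w / Cpow (RtoC (INR (S n))) k)%C = Re_parity m w / INR (S n) ^ k.
Proof.
  assert (H : INR (S n) ^ k <> 0) by (apply pow_nonzero, not_0_INR; lia).
  unfold Cdiv. rewrite -RtoC_pow -RtoC_inv //.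
  unfold Re_parity; destruct Nat.odd; [rewrite Re_mult | rewrite Im_mult]; simpl; unfold Rdiv; ring.
Qed.

Lemma Re_parity_Csum (m : nat) (a : nat -> C) :
  Re_parity m (Csum a) = Series (fun n => Re_parity m (a n)).
Proof. unfold Re_parity; destruct Nat.odd; reflexivity. Qed.

Lemma Re_parity_Li (m k : nat) (z : C) :
  Re_parity m (Li k z) = Series (fun n => Re_parity m (Cpow z (S n)) / INR (S n) ^ k).
Proof.
  rewrite Li_Csum Re_parity_Csum. apply Series_ext => n. apply Re_parity_div_pow.
Qed.

Lemma ex_series_Re_parity_Li (m k : nat) (z : C) : Cmod z < 1 ->
  ex_series (fun n => Re_parity m (Cpow z (S n)) / INR (S n) ^ k).
Proof.
  intros Hz. apply ex_series_ext with (fun n => Re_parity m (Literm k z n)).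
  { intros n. apply Re_parity_div_pow. }
  unfold Re_parity. destruct Nat.odd; [eapply Cdom_re | eapply Cdom_im]; now apply Li_dom.
Qed.

Lemma Series_sum (g : nat -> nat -> R) (M : nat) :
  (forall r, (r <= M)%nat -> ex_series (g r)) ->
  Series (fun n => sum_f_R0 (fun r => g r n) M) = sum_f_R0 (fun r => Series (g r)) M /\
  ex_series (fun n => sum_f_R0 (fun r => g r n) M).
Proof.
  induction M as [|M IH]; intros H.
  - split; [reflexivity | now apply (H 0%nat)].
  - destruct IH as [E1 E2]; [intros; apply H; lia|]. simpl. split.
    + rewrite Series_plus; [now rewrite E1 | exact E2 | now apply H].
    + apply: ex_series_plus; [exact E2 | now apply H].
Qed.

Lemma svlog_disc (m : nat) (z : C) : (1 <= m)%nat -> z <> 0%C -> Cmod z < 1 ->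
  svlog m z = sum_f_R0 (fun r => bcoef r * ln (Cmod z) ^ r * Re_parity m (Li (m - r) z)) (m - 1).
Proof.
  intros Hm H0 Hz.
  set (g := fun r n => (Re_parity m (Cpow z (S n)) / INR (S n) ^ (m - r)) * (bcoef r * ln (Cmod z) ^ r)).
  assert (Hg : forall r, ex_series (g r)).
  { intros r. apply ex_series_scal_r. now apply ex_series_Re_parity_Li. }
  transitivity (Series (fun n => sum_f_R0 (fun r => g r n) (m - 1))).
  - apply Series_ext => n. unfold svlog_term, bsum.
    replace (into_disc z) with z by (unfold into_disc; destruct Rle_dec => //; lra).
    unfold Rdiv. rewrite Rmult_assoc Rmult_comm scal_sum. apply sum_eq => r Hr. unfold g.
    assert (HN : INR (S n) <> 0) by (apply not_0_INR; lia).
    rewrite (_ : INR (S n) ^ m = INR (S n) ^ (m - r) * INR (S n) ^ r); [|rewrite -pow_add; f_equal; lia].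
    rewrite Rpow_mult_distr.
    field. split; now apply pow_nonzero.
  - rewrite (proj1 (Series_sum g (m - 1) (fun r _ => Hg r))). apply sum_eq => r Hr.
    unfold g. rewrite Series_scal_r Re_parity_Li. ring.
Qed.

Lemma svlog_into_disc (m : nat) (z : C) : svlog m (into_disc z) = svlog m z.
Proof.
  apply Series_ext => n. unfold svlog_term.
  replace (into_disc (into_disc z)) with (into_disc z); [reflexivity|].
  pose proof (Cmod_into_disc z). unfold into_disc at 2. destruct Rle_dec => //; lra.
Qed.

(** * The differential of the one-valued logarithm *)

(* The differential of the one-valued [m]-logarithm [L m] at [z], with
   [rho = log |z|], [lam = log |1-z|], [eta = dz / z] and [delta = d(1-z) / (1-z)]. *)
Definition dform (m : nat) (rho lam : R) (eta delta : C) (L : nat -> R) : R :=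
  match m with
  | 2%nat => rho * Im delta - lam * Im eta
  | 3%nat => - L 2%nat * Im eta - / 3 * rho * (rho * Re delta - lam * Re eta)
  | 4%nat => L 3%nat * Im eta - / 3 * rho * L 2%nat * Re eta
  | 5%nat => - L 4%nat * Im eta - / 3 * rho * L 3%nat * Re eta
             + / 45 * rho ^ 3 * (rho * Re delta - lam * Re eta)
  | 6%nat => L 5%nat * Im eta - / 3 * rho * L 4%nat * Re eta + / 45 * rho ^ 3 * L 2%nat * Re eta
  | 7%nat => - L 6%nat * Im eta - / 3 * rho * L 5%nat * Re eta + / 45 * rho ^ 3 * L 3%nat * Re eta
             - 2 / 945 * rho ^ 5 * (rho * Re delta - lam * Re eta)
  | _ => 0
  end.

Definition dsvlog (m : nat) (z h : C) : R :=
  dform m (ln (Cmod z)) (ln (Cmod (1 - z)%C)) (h / z)%C (- (h / (1 - z)))%C (fun k => svlog k z).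

Lemma is_derive_Re_parity (m : nat) (f : R -> C) (x : R) (l : C) :
  Cder f x l -> is_derive (fun s => Re_parity m (f s)) x (Re_parity m l).
Proof. intros [H1 H2]. unfold Re_parity. destruct Nat.odd; assumption. Qed.

Lemma is_derive_powR (f : R -> R) (x l : R) (n : nat) :
  is_derive f x l -> is_derive (fun s => f s ^ n) x (INR n * f x ^ (n - 1) * l).
Proof.
  intros H. destruct n as [|n].
  - simpl. rewrite !Rmult_0_l. apply: is_derive_const.
  - replace (S n - 1)%nat with n by lia. eapply is_derive_eq; [apply is_derive_pow, H|].
    simpl pred. ring.
Qed.

Lemma locally_along (z h : C) (P : C -> Prop) :
  locally (T := C_UniformSpace) z P -> locally 0 (fun s : R => P (z + s * h)%C).
Proof.
  intros H. pose proof (Cder_continuous _ _ _ (Cder_affine z h 0)) as Hc.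
  apply (Hc P). rewrite (_ : (z + 0 * h = z)%C); [exact H | ring].
Qed.

Lemma gateaux_disc (m : nat) (z h : C) : (2 <= m <= 7)%nat -> z <> 0%C -> Cmod z < 1 ->
  is_derive (fun s : R => svlog m (z + s * h)%C) 0 (dsvlog m z h).
Proof.
  intros Hm H0 Hz.
  assert (Hz1 : (1 - z <> 0)%C).
  { intros E. assert (z = 1)%C by (replace z with (1 - (1 - z))%C by ring; rewrite E; ring).
    rewrite H Cmod_1 in Hz; lra. }
  assert (Ez : (z + 0 * h = z)%C) by ring.
  pose proof (Cder_Li) as HLi.
  apply is_derive_ext_loc with (fun s : R => sum_f_R0 (fun r => bcoef r *
     (ln (Cmod (z + s * h)%C) ^ r * Re_parity m (Li (m - r) (z + s * h)%C))) (m - 1)).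
  { apply: filter_imp (filter_and _ _ (locally_along z h _ (locally_Cmod_lt z 1 Hz))
      (locally_along z h _ (locally_neq z 0 H0))) => s [H1 H2].
    rewrite svlog_disc //; [|lia]. apply sum_eq => r _. ring. }
  eapply is_derive_eq.
  - apply (is_derive_sum (fun r s => bcoef r *
     (ln (Cmod (z + s * h)%C) ^ r * Re_parity m (Li (m - r) (z + s * h)%C)))) => r Hr.
    apply is_derive_scalR. apply is_derive_mulR.
    + apply is_derive_powR. apply is_derive_ln_Cmod; [apply Cder_affine | now rewrite Ez].
    + replace (m - r)%nat with (S (m - r - 1)) by lia.
      apply is_derive_Re_parity. apply Cder_Li; now rewrite Ez.
  - cbv beta. rewrite Ez. set (eta := (h / z)%C).
    assert (E0 : (Li 0 z * eta = - - (h / (1 - z)))%C).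
    { rewrite Li_0 //. unfold eta. now field. }
    pose proof (Re_Li_1 z Hz) as E1.
    unfold dsvlog. fold eta. set (delta := (- (h / (1 - z)))%C) in *.
    set (rho := ln (Cmod z)). set (lam := ln (Cmod (1 - z)%C)) in *.
    assert (E1' : lam = - Re (Li 1 z)) by (rewrite E1; ring).
    assert (E0r : Re (Li 0 z) * Re eta - Im (Li 0 z) * Im eta = - Re delta) by (rewrite -Re_mult E0; reflexivity).
    assert (E0i : Re (Li 0 z) * Im eta + Im (Li 0 z) * Re eta = - Im delta) by (rewrite -Im_mult E0; reflexivity).
    assert (HL : forall k, (1 <= k)%nat -> svlog k z = sum_f_R0 (fun r => bcoef r * rho ^ r * Re_parity k (Li (k - r) z)) (k - 1)).
    { intros k Hk. now apply svlog_disc. }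
    rewrite E1'. clearbody eta delta rho lam. clear E1 E1' E0 HLi.
    (* For each [m] a polynomial identity remains in [rho] and in the real and imaginary parts of
       [eta], [delta] and the [Li k z]. It rests on the values of [bcoef] and on Li_0(z) dz/z = -
       d(1-z)/(1-z), which is [E0r] and [E0i]. *)
    do 2 (destruct m as [|m]; [lia|]).
    do 6 (destruct m as [|m];
      [cbn [dform]; rewrite ?HL; try lia;
       cbn [Nat.sub sum_f_R0 bcoef]; unfold Re_parity; cbn [Nat.odd Nat.even negb];
       rewrite ?Re_mult ?Im_mult; simpl INR; simpl pow; nra |]).
    lia.
Qed.

(** * The total differential, also on the unit circle *)

Lemma line_circle_finite (z h : C) : h <> 0%C ->
  exists l : list R, forall s : R, Cmod (z + s * h)%C = 1 -> In s l.
Proof.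
  intros Hh. set (a := Re h ^ 2 + Im h ^ 2). set (b := 2 * (Re z * Re h + Im z * Im h)).
  assert (Ha : 0 < a) by now apply sqr_neq_0.
  assert (E : forall s : R, Cmod (z + s * h)%C = 1 -> a * s ^ 2 + b * s + (Re z ^ 2 + Im z ^ 2 - 1) = 0).
  { intros s Hs. pose proof (Cmod2_alt (z + s * h)%C) as A. rewrite Hs in A.
    simpl in A. unfold a, b. simpl. rewrite /Re /Im /= in A |- *. nra. }
  destruct (classic (exists s : R, Cmod (z + s * h)%C = 1)) as [[r Hr]|N].
  (* The second root of the quadratic equation, from the sum - b / a of the roots. *)
  - exists [r; - b / a - r] => s Hs. simpl.
    destruct (Req_dec s r) as [->|Hne]; [now left|]. right; left.
    pose proof (E s Hs). pose proof (E r Hr).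
    assert (A : (s - r) * (a * (s + r) + b) = 0) by nra.
    apply Rmult_integral in A as [A|A]; [lra|].
    apply (Rmult_eq_reg_l a); [|lra].
    replace (a * (- b / a - r)) with (- b - a * r) by (field; lra). lra.
  - exists [] => s Hs. apply N. now exists s.
Qed.

Lemma locally_prod (z : C) (P : C -> Prop) : locally (T := C_UniformSpace) z P ->
  exists d, 0 < d /\ forall w, Rabs (Re w - Re z) < d -> Rabs (Im w - Im z) < d -> P w.
Proof. intros [d H]. exists d; split; [apply cond_pos|]. intros w H1 H2. now apply H. Qed.

Lemma Cmod_le_sum (z : C) : Cmod z <= Rabs (Re z) + Rabs (Im z).
Proof.
  pose proof (Rabs_pos (Re z)). pose proof (Rabs_pos (Im z)).
  apply Rsqr_incr_0; [|apply Cmod_ge_0 | lra].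
  rewrite !Rsqr_pow2 Cmod2_alt -(pow2_abs (Re z)) -(pow2_abs (Im z)). nra.
Qed.

(* The unit circle meets a segment in at most two points, so it is harmless in
   the mean value inequality. *)
Lemma frechet_of_gateaux (F : C -> R) (D : C -> C -> R) (z0 : C) (r : R) : 0 < r ->
  (forall z h, D z h = Re h * D z 1 + Im h * D z Ci) ->
  continuous (T := C_UniformSpace) (fun z => D z 1) z0 ->
  continuous (T := C_UniformSpace) (fun z => D z Ci) z0 ->
  (forall z, Cmod (z - z0)%C < r -> continuous (T := C_UniformSpace) F z) ->
  (forall z h, Cmod (z - z0)%C < r -> Cmod z <> 1 ->
     is_derive (fun s : R => F (z + s * h)%C) 0 (D z h)) ->
  differentiable_pt_lim (fun x y => F (x, y)) (Re z0) (Im z0) (D z0 1) (D z0 Ci).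
Proof.
  intros Hr Hlin H1 Hi Hc Hd eps.
  assert (He : 0 < eps / 2) by (pose proof (cond_pos eps); lra).
  pose proof (proj1 (filterlim_locally _ _) H1 (mkposreal _ He)) as L1.
  pose proof (proj1 (filterlim_locally _ _) Hi (mkposreal _ He)) as Li'.
  destruct (locally_prod z0 _ (filter_and _ _ L1 Li')) as [d [Hd0 HD]].
  assert (Hd' : 0 < Rmin d (r / 2)) by (apply Rmin_pos; lra).
  exists (mkposreal _ Hd') => u v Hu Hv. simpl in Hu, Hv.
  set (h := ((u, v) - z0)%C : C).
  assert (Eh : Re h = u - Re z0 /\ Im h = v - Im z0) by (split; reflexivity).
  rewrite -(proj1 Eh) -(proj2 Eh) in Hu Hv |- *.
  rewrite (_ : F (u, v) = F (z0 + 1%R * h)%C); [|f_equal; apply C_eq; rewrite /h /Re /Im /=; ring].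
  rewrite (_ : F (Re z0, Im z0) = F (z0 + 0%R * h)%C); [|f_equal; apply C_eq; rewrite /Re /Im /=; ring].
  pose proof (Rmin_l d (r / 2)). pose proof (Rmin_r d (r / 2)).
  pose proof (Rmax_l (Rabs (Re h)) (Rabs (Im h))). pose proof (Rmax_r (Rabs (Re h)) (Rabs (Im h))).
  pose proof (Rabs_pos (Re h)). pose proof (Rabs_pos (Im h)).
  destruct (classic (h = 0%C)) as [E0|Hh].
  { rewrite E0. rewrite (_ : (z0 + 1%R * 0 = z0 + 0%R * 0)%C); [|ring].
    simpl. rewrite !Rmult_0_r Rplus_0_r !Rminus_eq_0 Rabs_R0 Rmax_left; lra. }
  assert (Hin : forall s, 0 <= s <= 1 -> Cmod (z0 + s * h - z0)%C < r /\
     Rabs (Re (z0 + s * h)%C - Re z0) < d /\ Rabs (Im (z0 + s * h)%C - Im z0) < d).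
  { intros s Hs. rewrite (_ : (z0 + s * h - z0 = s * h)%C); [|ring].
    pose proof (Cmod_le_sum h). pose proof (Cmod_ge_0 h).
    rewrite (_ : Re (z0 + s * h)%C - Re z0 = s * Re h); [|rewrite /Re /Im /=; ring].
    rewrite (_ : Im (z0 + s * h)%C - Im z0 = s * Im h); [|rewrite /Re /Im /=; ring].
    rewrite Cmod_mult Cmod_R !Rabs_mult (Rabs_pos_eq s); [|lra].
    repeat split; nra. }
  destruct (line_circle_finite z0 h Hh) as [l Hl].
  pose proof (mean_value_except l (fun s : R => F (z0 + s * h)%C) (fun s : R => D (z0 + s * h)%C h)
     (D z0 h) (eps * Rmax (Rabs (Re h)) (Rabs (Im h))) 0 1 ltac:(lra)) as MV.
  rewrite Hlin in MV. rewrite Rminus_0_r !Rmult_1_r in MV.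
  rewrite (Rmult_comm (D z0 1)) (Rmult_comm (D z0 Ci)). apply MV.
  - intros s Hs. apply (continuous_comp (fun s : R => (z0 + s * h)%C : C_UniformSpace) F).
    + eapply Cder_continuous, Cder_affine.
    + apply Hc. now apply Hin.
  - intros s Hs Hsl. assert (Hs' : 0 <= s <= 1) by lra.
    destruct (Hin s Hs') as [A1 [A2 A3]]. split.
    + assert (G := Hd (z0 + s * h)%C h A1 (fun E => Hsl (Hl s E))).
      apply is_derive_ext with (fun t : R => F (z0 + s * h + RtoC (t - s) * h)%C).
      { intros t. f_equal. rewrite RtoC_minus. ring. }
      eapply is_derive_eq.
      * apply (is_derive_compR (fun t : R => F (z0 + s * h + t * h)%C) (fun t => t - s) s).
        -- rewrite Rminus_eq_0. exact G.
        -- apply is_derive_minusR; [apply: is_derive_id | apply: is_derive_const].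
      * rewrite /one /zero /=. ring.
    + destruct (HD _ A2 A3) as [B1 B2].
      rewrite /ball /= /AbsRing_ball /abs /minus /plus /opp /= in B1, B2.
      rewrite Hlin. set (X := D (z0 + s * h)%C 1) in *. set (Y := D (z0 + s * h)%C Ci) in *.
      replace (Re h * X + Im h * Y - (Re h * D z0 1 + Im h * D z0 Ci)) with
        (Re h * (X + - D z0 1) + Im h * (Y + - D z0 Ci)) by ring.
      eapply Rle_trans; [apply Rabs_triang|]. rewrite !Rabs_mult.
      pose proof (Rabs_pos (X + - D z0 1)). pose proof (Rabs_pos (Y + - D z0 Ci)).
      set (mx := Rmax _ _) in *.
      apply Rle_trans with (mx * (eps / 2) + mx * (eps / 2)); [|lra].
      apply Rplus_le_compat; apply Rmult_le_compat; lra.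
Qed.

Lemma is_derive_along (F : C -> R) (D : C -> C -> R) (p : R -> C) (s : R) (l : C) :
  (forall z h, D z h = Re h * D z 1 + Im h * D z Ci) ->
  differentiable_pt_lim (fun x y => F (x, y)) (Re (p s)) (Im (p s)) (D (p s) 1) (D (p s) Ci) ->
  Cder p s l -> is_derive (fun t => F (p t)) s (D (p s) l).
Proof.
  intros Hlin HF [H1 H2].
  apply is_derive_ext with (fun t => F (Re (p t), Im (p t))); [intros t; now destruct (p t)|].
  apply is_derive_Reals. rewrite Hlin (Rmult_comm (Re l)) (Rmult_comm (Im l)).
  apply (derivable_pt_lim_comp_2d (fun x y => F (x, y)) (fun t => Re (p t)) (fun t => Im (p t))) => //;
  now apply is_derive_Reals.
Qed.

Lemma dsvlog_linear (m : nat) (z h : C) : dsvlog m z h = Re h * dsvlog m z 1 + Im h * dsvlog m z Ci.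
Proof.
  unfold dsvlog, Cdiv.
  assert (E : forall w, (h * w = Re h * (1 * w) + Im h * (Ci * w))%C).
  { intros w. apply C_eq; rewrite /Re /Im /=; ring. }
  rewrite (E (/ z)%C) (E (/ (1 - z))%C).
  set (a := (1 * / z)%C). set (b := (Ci * / z)%C). set (c := (1 * / (1 - z))%C). set (d := (Ci * / (1 - z))%C).
  assert (R1 : forall x y : C, Re (Re h * x + Im h * y)%C = Re h * Re x + Im h * Re y).
  { intros; rewrite /Re /Im /=; ring. }
  assert (R2 : forall x y : C, Im (Re h * x + Im h * y)%C = Re h * Im x + Im h * Im y).
  { intros; rewrite /Re /Im /=; ring. }
  assert (R3 : forall x : C, Re (- x)%C = - Re x) by reflexivity.
  assert (R4 : forall x : C, Im (- x)%C = - Im x) by reflexivity.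
  do 8 (destruct m as [|m]; [cbn [dform]; rewrite ?R3 ?R4 ?R1 ?R2; ring|]).
  cbn [dform]. ring.
Qed.

Lemma continuous_dform {U : UniformSpace} (m : nat) (rho lam : U -> R) (eta delta : U -> C)
    (L : U -> nat -> R) (x : U) :
  continuous rho x -> continuous lam x -> Ccont eta x -> Ccont delta x ->
  (forall k, (2 <= k)%nat -> continuous (fun y => L y k) x) ->
  continuous (fun y => dform m (rho y) (lam y) (eta y) (delta y) (L y)) x.
Proof.
  intros Hr Hl [He1 He2] [Hd1 Hd2] HL.
  do 8 (destruct m as [|m]; [unfold dform;
    repeat first [ apply: continuous_plus | apply: continuous_minus | apply: continuous_opp
     | apply: continuous_multR | apply: continuous_powR | apply: continuous_const | assumption
     | apply HL; lia ] |]).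
  unfold dform. apply: continuous_const.
Qed.

Lemma continuous_dsvlog (m : nat) (z h : C) : z <> 0%C -> z <> 1%C ->
  continuous (T := C_UniformSpace) (fun w => dsvlog m w h) z.
Proof.
  intros H0 H1.
  assert (H1' : (1 - z <> 0)%C).
  { intros E. apply H1. replace z with (1 - (1 - z))%C by ring. rewrite E. ring. }
  pose proof (Ccont_id z) as Hid.
  assert (Hm : Ccont (fun w : C_UniformSpace => 1 - w)%C z).
  { apply (Ccont_minus (fun _ => RtoC 1)); [apply Ccont_const | exact Hid]. }
  unfold dsvlog. apply (continuous_dform m (fun w : C_UniformSpace => ln (Cmod w)) (fun w : C_UniformSpace => ln (Cmod (1 - w)%C))
    (fun w : C_UniformSpace => (h / w)%C) (fun w : C_UniformSpace => (- (h / (1 - w)))%C) (fun w k => svlog k w)).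
  - now apply continuous_ln_Cmod.
  - now apply continuous_ln_Cmod.
  - apply (Ccont_mult (fun _ => h)); [apply Ccont_const | now apply Ccont_inv].
  - assert (A : Ccont (fun w : C_UniformSpace => h / (1 - w))%C z).
    { apply (Ccont_mult (fun _ => h)); [apply Ccont_const | now apply Ccont_inv]. }
    destruct A as [A1 A2]; split; now apply: continuous_opp.
  - intros k Hk. now apply continuous_svlog.
Qed.

Lemma exists_radius (z : C) : z <> 0%C -> z <> 1%C -> exists r, 0 < r /\
  forall w, Cmod (w - z)%C < r -> w <> 0%C /\ w <> 1%C /\ (Cmod z < 1 -> Cmod w < 1).
Proof.
  intros H0 H1. set (a := Cmod (z - 0)%C). set (b := Cmod (z - 1)%C).
  assert (Ha : 0 < a).
  { apply Cmod_gt_0. intros E. apply H0. replace z with (z - 0)%C by ring. exact E. }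
  assert (Hb : 0 < b).
  { apply Cmod_gt_0. intros E. apply H1. replace z with (z - 1 + 1)%C by ring. rewrite E. ring. }
  set (c := match Rlt_dec (Cmod z) 1 with left _ => 1 - Cmod z | right _ => 1 end).
  assert (Hc : 0 < c) by (unfold c; destruct Rlt_dec; lra).
  exists (Rmin a (Rmin b c)). split; [repeat apply Rmin_pos; assumption|].
  intros w Hw.
  pose proof (Rmin_l a (Rmin b c)). pose proof (Rmin_r a (Rmin b c)).
  pose proof (Rmin_l b c). pose proof (Rmin_r b c).
  assert (S : forall q, Cmod (z - q)%C = Cmod (q - z)%C).
  { intros q. rewrite (_ : (z - q = - (q - z))%C); [apply Cmod_opp | ring]. }
  split; [|split].
  - intros E. rewrite E in Hw. pose proof (S 0%C : a = _). lra.
  - intros E. rewrite E in Hw. pose proof (S 1%C : b = _). lra.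
  - intros Hz. replace w with (w - z + z)%C by ring.
    assert (Ec : c = 1 - Cmod z) by (unfold c; destruct Rlt_dec; lra).
    eapply Rle_lt_trans; [apply Cmod_triangle | lra].
Qed.

(** The disc is treated first: outside it the function is composed with the reflection, which bends
    straight lines, so the chain rule in [gateaux] needs a total differential inside. *)
Lemma frechet_disc (m : nat) (z : C) : (2 <= m <= 7)%nat -> z <> 0%C -> Cmod z < 1 ->
  differentiable_pt_lim (fun x y => svlog m (x, y)) (Re z) (Im z) (dsvlog m z 1) (dsvlog m z Ci).
Proof.
  intros Hm H0 Hz.
  assert (H1 : z <> 1%C) by (intros ->; rewrite Cmod_1 in Hz; lra).
  destruct (exists_radius z H0 H1) as [r [Hr H]].
  apply frechet_of_gateaux with r => //.
  - apply dsvlog_linear.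
  - now apply continuous_dsvlog.
  - now apply continuous_dsvlog.
  - intros w Hw. apply continuous_svlog; [lia | exact (proj1 (H w Hw))].
  - intros w h Hw _. destruct (H w Hw) as [A [B Cc]]. apply gateaux_disc; auto.
Qed.

Lemma svlog_reflect (m : nat) (z : C) : z <> 0%C -> svlog m (/ Cconj z)%C = svlog m z.
Proof.
  intros Hz. pose proof (Cconj_neq_0 _ Hz) as Hc. apply Cmod_gt_0 in Hz as Hz0.
  assert (Hinv : Cmod (/ Cconj z)%C = / Cmod z) by (rewrite Cmod_inv // Cmod_conj //).
  destruct (Rle_dec (Cmod z) 1) as [H|H].
  - rewrite -(svlog_into_disc m (/ Cconj z)%C). unfold into_disc. destruct Rle_dec as [H'|H'].
    + assert (Cmod z = 1).
      { apply Rle_antisym => //. rewrite Hinv in H'.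
        apply (Rmult_le_compat_l (Cmod z)) in H'; [|lra]. rewrite Rinv_r in H'; lra. }
      assert (E : (z * Cconj z = 1)%C) by (rewrite -Cmod2_conj H0; simpl; f_equal; ring).
      f_equal. replace (/ Cconj z)%C with (z * Cconj z / Cconj z)%C by (rewrite E; now field). now field.
    + f_equal. rewrite Cinv_conj // Cconj_conj. now field.
  - rewrite -(svlog_into_disc m z). unfold into_disc. destruct Rle_dec => //; lra.
Qed.

(** Under the reflection rho, eta, lam, delta become - rho, - conj eta, lam - rho, conj delta - conj
    eta, and [dform] is invariant under this substitution. *)
Lemma gateaux (m : nat) (z h : C) : (2 <= m <= 7)%nat -> z <> 0%C -> Cmod z <> 1 ->
  is_derive (fun s : R => svlog m (z + s * h)%C) 0 (dsvlog m z h).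
Proof.
  intros Hm H0 Hz. destruct (Rlt_dec (Cmod z) 1) as [Hlt|Hge]; [now apply gateaux_disc|].
  pose proof (Cconj_neq_0 _ H0) as Hc. apply Cmod_gt_0 in H0 as Hz0.
  assert (Ez : (z + 0 * h = z)%C) by ring.
  set (w := (/ Cconj z)%C).
  assert (Hw0 : w <> 0%C).
  { intros E. apply C1_nz. rewrite -(Cinv_l (Cconj z)) //. fold w. rewrite E. ring. }
  assert (Hw1 : Cmod w < 1).
  { unfold w. rewrite Cmod_inv // Cmod_conj -Rinv_1. apply Rinv_lt_contravar; lra. }
  set (l := (- Cconj h / (Cconj z * Cconj z))%C).
  assert (HP : Cder (fun s : R => / Cconj (z + s * h))%C 0 l).
  { eapply Cder_eq; [apply Cder_inv; [apply Cder_conj, Cder_affine | now rewrite Ez]|].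
    cbv beta. now rewrite Ez. }
  apply is_derive_ext_loc with (fun s : R => svlog m (/ Cconj (z + s * h))%C).
  { apply: filter_imp (locally_along z h _ (locally_neq z 0 H0)) => s Hs. now apply svlog_reflect. }
  eapply is_derive_eq.
  - apply (is_derive_along (svlog m) (dsvlog m) (fun s : R => / Cconj (z + s * h))%C 0 l (dsvlog_linear m)); [|exact HP].
    rewrite Ez. fold w. now apply frechet_disc.
  - cbv beta. rewrite Ez. fold w.
    assert (Hz1 : (1 - z <> 0)%C).
    { intros E. apply Hz. rewrite (_ : (z = 1)%C); [apply Cmod_1|]. rewrite (_ : (z = 1 - (1 - z))%C); [|ring]. rewrite E. ring. }
    pose proof (Cconj_neq_0 _ Hz1) as Hz1c. rewrite Cminus_conj in Hz1c.
    assert (E1c : Cconj 1 = 1%C) by (apply C_eq; simpl; ring). rewrite E1c in Hz1c.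
    assert (E1 : ln (Cmod w) = - ln (Cmod z)).
    { unfold w. rewrite Cmod_inv // Cmod_conj ln_Rinv //. }
    assert (E2 : (1 - w = - Cconj (1 - z) / Cconj z)%C).
    { unfold w. rewrite Cminus_conj E1c. now field. }
    assert (E3 : ln (Cmod (1 - w)%C) = ln (Cmod (1 - z)%C) - ln (Cmod z)).
    { rewrite E2 Cmod_div // Cmod_opp !Cmod_conj ln_div //. now apply Cmod_gt_0. }
    assert (E4 : (l / w = - Cconj (h / z))%C).
    { rewrite Cdiv_conj //. unfold l, w. now field. }
    assert (E5 : (- (l / (1 - w)) = Cconj (- (h / (1 - z))) - Cconj (h / z))%C).
    { rewrite Copp_conj !Cdiv_conj // E2 Cminus_conj E1c. unfold l. field. repeat split => //. }
    unfold dsvlog. rewrite E1 E3 E4 E5.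
    set (eta := (h / z)%C). set (delta := (- (h / (1 - z)))%C).
    assert (HL : forall k, svlog k w = svlog k z) by (intros; now apply svlog_reflect).
    assert (R1 : Re (- Cconj eta)%C = - Re eta) by reflexivity.
    assert (R2 : Im (- Cconj eta)%C = Im eta) by (simpl; rewrite /Im; ring).
    assert (R3 : Re (Cconj delta - Cconj eta)%C = Re delta - Re eta) by reflexivity.
    assert (R4 : Im (Cconj delta - Cconj eta)%C = - Im delta + Im eta) by (rewrite /Im /=; ring).
    do 8 (destruct m as [|m]; [cbn [dform]; rewrite ?R1 ?R2 ?R3 ?R4 ?HL; ring|]). lia.
Qed.

Lemma is_derive_svlog (m : nat) (p : R -> C) (s : R) (l : C) : (2 <= m <= 7)%nat ->
  Cder p s l -> p s <> 0%C -> p s <> 1%C -> is_derive (fun t => svlog m (p t)) s (dsvlog m (p s) l).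
Proof.
  intros Hm Hp H0 H1. destruct (exists_radius (p s) H0 H1) as [r [Hr H]].
  apply is_derive_along => //; [apply dsvlog_linear|].
  apply frechet_of_gateaux with r => //.
  - apply dsvlog_linear.
  - now apply continuous_dsvlog.
  - now apply continuous_dsvlog.
  - intros w Hw. apply continuous_svlog; [lia | exact (proj1 (H w Hw))].
  - intros w h Hw Hw1. apply gateaux => //. exact (proj1 (H w Hw)).
Qed.

(** * Comparison with the definition through Bernoulli numbers *)

Lemma bernoulli_list_6 : bernoulli_list 6 = [1; - / 2; / 6; 0; - / 30; 0; / 42].
Proof.
  assert (B1 : bernoulli_list 1 = [1; - / 2]).
  { cbn -[fact INR]. unfold Binomial.C. cbn [fact Nat.sub Nat.mul Nat.add]. rewrite !INR_IZR_INZ. cbn.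
    repeat f_equal. field. }
  assert (B2 : bernoulli_list 2 = [1; - / 2; / 6]).
  { change (bernoulli_list 2) with (bernoulli_list 1 ++
      [- sum_f_R0 (fun k => Binomial.C 3 k * nth k (bernoulli_list 1) 0) 1 / INR 3]).
    rewrite B1. unfold Binomial.C. cbn -[INR]. rewrite !INR_IZR_INZ. cbn. repeat f_equal. field. }
  assert (B3 : bernoulli_list 3 = [1; - / 2; / 6; 0]).
  { change (bernoulli_list 3) with (bernoulli_list 2 ++
      [- sum_f_R0 (fun k => Binomial.C 4 k * nth k (bernoulli_list 2) 0) 2 / INR 4]).
    rewrite B2. unfold Binomial.C. cbn -[INR]. rewrite !INR_IZR_INZ. cbn. repeat f_equal. field. }
  assert (B4 : bernoulli_list 4 = [1; - / 2; / 6; 0; - / 30]).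
  { change (bernoulli_list 4) with (bernoulli_list 3 ++
      [- sum_f_R0 (fun k => Binomial.C 5 k * nth k (bernoulli_list 3) 0) 3 / INR 5]).
    rewrite B3. unfold Binomial.C. cbn -[INR]. rewrite !INR_IZR_INZ. cbn. repeat f_equal. field. }
  assert (B5 : bernoulli_list 5 = [1; - / 2; / 6; 0; - / 30; 0]).
  { change (bernoulli_list 5) with (bernoulli_list 4 ++
      [- sum_f_R0 (fun k => Binomial.C 6 k * nth k (bernoulli_list 4) 0) 4 / INR 6]).
    rewrite B4. unfold Binomial.C. cbn -[INR]. rewrite !INR_IZR_INZ. cbn. repeat f_equal. field. }
  change (bernoulli_list 6) with (bernoulli_list 5 ++
      [- sum_f_R0 (fun k => Binomial.C 7 k * nth k (bernoulli_list 5) 0) 5 / INR 7]).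
  rewrite B5. unfold Binomial.C. cbn -[INR]. rewrite !INR_IZR_INZ. cbn. repeat f_equal. field.
Qed.

Lemma bernoulli_list_nth (n k i : nat) : (i <= n)%nat ->
  nth i (bernoulli_list (n + k)) 0 = nth i (bernoulli_list n) 0.
Proof.
  assert (Hlen : forall n, length (bernoulli_list n) = S n).
  { induction n0 as [|p IH]; [reflexivity|]. cbn [bernoulli_list]. rewrite length_app IH /=. lia. }
  intros Hi. induction k as [|k IH]; [now rewrite Nat.add_0_r|].
  rewrite Nat.add_succ_r. cbn [bernoulli_list]. rewrite app_nth1; [exact IH|]. rewrite Hlen. lia.
Qed.

Lemma bcoef_bernoulli (r : nat) : (r <= 6)%nat -> 2 ^ r * bernoulli r / INR (fact r) = bcoef r.
Proof.
  intros Hr. unfold bernoulli. rewrite -(bernoulli_list_nth r (6 - r) r (le_n r)).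
  replace (r + (6 - r))%nat with 6%nat by lia. rewrite bernoulli_list_6.
  do 7 (destruct r as [|r]; [cbn [nth bcoef]; rewrite INR_IZR_INZ; cbn; field|]). lia.
Qed.

Lemma polylog_disc_7 (z : C) : z <> 0%C -> Cmod z <= 1 -> polylog_disc 7 z = svlog 7 z.
Proof.
  intros H0 Hz.
  assert (E : polylog_disc 7 z =
    sum_f_R0 (fun r => bcoef r * ln (Cmod z) ^ r * Re_parity 7 (Li (7 - r) z)) 6).
  { unfold polylog_disc. change (Re_parity 7) with Re. change (7 - 1)%nat with 6%nat.
    assert (Hg : forall n, (n <= 6)%nat ->
      Re (sum_n (fun r : nat => (RtoC (2 ^ r * bernoulli r / INR (fact r) * ln (Cmod z) ^ r) * Li (7 - r) z)%C) n)
      = sum_f_R0 (fun r => bcoef r * ln (Cmod z) ^ r * Re (Li (7 - r) z)) n).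
    { induction n as [|n IH]; intros Hn.
      - rewrite sum_O Re_mult bcoef_bernoulli //. unfold RtoC, Re, Im; cbn -[Li]. ring.
      - rewrite sum_Sn tech5 -IH; [|lia].
        rewrite (_ : forall a b : C, Re (plus a b) = Re a + Re b); [|reflexivity].
        rewrite Re_mult bcoef_bernoulli //. f_equal. unfold RtoC, Re at 1, Im at 1; cbn -[Li bcoef]. ring. }
    now apply Hg. }
  rewrite E. destruct (Rle_lt_or_eq_dec _ _ Hz) as [Hlt|Heq].
  - symmetry. apply svlog_disc => //. lia.
  (* On the unit circle log|z| = 0, so only r = 0 survives, whatever value [Series] assigns to the
     lower [Li]. *)
  - rewrite Heq ln_1. cbn [sum_f_R0 bcoef Nat.sub].
    transitivity (Re_parity 7 (Li 7 z)); [ring|].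
    rewrite Re_parity_Li. apply Series_ext => n. unfold svlog_term.
    replace (into_disc z) with z by (unfold into_disc; destruct Rle_dec => //; lra).
    rewrite Heq ln_1 Rmult_0_r. replace (bsum 7 0) with 1; [unfold Rdiv; ring|].
    unfold bsum. cbn. ring.
Qed.

Lemma svlog_conj (m : nat) (z : C) : Nat.odd m = true -> z <> 0%C -> svlog m (Cconj z) = svlog m z.
Proof.
  intros Hm Hz. apply Series_ext => n. unfold svlog_term.
  assert (E : into_disc (Cconj z) = Cconj (into_disc z)).
  { unfold into_disc. rewrite Cmod_conj. destruct Rle_dec => //.
    rewrite Cinv_conj //. now apply Cconj_neq_0. }
  rewrite E Cmod_conj -Cpow_conj /Re_parity Hm. reflexivity.
Qed.

Lemma polylog_generic_7 (z : C) : z <> 0%C -> polylog_generic 7 z = svlog 7 z.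
Proof.
  intros Hz. unfold polylog_generic. destruct Rle_dec as [H|H]; [now apply polylog_disc_7|].
  assert (Hz' : (/ z <> 0)%C).
  { intros E. apply C1_nz. rewrite -(Cinv_l z) // E. ring. }
  rewrite polylog_disc_7 //.
  (* Since 7 is odd, conjugation turns the reflection into the inversion of the definition, and the
     sign (-1)^6 is 1. *)
  - rewrite -(svlog_reflect 7 z) // -(svlog_conj 7 (/ z)%C) // Cinv_conj //. simpl; ring.
  - rewrite Cmod_inv // -Rinv_1. apply Rinv_le_contravar; lra.
Qed.

Lemma locally'_proper (z : C) : ProperFilter (locally' (T := C_UniformSpace) z).
Proof.
  constructor; [|apply locally'_filter].
  intros P [d H].
  assert (Hd : 0 < d / 2) by (pose proof (cond_pos d); lra).
  exists (Re z + d / 2, Im z). apply H.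
  - split; rewrite /ball /= /AbsRing_ball /abs /minus /plus /opp /= /Re /Im.
    + replace (fst z + d / 2 + - fst z) with (d / 2) by ring. rewrite Rabs_pos_eq; lra.
    + replace (snd z + - snd z) with 0 by ring. rewrite Rabs_R0; lra.
  - intros E. apply (f_equal fst) in E. rewrite /Re /= in E. lra.
Qed.

(** [lim] is specified only on Cauchy filters; a convergent one is Cauchy, and then limits are
    unique. *)
Lemma lim_locally' (F : C -> R) (z : C) (l : R) :
  filterlim F (locally' (T := C_UniformSpace) z) (locally l) ->
  lim (filtermap F (locally' (T := C_UniformSpace) z)) = l.
Proof.
  intros H. pose proof (locally'_proper z) as HP.
  assert (HPm : ProperFilter (filtermap F (locally' (T := C_UniformSpace) z))) by now apply filtermap_proper_filter.
  apply (filterlim_locally_unique (V := R_NormedModule) (F := filtermap F (locally' (T := C_UniformSpace) z)) (fun x => x)); [|exact H].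
  apply/filterlim_locally => eps.
  assert (Hc : cauchy (filtermap F (locally' (T := C_UniformSpace) z))).
  { intros e. exists l. apply H. now exists e. }
  apply (complete_cauchy (T := R_CompleteSpace) (filtermap F (locally' (T := C_UniformSpace) z)) HPm Hc eps).
Qed.

Lemma polylog_7 (z : C) : z <> 0%C -> polylog 7 (Fin z) = svlog 7 z.
Proof.
  intros Hz. cbn [polylog]. destruct Ceq_dec as [E|_]; [contradiction|].
  destruct Ceq_dec as [->|_]; [|now apply polylog_generic_7].
  (* At [z = 1] the value is defined as a limit, which continuity of [svlog 7] at 1 evaluates. *)
  apply lim_locally'.
  apply filterlim_ext_loc with (svlog 7).
  - destruct (locally_neq 1 0 C1_nz) as [d Hd]. exists d => w Hw _.
    symmetry. apply polylog_generic_7. now apply Hd.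
  - apply (filterlim_filter_le_1 (F := locally (T := C_UniformSpace) (RtoC 1))).
    + intros P [d Hd]. exists d => w Hw _. now apply Hd.
    + apply (continuous_svlog 7); [lia | apply C1_nz].
Qed.

(** * The arguments and their symbols *)

Local Open Scope Z_scope.

(* [(s, [e1; ...; e6])] stands for the product of the sign [s] and of the powers
   of [t], [1 - t], [den t], [u], [1 - u], [den u] with exponents [e1, ..., e6]. *)
Definition smono : Type := Z * list Z.

Fixpoint vadd (v w : list Z) : list Z :=
  match v, w with
  | x :: v', y :: w' => (x + y) :: vadd v' w'
  | _, _ => []
  end.

Definition smul (x y : smono) : smono := (fst x * fst y, vadd (snd x) (snd y)).
Definition spow (x : smono) (n : Z) : smono :=
  (if Z.even n then 1 else fst x, map (Z.mul n) (snd x)).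

Definition fiM : list smono := [(-1, [1; 0; -1]); (-1, [0; 1; -1]); (1, [1; 1; -1])].
Definition fM : smono := (-1, [2; 2; -3]).
Definition in_t (x : smono) : smono := (fst x, snd x ++ [0; 0; 0]).
Definition in_u (x : smono) : smono := (fst x, [0; 0; 0] ++ snd x).

Definition argM (a b c d : Z) (g h : smono) : smono :=
  smul (smul (spow (in_t fM) a) (spow (in_t g) (b - a)))
       (spow (smul (spow (in_u fM) c) (spow (in_u h) (d - c))) (-1)).

Definition brace0M (a b c d : Z) : list smono :=
  map (fun '(g, h) => argM a b c d g h) (list_prod fiM fiM).
Definition braceM (a b c d : Z) : list smono :=
  brace0M a b c d ++ brace0M c d a b.

(* 72 is a common denominator of the coefficients of xi_7. *)
Definition wt (q : Q) : Z := Qnum q * (72 / QDen q).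

Definition braces : list (Q * (Z * Z * Z * Z)) :=
  [ (((1#2) * 700)%Q,      (1, -2, -1, 2));
    (3150%Q,               (0, 1, 1, -1));
    (((1#2) * 1575)%Q,     (-1, 1, 1, -1));
    ((-2100)%Q,            (1, -2, 0, -1));
    (((1#2) * 6300)%Q,     (0, 1, 0, -1));
    ((-1050)%Q,            (-1, 2, -1, 1));
    ((- ((1#2) * 700))%Q,  (-1, 2, -1, 2));
    ((- ((1#2) * 1575))%Q, (-1, 1, -1, 1));
    ((- ((1#2) * 6300))%Q, (0, 1, 0, 1));
    (1050%Q,               (-1, 2, 1, -1));
    (2100%Q,               (0, -1, -1, 2));
    ((-3150)%Q,            (1, -1, 0, -1));
    (((1#2) * 700)%Q,     (1, 0, 1, 0));
    (((1#2) * (175#4))%Q, (1, -3, 1, -3));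
    (((1#2) * 28)%Q,      (-2, 3, -2, 3));
    ((-35)%Q,             (1, -3, -2, 3));
    ((-140)%Q,            (-2, 3, 1, 0));
    (175%Q,               (1, 0, 1, -3));
    ((- ((1#18) * (609#4)))%Q, (-1, -1, -1, -1));
    ((- ((1#3) * 35))%Q,       (-1, -1, -2, 1));
    (((1#3) * (105#8))%Q,      (-1, -1, 3, -5));
    ((- ((1#3) * 21))%Q,       (-1, -1, -1, 4));
    ((- ((1#3) * 15))%Q,       (-1, -1, -2, 5));
    (((1#3) * 15)%Q,           (-1, -1, 3, -4)) ].

Definition args : list (Z * smono) :=
  flat_map (fun '(q, (a, b, c, d)) => map (fun x => (wt q, x)) (braceM a b c d)) braces.

(** * Certified factorizations of 1 - x *)

Notation pe := (PExpr Z).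
Definition pT : pe := PEX Z 1.
Definition pU : pe := PEX Z 2.
Definition denP (z : pe) : pe := PEadd (PEsub (PEc 1) z) (PEmul z z).
Definition gensP : list pe :=
  [pT; PEsub (PEc 1) pT; denP pT; pU; PEsub (PEc 1) pU; denP pU].

Definition numsP (z : pe) : list pe :=
  [PEopp z; PEsub z (PEc 1); PEmul z (PEsub (PEc 1) z)].

(* The six factors of the numerators of [f_i t - f_j u], followed by the
   numerators of [x + y + 1], [x + y + x y], [1 + x y + x], [1 + x y + y] and
   [1 - x y] at [x = f_i t], [y = f_j u]. *)
Definition relsP : list pe :=
  [ PEsub pT pU; PEsub (PEc 1) (PEmul pT pU);
    PEsub (PEsub (PEc 1) pT) pU; PEsub (PEadd pT pU) (PEmul pT pU);
    PEadd (PEsub (PEc 1) pT) (PEmul pT pU);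
    PEadd (PEsub (PEc 1) pU) (PEmul pT pU) ] ++
  flat_map (fun '(x, y) =>
    let d := denP pT in let d' := denP pU in
    let c := PEmul d d' in let x1 := PEmul x d' in let y1 := PEmul d y in
    let xy := PEmul x y in
    [ PEadd (PEadd x1 y1) c; PEadd (PEadd x1 y1) xy; PEadd (PEadd c xy) x1;
      PEadd (PEadd c xy) y1; PEsub c xy ]) (list_prod (numsP pT) (numsP pU)).

Fixpoint monoP (gs : list pe) (e : list Z) : pe :=
  match gs, e with
  | g :: gs', k :: e' => PEmul (PEpow g (Z.to_N k)) (monoP gs' e')
  | _, _ => PEc 1
  end.

Fixpoint prodP (ls : list nat) : pe :=
  match ls with
  | [] => PEc 1
  | l :: ls' => PEmul (nth l relsP (PEc 0)) (prodP ls')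
  end.

Fixpoint evalZ (T U : Z) (p : pe) : Z :=
  match p with
  | PEO => 0 | PEI => 1
  | PEc c => c
  | PEX j => if Pos.eqb j 1 then T else U
  | PEadd p q => evalZ T U p + evalZ T U q
  | PEsub p q => evalZ T U p - evalZ T U q
  | PEmul p q => evalZ T U p * evalZ T U q
  | PEopp p => - evalZ T U p
  | PEpow p n => Z.pow (evalZ T U p) (Z.of_N n)
  end.

Fixpoint mult (fuel : nat) (h n : Z) : Z * Z :=
  match fuel with
  | O => (0, n)
  | S k => if n mod h =? 0 then let '(m, r) := mult k h (n / h) in (m + 1, r) else (0, n)
  end.

(* The factorization of [1 - x] is guessed from divisibilities between values at
   one integer point; [term_ok] checks it as a polynomial identity. *)
Definition factored (x : smono) : smono * list nat :=
  let '(s, e) := x in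
  let ev := evalZ 1009 1000003 in
  let neg := map (fun k => Z.max 0 (- k)) e in
  let n := ev (monoP gensP neg) - s * ev (monoP gensP (map (Z.max 0) e)) in
  let '(n, dg) := fold_left (fun '(n, dg) g => let '(m, r) := mult 20 (ev g) n in (r, dg ++ [m])) gensP (n, []) in
  let '(n, dh, _) := fold_left (fun '(n, dh, i) h => let '(m, r) := mult 1 (ev h) n in
     (r, (if m =? 0 then dh else dh ++ [i]), S i)) relsP (n, [], O) in
  ((n, vadd dg (map Z.opp neg)), dh).

(* A weighted argument [targ], with
   [1 - targ = tcomp * (product of the members of relsP with index in trels)]. *)
Record term := Term { twt : Z; targ : smono; tcomp : smono; trels : list nat }.

(** Computed once and stored as data. Nothing is trusted about the search that found the
    factorizations: [terms_ok] verifies every one of them. *)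
Definition terms : list term := Eval vm_compute in
  map (fun '(q, x) => let '(y, l) := factored x in Term q x y l) args.

Definition peq (p q : pe) : bool :=
  Peq Z.eqb
     (norm_subst 0%Z 1%Z Z.add Z.mul Z.sub Z.opp Z.eqb Z.quotrem 0 [] p)
     (norm_subst 0%Z 1%Z Z.add Z.mul Z.sub Z.opp Z.eqb Z.quotrem 0 [] q).

(** The least nonnegative exponents of a monomial that clears the negative powers in both x and the
    monomial part of 1 - x, so that the factorization becomes an identity of polynomials. *)
Fixpoint common (e d : list Z) : list Z :=
  match e, d with
  | x :: e', y :: d' => Z.max 0 (Z.max (-x) (-y)) :: common e' d'
  | _, _ => []
  end.

Definition term_ok (x : term) : bool :=
  let '(s, e) := targ x in
  let '(s', d) := tcomp x in
  let v := common e d in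
  peq (PEsub (monoP gensP v) (PEmul (PEc s) (monoP gensP (vadd v e))))
      (PEmul (PEc s') (PEmul (monoP gensP (vadd v d)) (prodP (trels x)))).

(** * A decision procedure for weighted power sums *)

Definition strip (x : Z * list Z) : Z * list Z := (fst x, tl (snd x)).
Definition times_hd (x : Z * list Z) : Z * list Z := (fst x * hd 0 (snd x), snd x).
Definition prune (L : list (Z * list Z)) := filter (fun x => negb (fst x =? 0)) L.

(* Decides whether the sum over [(c, e)] in [L] of [c * (a_1 . e) ... (a_n . e)]
   is zero for all vectors [a_1, ..., a_n], when the [e] have length [dim]. *)
Fixpoint vanish (dim n : nat) (L : list (Z * list Z)) : bool :=
  match dim with
  | O => match n with O => fold_right (fun x s => fst x + s) 0 L =? 0 | S _ => true end
  | S dim' =>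
      (fix loop (n : nat) (L : list (Z * list Z)) : bool :=
         vanish dim' n (map strip L) &&
         match n with O => true | S n' => loop n' (prune (map times_hd L)) end) n L
  end.

(** The weighted coordinate of x ∧ (1 - x) on the k-th and l-th of the six generators; signs are
    torsion and disappear. *)
Definition wedge_coef (k l : nat) (x : term) : Z :=
  twt x * (nth k (snd (targ x)) 0 * nth l (snd (tcomp x)) 0 -
           nth l (snd (targ x)) 0 * nth k (snd (tcomp x)) 0).
Definition rel_coef (l : nat) (x : term) : Z := twt x * Z.of_nat (count_occ Nat.eq_dec (trels x) l).

Definition vanish_terms (n : nat) (c : term -> Z) : bool :=
  vanish 6 n (prune (map (fun x => (c x, snd (targ x))) terms)).

(* When [den t] is of order [r] and [den u] of order [r ^ 4], the argument with
   exponents [e] is of order [r ^ kappa e]. *)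
Definition kappa (e : list Z) : Z := nth 2 e 0 + 4 * nth 5 e 0.
Definition base_coef (x : term) : Z := if kappa (snd (targ x)) =? 0 then twt x else 0.

Local Close Scope Z_scope.

(** * Finite sums and products of linear forms *)

Fixpoint lsum {A : Type} (F : A -> R) (l : list A) : R :=
  match l with [] => 0 | x :: l' => F x + lsum F l' end.

Lemma lsum_ext {A : Type} (F G : A -> R) (l : list A) :
  (forall x, In x l -> F x = G x) -> lsum F l = lsum G l.
Proof.
  induction l as [|x l IH]; intros H; [reflexivity|].
  cbn. rewrite H; [|now left]. rewrite IH //. intros; apply H; now right.
Qed.

Lemma lsum_0 {A : Type} (F : A -> R) (l : list A) : (forall x, In x l -> F x = 0) -> lsum F l = 0.
Proof.
  intros H. rewrite (lsum_ext F (fun _ => 0)) //. induction l as [|x l IH]; [reflexivity|].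
  cbn. rewrite IH; [ring | intros; apply H; now right].
Qed.

Lemma lsum_plus {A : Type} (F G : A -> R) (l : list A) :
  lsum (fun x => F x + G x) l = lsum F l + lsum G l.
Proof. induction l as [|x l IH]; cbn; [ring | rewrite IH; ring]. Qed.

Lemma lsum_scal {A : Type} (k : R) (F : A -> R) (l : list A) :
  lsum (fun x => k * F x) l = k * lsum F l.
Proof. induction l as [|x l IH]; cbn; [ring | rewrite IH; ring]. Qed.

Lemma lsum_map {A B : Type} (g : A -> B) (F : B -> R) (l : list A) :
  lsum F (map g l) = lsum (fun x => F (g x)) l.
Proof. induction l as [|x l IH]; cbn; [reflexivity | now rewrite IH]. Qed.

Lemma lsum_swap {A B : Type} (F : A -> B -> R) (l : list A) (l' : list B) :
  lsum (fun x => lsum (F x) l') l = lsum (fun y => lsum (fun x => F x y) l) l'.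
Proof.
  induction l as [|x l IH]; cbn.
  - now rewrite lsum_0.
  - now rewrite IH -lsum_plus.
Qed.

Fixpoint dot (e : list Z) (a : list R) : R :=
  match e with
  | [] => 0
  | k :: e' => IZR k * hd 0 a + dot e' (tl a)
  end.

Fixpoint dots (vs : list (list R)) (e : list Z) : R :=
  match vs with [] => 1 | a :: vs' => dot e a * dots vs' e end.

Lemma dot_nil (e : list Z) : dot e [] = 0.
Proof. induction e as [|k e IH]; cbn; [|rewrite IH]; ring. Qed.

Lemma dot_hd_tl (e : list Z) (a : list R) : dot e a = IZR (hd 0%Z e) * hd 0 a + dot (tl e) (tl a).
Proof. destruct e; cbn; [ring | reflexivity]. Qed.

Lemma lsum_prune (G : list Z -> R) (L : list (Z * list Z)) :
  lsum (fun x => IZR (fst x) * G (snd x)) (prune L) = lsum (fun x => IZR (fst x) * G (snd x)) L.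
Proof.
  induction L as [|[c e] L IH]; [reflexivity|]. cbn.
  destruct (Z.eqb_spec c 0) as [->|H]; cbn; [rewrite IH; ring | now rewrite IH].
Qed.

Lemma lsum_IZR {A : Type} (F : A -> Z) (l : list A) :
  IZR (fold_right (fun x s => (F x + s)%Z) 0%Z l) = lsum (fun x => IZR (F x)) l.
Proof. induction l as [|x l IH]; [reflexivity|]. cbn. now rewrite plus_IZR IH. Qed.

(* Expanding each factor [dot e a] along the first coordinate of [e] groups the
   product by the power of that coordinate. *)
Lemma vanish_correct (dim : nat) : forall (n : nat) (L : list (Z * list Z)) (vs : list (list R)),
  vanish dim n L = true -> length vs = n -> (forall x, In x L -> (length (snd x) <= dim)%nat) ->
  lsum (fun x => IZR (fst x) * dots vs (snd x)) L = 0.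
Proof.
  induction dim as [|dim IH]; intros n L vs HV Hn HL.
  - cbn in HV. destruct vs as [|a vs]; subst n; cbn in HV.
    + apply Z.eqb_eq in HV. rewrite (lsum_ext _ (fun x => IZR (fst x))).
      * now rewrite -lsum_IZR HV.
      * intros x _. cbn. ring.
    + apply lsum_0 => x Hx. specialize (HL x Hx). destruct (snd x); [|cbn in HL; lia]. cbn. ring.
  - enough (G : forall todo done n L,
        vanish (S dim) n L = true -> (length todo + length done = n)%nat ->
        (forall x, In x L -> (length (snd x) <= S dim)%nat) ->
        lsum (fun x => IZR (fst x) * (dots todo (snd x) * dots done (tl (snd x)))) L = 0).
    { rewrite -(G vs [] n L HV); [| cbn; lia | exact HL].
      apply lsum_ext => x _. cbn. ring. }
    clear n L vs HV Hn HL. induction todo as [|a todo IHt]; intros dn n L HV Hn HL.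
    + assert (HV' : vanish dim n (map strip L) = true).
      { destruct n; cbn [vanish] in HV; apply andb_prop in HV; apply HV. }
      rewrite -(IH n (map strip L) dn HV' Hn).
      * rewrite lsum_map. apply lsum_ext => x _. cbn. ring.
      * intros x Hx. apply in_map_iff in Hx as [y [<- Hy]]. specialize (HL y Hy). cbn.
        destruct (snd y); cbn in *; lia.
    + destruct n as [|n]; [cbn in Hn; lia|].
      assert (HV' : vanish (S dim) n (prune (map times_hd L)) = true).
      { cbn [vanish] in HV. apply andb_prop in HV as [_ HV].
        destruct n; exact HV. }
      assert (A : lsum (fun x => hd 0 a * (IZR (fst x) * IZR (hd 0%Z (snd x)) *
                    (dots todo (snd x) * dots dn (tl (snd x))))) L = 0).
      { rewrite lsum_scal. apply Rmult_eq_0_compat_l.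
        rewrite -(IHt dn n _ HV').
        - rewrite (lsum_prune (fun e => dots todo e * dots dn (tl e))) lsum_map.
          apply lsum_ext => x _. cbn. now rewrite mult_IZR.
        - cbn in Hn; lia.
        - intros x Hx. apply filter_In in Hx as [Hx _]. apply in_map_iff in Hx as [y [<- Hy]].
          exact (HL y Hy). }
      assert (B : lsum (fun x => IZR (fst x) * (dots todo (snd x) * dots (tl a :: dn) (tl (snd x)))) L = 0).
      { apply IHt with (S n) => //. cbn in *; lia. }
      pose proof (f_equal2 Rplus A B) as AB. rewrite -lsum_plus Rplus_0_l in AB.
      rewrite -AB. apply lsum_ext => x _.
      cbn [dots]. rewrite (dot_hd_tl (snd x) a). ring.
Qed.

(** * The symbol of xi_7 *)

Definition wf_term (x : term) : bool :=
  (Z.eqb (fst (targ x) * fst (targ x)) 1 && Nat.eqb (length (snd (targ x))) 6 &&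
  Z.eqb (fst (tcomp x) * fst (tcomp x)) 1 && Nat.eqb (length (snd (tcomp x))) 6 &&
  forallb (fun l => Nat.ltb l 51) (trels x))%bool.

Lemma terms_wf : forallb wf_term terms = true.
Proof. vm_compute. reflexivity. Qed.

Lemma term_wf (x : term) : In x terms ->
  (fst (targ x) * fst (targ x) = 1)%Z /\ length (snd (targ x)) = 6%nat /\
  (fst (tcomp x) * fst (tcomp x) = 1)%Z /\ length (snd (tcomp x)) = 6%nat /\
  forall l, In l (trels x) -> (l < 51)%nat.
Proof.
  intros Hx. pose proof (proj1 (forallb_forall _ _) terms_wf x Hx) as H.
  unfold wf_term in H. repeat (apply andb_prop in H as [H ?]).
  repeat split; try (now apply Z.eqb_eq); try (now apply Nat.eqb_eq).
  intros l Hl. apply Nat.ltb_lt. now apply (proj1 (forallb_forall _ _) H0).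
Qed.

Lemma terms_ok : forallb term_ok terms = true.
Proof. vm_compute. reflexivity. Qed.

(* Unfolding the 432 terms during conversion would be fatal. *)
Opaque terms.

Definition pairs6 : list (nat * nat) :=
  [(0,1);(0,2);(0,3);(0,4);(0,5);(1,2);(1,3);(1,4);(1,5);(2,3);(2,4);(2,5);(3,4);(3,5);(4,5)]%nat.

Lemma wedge_checks : forallb (fun p => vanish_terms 5 (wedge_coef (fst p) (snd p))) pairs6 = true.
Proof. vm_compute. reflexivity. Qed.

(** Members of [relsP] occur in 1 - x but not in x. The part of the symbol that involves the l-th
    one is therefore x^5 ⊗ (x ∧ h_l), a symmetric tensor of degree six in x, which explains the 6
    here against the 5 in [wedge_checks]. *)
Lemma rel_checks : forallb (fun l => vanish_terms 6 (rel_coef l)) (seq 0 51) = true.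
Proof. vm_compute. reflexivity. Qed.

Lemma base_checks : forallb (fun n => vanish_terms n base_coef) [0; 2; 4]%nat = true.
Proof. vm_compute. reflexivity. Qed.

Lemma vanish_terms_correct (c : term -> Z) (n : nat) (vs : list (list R)) :
  vanish_terms n c = true -> length vs = n ->
  lsum (fun x => IZR (c x) * dots vs (snd (targ x))) terms = 0.
Proof.
  intros H Hn. pose proof (vanish_correct 6 n _ vs H Hn) as V.
  rewrite (lsum_prune (dots vs)) lsum_map in V. apply V.
  intros x Hx. apply filter_In in Hx as [Hx _]. apply in_map_iff in Hx as [y [<- Hy]]. cbn.
  apply term_wf in Hy as [_ [E _]]. lia.
Qed.

(** The Binet-Cauchy identity: it reduces the antisymmetric expression to the fifteen coordinates of
    e ∧ d. *)
Lemma dot_antisym (e d : list Z) (a b : list R) : length e = 6%nat -> length d = 6%nat ->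
  dot e a * dot d b - dot e b * dot d a =
  lsum (fun '(k, l) => (nth k a 0 * nth l b 0 - nth l a 0 * nth k b 0) *
     IZR (nth k e 0 * nth l d 0 - nth l e 0 * nth k d 0)%Z) pairs6.
Proof.
  intros He Hd.
  do 7 (destruct e as [|? e]; try discriminate He). do 7 (destruct d as [|? d]; try discriminate Hd).
  (* Coordinates missing from a real vector count as 0 both in [dot] and in [nth], so the lengths of
     [a] and [b] are free. *)
  assert (N : forall v : list R, exists v0 v1 v2 v3 v4 v5,
    (forall c0 c1 c2 c3 c4 c5, dot [c0; c1; c2; c3; c4; c5] v =
       IZR c0 * v0 + IZR c1 * v1 + IZR c2 * v2 + IZR c3 * v3 + IZR c4 * v4 + IZR c5 * v5) /\
    nth 0 v 0 = v0 /\ nth 1 v 0 = v1 /\ nth 2 v 0 = v2 /\ nth 3 v 0 = v3 /\ nth 4 v 0 = v4 /\ nth 5 v 0 = v5).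
  { intros v. do 6 eexists. split; [|repeat split; reflexivity].
    intros. do 6 (destruct v as [|? v]; [cbn; ring|]). cbn. ring. }
  destruct (N a) as (a0 & a1 & a2 & a3 & a4 & a5 & Da & A0 & A1 & A2 & A3 & A4 & A5).
  destruct (N b) as (b0 & b1 & b2 & b3 & b4 & b5 & Db & B0 & B1 & B2 & B3 & B4 & B5).
  rewrite !Da !Db. cbn [lsum pairs6].
  rewrite A0 A1 A2 A3 A4 A5 B0 B1 B2 B3 B4 B5. cbn [nth].
  rewrite !minus_IZR !mult_IZR. ring.
Qed.

Lemma wedge_sum (vs : list (list R)) (a b : list R) : length vs = 5%nat ->
  lsum (fun x => IZR (twt x) * dots vs (snd (targ x)) *
    (dot (snd (targ x)) a * dot (snd (tcomp x)) b - dot (snd (targ x)) b * dot (snd (tcomp x)) a)) terms = 0.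
Proof.
  intros Hn.
  rewrite (lsum_ext _ (fun x => lsum (fun p => (nth (fst p) a 0 * nth (snd p) b 0 - nth (snd p) a 0 * nth (fst p) b 0) *
    (IZR (wedge_coef (fst p) (snd p) x) * dots vs (snd (targ x)))) pairs6)).
  - rewrite lsum_swap. apply lsum_0 => p Hp. rewrite lsum_scal. apply Rmult_eq_0_compat_l.
    apply (fun H => vanish_terms_correct _ 5 vs H Hn).
    exact (proj1 (forallb_forall _ _) wedge_checks p Hp).
  - intros x Hx. destruct (term_wf x Hx) as [_ [He [_ [Hd _]]]].
    rewrite dot_antisym // -lsum_scal. apply lsum_ext => [[k l]] _. cbn [fst snd].
    unfold wedge_coef. rewrite mult_IZR. ring.
Qed.

Lemma lsum_count (F : nat -> R) (l : list nat) (n : nat) : (forall i, In i l -> (i < n)%nat) ->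
  lsum F l = lsum (fun i => IZR (Z.of_nat (count_occ Nat.eq_dec l i)) * F i) (seq 0 n).
Proof.
  intros H. induction l as [|j l IH].
  - symmetry. apply lsum_0 => i _. cbn. ring.
  - cbn [lsum]. rewrite IH; [|intros; apply H; now right].
    assert (E : F j = lsum (fun i => (if Nat.eqb i j then 1 else 0) * F i) (seq 0 n)).
    { assert (Hj : (j < n)%nat) by (apply H; now left).
      rewrite (_ : n = (j + S (n - S j))%nat); [|lia]. rewrite seq_app. cbn [seq].
      assert (App : forall (G : nat -> R) u v, lsum G (u ++ v) = lsum G u + lsum G v).
      { intros G u v. induction u as [|? ? IHu]; cbn; [ring | rewrite IHu; ring]. }
      rewrite App. cbn [lsum Nat.add]. rewrite Nat.eqb_refl.
      rewrite lsum_0; [rewrite lsum_0; [ring|]|].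
      - intros i Hi. apply in_seq in Hi. destruct (Nat.eqb_spec i j); [lia | ring].
      - intros i Hi. apply in_seq in Hi. destruct (Nat.eqb_spec i j); [lia | ring]. }
    rewrite {1}E -lsum_plus. apply lsum_ext => i _. cbn [count_occ].
    destruct (Nat.eq_dec j i) as [->|Hne].
    + rewrite Nat.eqb_refl Nat2Z.inj_succ succ_IZR. ring.
    + destruct (Nat.eqb_spec i j); [congruence | ring].
Qed.

(* This is the vanishing of the image of xi_7 in Sym^5 (x) Lambda^2, evaluated at
   real vectors; [a], [s] and [b], [d] are two sets of values for the factors. *)
Lemma symbol_vanishes (vs : list (list R)) (a b : list R) (s d : nat -> R) : length vs = 5%nat ->
  lsum (fun x => IZR (twt x) * dots vs (snd (targ x)) *
    (dot (snd (targ x)) a * (dot (snd (tcomp x)) b + lsum d (trels x)) -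
     (dot (snd (tcomp x)) a + lsum s (trels x)) * dot (snd (targ x)) b)) terms = 0.
Proof.
  intros Hn.
  assert (Rel : forall (v : list R) (F : nat -> R),
    lsum (fun x => IZR (twt x) * dots vs (snd (targ x)) * (dot (snd (targ x)) v * lsum F (trels x))) terms = 0).
  { intros v F.
    rewrite (lsum_ext _ (fun x => lsum (fun i => F i *
      (IZR (rel_coef i x) * dots (v :: vs) (snd (targ x)))) (seq 0 51))).
    - rewrite lsum_swap. apply lsum_0 => i Hi. rewrite lsum_scal. apply Rmult_eq_0_compat_l.
      apply (fun H => vanish_terms_correct _ 6 (v :: vs) H (f_equal S Hn)).
      exact (proj1 (forallb_forall _ _) rel_checks i Hi).
    - intros x Hx. destruct (term_wf x Hx) as [_ [_ [_ [_ Hl]]]].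
      rewrite (lsum_count F (trels x) 51 Hl) -!lsum_scal. apply lsum_ext => i _.
      unfold rel_coef. rewrite mult_IZR. cbn [dots]. ring. }
  rewrite (lsum_ext _ (fun x =>
    IZR (twt x) * dots vs (snd (targ x)) *
      (dot (snd (targ x)) a * dot (snd (tcomp x)) b - dot (snd (targ x)) b * dot (snd (tcomp x)) a) +
    (IZR (twt x) * dots vs (snd (targ x)) * (dot (snd (targ x)) a * lsum d (trels x)) +
     -1 * (IZR (twt x) * dots vs (snd (targ x)) * (dot (snd (targ x)) b * lsum s (trels x)))))).
  - rewrite !lsum_plus lsum_scal !Rel wedge_sum //. ring.
  - intros x _. ring.
Qed.

(** * Integer powers and signed monomials *)

Lemma Cpowz_sub (z : C) (a b : nat) : z <> 0%C ->
  Cpowz z (Z.of_nat a - Z.of_nat b) = (Cpow z a / Cpow z b)%C.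
Proof.
  intros Hz.
  assert (P : forall n, Cpowz z (Z.of_nat n) = Cpow z n).
  { intros [|n]; [reflexivity|]. cbn [Z.of_nat Cpowz]. now rewrite SuccNat2Pos.id_succ. }
  assert (N : forall n, Cpowz z (- Z.of_nat n) = (/ Cpow z n)%C).
  { intros [|n]; [cbn; field; apply C1_nz|]. cbn [Z.of_nat Z.opp Cpowz]. now rewrite SuccNat2Pos.id_succ. }
  destruct (Nat.le_ge_cases b a) as [H|H].
  - rewrite -Nat2Z.inj_sub // P {2}(_ : a = (a - b + b)%nat); [|lia].
    rewrite Cpow_add_r. field. now apply Cpow_nz.
  - rewrite (_ : (Z.of_nat a - Z.of_nat b = - Z.of_nat (b - a))%Z); [|lia].
    rewrite N {2}(_ : b = (b - a + a)%nat); [|lia].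
    rewrite Cpow_add_r. field. split; now apply Cpow_nz.
Qed.

(** Together with [Cpowz_sub] this derives the power laws for integer exponents from those for
    natural ones, without a case distinction on signs. *)
Lemma Z_as_sub (n : Z) : exists a b : nat, n = (Z.of_nat a - Z.of_nat b)%Z.
Proof. exists (Z.to_nat n), (Z.to_nat (- n)). lia. Qed.

Lemma Cpowz_add (z : C) (m n : Z) : z <> 0%C -> Cpowz z (m + n) = (Cpowz z m * Cpowz z n)%C.
Proof.
  intros Hz. destruct (Z_as_sub m) as [a [b ->]]. destruct (Z_as_sub n) as [c [d ->]].
  rewrite (_ : (Z.of_nat a - Z.of_nat b + (Z.of_nat c - Z.of_nat d) =
               Z.of_nat (a + c) - Z.of_nat (b + d))%Z); [|lia].
  rewrite !Cpowz_sub // !Cpow_add_r. field. split; now apply Cpow_nz.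
Qed.

Lemma Cpowz_neq_0 (z : C) (n : Z) : z <> 0%C -> Cpowz z n <> 0%C.
Proof.
  intros Hz E.
  assert (E1 : Cpowz z (n + - n) = 1%C) by (now rewrite Z.add_opp_diag_r).
  rewrite Cpowz_add // E in E1. apply C1_nz. rewrite -E1. ring.
Qed.

Lemma Cpowz_opp (z : C) (n : Z) : z <> 0%C -> Cpowz z (- n) = (/ Cpowz z n)%C.
Proof.
  intros Hz. pose proof (Cpowz_neq_0 z n Hz).
  assert (E1 : Cpowz z (- n + n) = 1%C) by (now rewrite Z.add_opp_diag_l).
  rewrite Cpowz_add // in E1. rewrite -(Cmult_1_l (/ _)%C) -E1. now field.
Qed.

Lemma Cpowz_mult (z w : C) (n : Z) : z <> 0%C -> w <> 0%C ->
  Cpowz (z * w)%C n = (Cpowz z n * Cpowz w n)%C.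
Proof.
  intros Hz Hw. destruct (Z_as_sub n) as [a [b ->]].
  rewrite !Cpowz_sub //; [|now apply Cmult_neq_0]. rewrite !Cpow_mult_l. field.
  split; now apply Cpow_nz.
Qed.

Lemma Cpowz_1 (z : C) : Cpowz z 1 = z.
Proof. change (z * 1 = z)%C. ring. Qed.

Lemma Cpowz_pos (z : C) (p : positive) : Cpowz z (Zpos p) = Cpow z (Pos.to_nat p).
Proof. reflexivity. Qed.

Lemma Cpowz_neg (z : C) (p : positive) : Cpowz z (Zneg p) = (/ Cpow z (Pos.to_nat p))%C.
Proof. reflexivity. Qed.

Lemma Cpowz_0 (z : C) : Cpowz z 0 = 1%C.
Proof. reflexivity. Qed.

Lemma Cpowz_Cpowz (z : C) (m n : Z) : z <> 0%C -> Cpowz (Cpowz z m) n = Cpowz z (n * m).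
Proof.
  intros Hz. pose proof (Cpowz_neq_0 z m Hz) as Hm.
  pattern n. apply Z.peano_ind.
  - reflexivity.
  - intros k IH. rewrite -Z.add_1_r Z.mul_add_distr_r Z.mul_1_l !Cpowz_add // IH. now rewrite Cpowz_1.
  - intros k IH. rewrite -Z.sub_1_r Z.mul_sub_distr_r Z.mul_1_l -!Z.add_opp_r !Cpowz_add // IH. f_equal.
    now rewrite !Cpowz_opp // Cpowz_1.
Qed.

Fixpoint mono (gs : list C) (e : list Z) : C :=
  match gs, e with
  | g :: gs', k :: e' => (Cpowz g k * mono gs' e')%C
  | _, _ => 1%C
  end.

Definition evM (gs : list C) (x : smono) : C := (RtoC (IZR (fst x)) * mono gs (snd x))%C.

Definition nonzero (gs : list C) : Prop := List.Forall (fun g : C => g <> 0%C) gs.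

Lemma mono_neq_0 (gs : list C) (e : list Z) : nonzero gs -> mono gs e <> 0%C.
Proof.
  intros H; revert e; induction H as [|g gs Hg H IH]; intros [|k e]; cbn; try apply C1_nz.
  apply Cmult_neq_0; [now apply Cpowz_neq_0 | apply IH].
Qed.

Lemma mono_vadd (gs : list C) (e d : list Z) : nonzero gs -> length e = length d ->
  mono gs (vadd e d) = (mono gs e * mono gs d)%C.
Proof.
  intros H; revert e d; induction H as [|g gs Hg H IH]; intros [|k e] [|l d] E; cbn; try (ring || discriminate).
  rewrite Cpowz_add // IH; [ring | now injection E].
Qed.

Lemma mono_scal (gs : list C) (e : list Z) (n : Z) : nonzero gs ->
  mono gs (map (Z.mul n) e) = Cpowz (mono gs e) n.
Proof.
  intros H; revert e; induction H as [|g gs Hg H IH]; intros [|k e]; cbn.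
  1-3: destruct (Z_as_sub n) as [a [b ->]]; rewrite Cpowz_sub; [|apply C1_nz]; rewrite !Cpow_1_l; field; apply C1_nz.
  rewrite Cpowz_mult; [|now apply Cpowz_neq_0 | now apply mono_neq_0]. now rewrite IH Cpowz_Cpowz.
Qed.

Definition wfM (x : smono) : Prop := (fst x * fst x = 1)%Z /\ length (snd x) = 6%nat.

Lemma wfM_sign (x : smono) : wfM x -> fst x = 1%Z \/ fst x = (-1)%Z.
Proof. intros [H _]. nia. Qed.

Lemma vadd_length (e d : list Z) : length e = length d -> length (vadd e d) = length e.
Proof. revert d; induction e as [|k e IH]; intros [|l d] H; cbn in *; try discriminate; auto. Qed.

Lemma wfM_smul (x y : smono) : wfM x -> wfM y -> wfM (smul x y).
Proof. intros [H1 H2] [H3 H4]; split; cbn; [nia|]. rewrite vadd_length; congruence. Qed.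

Lemma wfM_spow (x : smono) (n : Z) : wfM x -> wfM (spow x n).
Proof. intros [H1 H2]; split; cbn; [now destruct Z.even | now rewrite length_map]. Qed.

Lemma evM_neq_0 (gs : list C) (x : smono) : nonzero gs -> wfM x -> evM gs x <> 0%C.
Proof.
  intros H Hx. apply Cmult_neq_0; [|now apply mono_neq_0].
  destruct (wfM_sign x Hx) as [-> | ->]; intros E; apply RtoC_inj in E; lra.
Qed.

Lemma evM_smul (gs : list C) (x y : smono) : nonzero gs -> wfM x -> wfM y ->
  evM gs (smul x y) = (evM gs x * evM gs y)%C.
Proof.
  intros H [_ Hx] [_ Hy]. unfold evM, smul. cbn [fst snd].
  rewrite mult_IZR RtoC_mult mono_vadd //; [ring | congruence].
Qed.

Lemma Cpowz_sign (s n : Z) : (s = 1 \/ s = -1)%Z ->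
  Cpowz (RtoC (IZR s)) n = RtoC (IZR (if Z.even n then 1 else s)%Z).
Proof.
  intros Hs.
  assert (H : RtoC (IZR s) <> 0%C) by (destruct Hs as [-> | ->]; intros E; apply RtoC_inj in E; lra).
  assert (Hss : (RtoC (IZR s) * RtoC (IZR s) = 1)%C).
  { rewrite -RtoC_mult -mult_IZR. destruct Hs as [-> | ->]; reflexivity. }
  assert (H2 : forall k, Cpowz (RtoC (IZR s)) (k + k) = RtoC 1).
  { intros k. rewrite Cpowz_add // -Cpowz_mult // Hss.
    destruct (Z_as_sub k) as [a [b ->]]; rewrite Cpowz_sub; [|apply C1_nz]; rewrite !Cpow_1_l; field; apply C1_nz. }
  destruct (Z.Even_or_Odd n) as [[k ->]|[k ->]].
  - rewrite Z.even_mul. cbn [Z.even orb]. now rewrite (_ : (2 * k = k + k)%Z); [|lia].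
  - rewrite Z.even_add Z.even_mul. cbn [Z.even orb Bool.eqb].
    rewrite Cpowz_add // (_ : (2 * k = k + k)%Z); [|lia]. rewrite H2 Cpowz_1. ring.
Qed.

Lemma evM_spow (gs : list C) (x : smono) (n : Z) : nonzero gs -> wfM x ->
  evM gs (spow x n) = Cpowz (evM gs x) n.
Proof.
  intros H Hx. unfold evM, spow. cbn [fst snd]. pose proof (wfM_sign x Hx) as Hs.
  rewrite Cpowz_mult; [| |now apply mono_neq_0].
  - now rewrite Cpowz_sign // mono_scal.
  - destruct Hs as [-> | ->]; intros E; apply RtoC_inj in E; lra.
Qed.

(** * The arguments of xi_7 as signed monomials *)

Section Arguments.
Variables t u : C.

Definition gensC : list C := [t; (1 - t)%C; den t; u; (1 - u)%C; den u].

Hypothesis Hgs : nonzero gensC.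

Lemma fi_evM (p : (C -> C) * smono) : In p (combine fs fiM) ->
  fst p t = evM gensC (in_t (snd p)) /\ fst p u = evM gensC (in_u (snd p)) /\
  wfM (in_t (snd p)) /\ wfM (in_u (snd p)).
Proof.
  assert (Ht : den t <> 0%C) by exact (proj1 (Forall_forall _ _) Hgs (den t) (or_intror (or_intror (or_introl eq_refl)))).
  assert (Hu : den u <> 0%C).
  { apply (proj1 (Forall_forall _ _) Hgs (den u)). cbn; tauto. }
  intros [<-|[<-|[<-|[]]]]; (split; [|split; [|split; split; reflexivity]]);
    unfold evM, gensC, in_t, in_u; cbn [fst snd app mono];
    rewrite !(Cpowz_pos, Cpowz_neg, Cpowz_0); change (Pos.to_nat 1) with 1%nat; change (Pos.to_nat 2) with 2%nat; change (Pos.to_nat 3) with 3%nat;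
    unfold f1, f2, f3; field; assumption.
Qed.

Lemma f_evM : Defs.f t = evM gensC (in_t fM) /\ Defs.f u = evM gensC (in_u fM).
Proof.
  assert (Ht : den t <> 0%C).
  { apply (proj1 (Forall_forall _ _) Hgs (den t)). cbn; tauto. }
  assert (Hu : den u <> 0%C).
  { apply (proj1 (Forall_forall _ _) Hgs (den u)). cbn; tauto. }
  split; unfold evM, gensC, in_t, in_u, fM; cbn [fst snd app mono];
    rewrite !(Cpowz_pos, Cpowz_neg, Cpowz_0); change (Pos.to_nat 1) with 1%nat; change (Pos.to_nat 2) with 2%nat; change (Pos.to_nat 3) with 3%nat;
    unfold Defs.f, f1, f2, f3; field; assumption.
Qed.

Lemma argM_evM (a b c d : Z) (p q : (C -> C) * smono) :
  In p (combine fs fiM) -> In q (combine fs fiM) ->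
  (Cpowz (Defs.f t) a * Cpowz (fst p t) (b - a) / (Cpowz (Defs.f u) c * Cpowz (fst q u) (d - c)))%C =
  evM gensC (argM a b c d (snd p) (snd q)).
Proof.
  intros Hp Hq.
  destruct (fi_evM p Hp) as [E1 [_ [W1 _]]]. destruct (fi_evM q Hq) as [_ [E2 [_ W2]]].
  destruct f_evM as [E3 E4].
  assert (W3 : wfM (in_t fM)) by (split; reflexivity).
  assert (W4 : wfM (in_u fM)) by (split; reflexivity).
  unfold argM. rewrite !evM_smul ?evM_spow ?evM_smul ?evM_spow //; repeat (apply wfM_smul || apply wfM_spow); try assumption.
  rewrite -E1 -E2 -E3 -E4. rewrite Cpowz_neg. change (Pos.to_nat 1) with 1%nat. now rewrite Cpow_1_r.
Qed.

Lemma brace0_evM (a b c d : Z) :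
  brace0 a b c d t u = map (fun x => (1%Q, evM gensC x)) (brace0M a b c d).
Proof.
  pose proof (fun p q Hp Hq => argM_evM a b c d p q Hp Hq) as A.
  unfold brace0, brace0M, fs, fiM. cbn [list_prod map app].
  repeat (apply f_equal2; [apply f_equal2; [reflexivity|]|]); try reflexivity;
  match goal with |- (_ * Cpowz (?g t) _ / (_ * Cpowz (?h u) _))%C = evM _ (argM _ _ _ _ ?x ?y) =>
    apply (A (g, x) (h, y)); cbn; tauto end.
Qed.

Lemma polylog_linear_cons (m : nat) (q : Q) (z : C) (s : formal_sum) :
  polylog_linear m ((q, z) :: s) = Q2R q * polylog m (Fin z) + polylog_linear m s.
Proof. reflexivity. Qed.

Lemma polylog_linear_app (m : nat) (s s' : formal_sum) :
  polylog_linear m (s ++ s') = polylog_linear m s + polylog_linear m s'.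
Proof.
  induction s as [|[q z] s IH]; [symmetry; apply Rplus_0_l|].
  rewrite -app_comm_cons !polylog_linear_cons IH. ring.
Qed.

Lemma wt_Q2R (q : Q) : (72 mod QDen q = 0)%Z -> Q2R q = IZR (wt q) / 72.
Proof.
  intros H. unfold wt, Q2R. rewrite mult_IZR.
  assert (E : (72 = QDen q * (72 / QDen q))%Z) by (apply Z_div_exact_2; [reflexivity | exact H]).
  assert (E' : 72 = IZR (QDen q) * IZR (72 / QDen q)) by (rewrite -mult_IZR -E; reflexivity).
  assert (IZR (QDen q) <> 0) by (apply not_0_IZR; discriminate).
  rewrite E'. assert (IZR (72 / QDen q) <> 0).
  { intros E0. rewrite E0 Rmult_0_r in E'. lra. }
  field. now split.
Qed.

Lemma xi7_braces : xi7 t u = brace_comb braces t u.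
Proof. unfold xi7, xi7_1, xi7_2, xi7_3, brace_comb. now rewrite -!flat_map_app. Qed.

Lemma polylog_linear_xi7 :
  polylog_linear 7 (xi7 t u) = / 72 * lsum (fun x => IZR (twt x) * svlog 7 (evM gensC (targ x))) terms.
Proof.
  rewrite xi7_braces.
  (* The stored list carries exactly the weights and arguments that the braces produce; here the
     checked data meet xi_7. *)
  assert (Eargs : args = map (fun x => (twt x, targ x)) terms) by (vm_compute; reflexivity).
  transitivity (/ 72 * lsum (fun p => IZR (fst p) * svlog 7 (evM gensC (snd p))) args);
    [|now rewrite Eargs lsum_map].
  unfold args. clear Eargs.
  assert (Hq : forallb (fun b => 72 mod QDen (fst b) =? 0)%Z braces = true) by reflexivity.
  assert (Wf : forall a b c d x, In x (brace0M a b c d) -> wfM x).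
  { intros a b c d x Hx. apply in_map_iff in Hx as [[g h] [<- Hx]]. apply in_prod_iff in Hx as [Hg Hh].
    assert (W : forall g, In g fiM -> wfM (in_t g) /\ wfM (in_u g)).
    { intros k [<-|[<-|[<-|[]]]]; repeat split; reflexivity. }
    assert (wfM (in_t fM) /\ wfM (in_u fM)) as [W3 W4] by (repeat split; reflexivity).
    unfold argM. repeat (apply wfM_smul || apply wfM_spow); try assumption; now apply W. }
  (* The formula holds for any list of braces whose denominators divide 72, so the concrete list
     need not be expanded. *)
  revert Hq. generalize braces. induction l as [|[q [[[a b] c] d]] l IH]; intros Hq.
  - cbn. ring.
  - cbn [forallb fst] in Hq. apply andb_prop in Hq as [Hq1 Hq2]. apply Z.eqb_eq in Hq1.
    unfold brace_comb. cbn [flat_map].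
    rewrite polylog_linear_app. change (flat_map _ l) with (brace_comb l t u) at 1. rewrite IH //.
    assert (App : forall (G : Z * smono -> R) v w, lsum G (v ++ w) = lsum G v + lsum G w).
    { intros G v w. induction v as [|? ? IHu]; cbn; [ring | rewrite IHu; ring]. }
    rewrite App Rmult_plus_distr_l. f_equal.
    unfold brace. rewrite !brace0_evM -map_app. fold (braceM a b c d).
    assert (Wf' : forall x, In x (braceM a b c d) -> wfM x).
    { intros x Hx. apply in_app_or in Hx as [Hx|Hx]; eapply Wf, Hx. }
    revert Wf'. generalize (braceM a b c d). induction l0 as [|x l0 IH0]; intros Wf'.
    + cbn. ring.
    + cbn [map scale lsum fst snd] in IH0 |- *. rewrite polylog_linear_cons IH0; [|intros; apply Wf'; now right].
      rewrite polylog_7; [|apply evM_neq_0; [exact Hgs | apply Wf'; now left]].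
      rewrite Qreals.Q2R_mult wt_Q2R // (_ : Q2R 1 = 1); [|unfold Q2R; cbn; field]. field.
Qed.
End Arguments.

(** * Evaluation of the certificates at complex points *)

Definition evalP (t u : C) (p : pe) : C :=
  PEeval (RtoC 0) (RtoC 1) Cplus Cmult Cminus Copp (fun z : Z => RtoC (IZR z)) BinNat.N.to_nat Cpow [t; u] p.

(** This is the soundness lemma behind the [ring] tactic on the complex numbers, applied to normal
    forms that were computed once. *)
Lemma peq_correct (t u : C) (p q : pe) : peq p q = true -> evalP t u p = evalP t u q.
Proof. intros H. exact (C_ring_ring_ring_lemma1 0 [t; u] [] p q I H). Qed.

Lemma evalP_gensP (t u : C) : map (evalP t u) gensP = gensC t u.
Proof.
  unfold gensC, den.
  rewrite (_ : (1 - t + t ^ 2 = 1 - t + t * t)%C); [|ring].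
  rewrite (_ : (1 - u + u ^ 2 = 1 - u + u * u)%C); [|ring].
  reflexivity.
Qed.

Lemma evalP_monoP (t u : C) (gs : list pe) (v : list Z) : List.Forall (fun k => 0 <= k)%Z v ->
  evalP t u (monoP gs v) = mono (map (evalP t u) gs) v.
Proof.
  intros Hv. revert gs. induction Hv as [|k v Hk Hv IH]; intros [|g gs]; try reflexivity.
  cbn [monoP map mono]. rewrite -IH.
  change (evalP t u (PEmul (PEpow g (Z.to_N k)) (monoP gs v)))
    with (Cpow (evalP t u g) (N.to_nat (Z.to_N k)) * evalP t u (monoP gs v))%C.
  f_equal. destruct k as [|k|k]; [reflexivity | reflexivity | lia].
Qed.

Definition relC (t u : C) (l : nat) : C := evalP t u (nth l relsP (PEc 0%Z)).

Definition prodC (F : nat -> C) (l : list nat) : C := fold_right (fun i p => F i * p)%C 1%C l.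

Lemma evalP_prodP (t u : C) (l : list nat) : evalP t u (prodP l) = prodC (relC t u) l.
Proof. induction l as [|i l IH]; [reflexivity|]. cbn [prodP prodC fold_right]. rewrite -/(prodC _ _) -IH. reflexivity. Qed.

Lemma common_spec (e d : list Z) : length e = length d ->
  length (common e d) = length e /\ List.Forall (fun k => 0 <= k)%Z (common e d) /\
  List.Forall (fun k => 0 <= k)%Z (vadd (common e d) e) /\ List.Forall (fun k => 0 <= k)%Z (vadd (common e d) d).
Proof.
  revert d; induction e as [|x e IH]; intros [|y d] H; try discriminate H.
  - repeat split; constructor.
  - injection H as H. destruct (IH d H) as [A [B [D E]]]. cbn.
    repeat split; [now rewrite A|..]; constructor; try assumption; lia.
Qed.

(** The certified polynomial identity is this one multiplied by the monomial with exponents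
    [common e d], which is nonzero at (t, u). *)
Lemma one_minus_arg (t u : C) (x : term) : nonzero (gensC t u) -> In x terms ->
  (1 - evM (gensC t u) (targ x) = evM (gensC t u) (tcomp x) * prodC (relC t u) (trels x))%C.
Proof.
  intros Hgs Hx. destruct (term_wf x Hx) as [_ [He [_ [Hd _]]]].
  pose proof (proj1 (forallb_forall _ _) terms_ok x Hx) as H. unfold term_ok in H. unfold evM.
  destruct (targ x) as [s e]. destruct (tcomp x) as [s' d]. cbn [fst snd] in *.
  apply (peq_correct t u) in H.
  destruct (common_spec e d) as [A [B [D E]]]; [congruence|].
  set (v := common e d) in *.
  change (evalP t u (monoP gensP v) - RtoC (IZR s) * evalP t u (monoP gensP (vadd v e)) =
    RtoC (IZR s') * (evalP t u (monoP gensP (vadd v d)) * evalP t u (prodP (trels x))))%C in H.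
  rewrite !evalP_monoP // evalP_gensP evalP_prodP in H.
  rewrite !mono_vadd // in H; try congruence.
  pose proof (mono_neq_0 (gensC t u) v Hgs) as Hv.
  set (mv := mono (gensC t u) v) in *.
  replace (1 - IZR s * mono (gensC t u) e)%C with ((mv - IZR s * (mv * mono (gensC t u) e)) / mv)%C by now field.
  rewrite H. now field.
Qed.

(** * Polynomial functions of the path parameter *)

Fixpoint peval (p : list C) (s : R) : C :=
  match p with [] => 0%C | a :: p' => (a + s * peval p' s)%C end.

Definition polyfun (F : R -> C) : Prop := exists p, forall s, F s = peval p s.

Lemma polyfun_const (c : C) : polyfun (fun _ => c).
Proof. exists [c] => s. cbn [peval]. ring. Qed.

Lemma polyfun_id : polyfun RtoC.
Proof. exists [RtoC 0; RtoC 1] => s. cbn [peval]. ring. Qed.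

Lemma polyfun_plus (F G : R -> C) : polyfun F -> polyfun G -> polyfun (fun s => F s + G s)%C.
Proof.
  intros [p Hp] [q Hq].
  enough (H : exists r, forall s, (peval p s + peval q s)%C = peval r s).
  { destruct H as [r Hr]. exists r => s. now rewrite Hp Hq. }
  clear F G Hp Hq. revert q. induction p as [|a p IH]; intros q.
  - exists q => s. cbn [peval]. ring.
  - destruct q as [|b q]; [exists (a :: p) => s; cbn [peval]; ring|].
    destruct (IH q) as [r Hr]. exists ((a + b)%C :: r) => s. cbn [peval]. rewrite -Hr. ring.
Qed.

Lemma polyfun_scal (c : C) (F : R -> C) : polyfun F -> polyfun (fun s => c * F s)%C.
Proof.
  intros [p Hp]. exists (map (Cmult c) p) => s. rewrite Hp. clear Hp.
  induction p as [|a p IH]; cbn [peval map]; [ring | rewrite -IH; ring].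
Qed.

Lemma polyfun_mult (F G : R -> C) : polyfun F -> polyfun G -> polyfun (fun s => F s * G s)%C.
Proof.
  intros [p Hp] HG.
  enough (H : polyfun (fun s => peval p s * G s)%C).
  { destruct H as [r Hr]. exists r => s. now rewrite Hp Hr. }
  clear F Hp. induction p as [|a p IH].
  - exists [] => s. cbn [peval]. ring.
  - destruct IH as [r Hr]. destruct (polyfun_plus (fun s => a * G s)%C (fun s => s * peval r s)%C) as [q Hq].
    + now apply polyfun_scal.
    + exists (RtoC 0 :: r) => s. cbn [peval]. ring.
    + exists q => s. rewrite -Hq -Hr. cbn [peval]. ring.
Qed.

Lemma polyfun_pow (F : R -> C) (n : nat) : polyfun F -> polyfun (fun s => Cpow (F s) n).
Proof.
  intros H. induction n as [|n IH]; [exact (polyfun_const 1)|]. now apply (polyfun_mult F).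
Qed.

Lemma polyfun_ext (F G : R -> C) : (forall s, F s = G s) -> polyfun F -> polyfun G.
Proof. intros H [p Hp]. exists p => s. now rewrite -H. Qed.

Lemma polyfun_minus (F G : R -> C) : polyfun F -> polyfun G -> polyfun (fun s => F s - G s)%C.
Proof.
  intros HF HG. apply polyfun_ext with (fun s => F s + (-1) * G s)%C; [intros; ring|].
  apply polyfun_plus; [|apply polyfun_scal]; assumption.
Qed.

(** Evaluation of a variable is a lookup by [BinList.nth]; this lemma moves the path parameter out
    of the list of values. *)
Lemma BinList_nth_map {A B : Type} (g : A -> B) (d : A) (j : positive) (l : list A) :
  BinList.nth (g d) j (map g l) = g (BinList.nth d j l).
Proof.
  assert (Tl : forall l, tl (map g l) = map g (tl l)) by now intros [].
  assert (J : forall j l, BinList.jump j (map g l) = map g (BinList.jump j l)).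
  { clear j l. intros j; induction j as [j IH|j IH|]; intros l; cbn; rewrite ?Tl ?IH; reflexivity. }
  revert l; induction j as [j IH|j IH|]; intros l; cbn.
  - now rewrite Tl J IH.
  - now rewrite J IH.
  - now destruct l.
Qed.

Lemma BinList_nth_in {A : Type} (d : A) (j : positive) (l : list A) :
  In (BinList.nth d j l) (d :: l).
Proof.
  assert (Tl : forall l : list A, incl (tl l) l).
  { intros [|a l' ]; [easy | intros x Hx; now right]. }
  assert (J : forall j (l : list A), incl (BinList.jump j l) l).
  { clear j l. intros j; induction j as [j IH|j IH|]; intros l; cbn; eauto using incl_tran. }
  revert l; induction j as [j IH|j IH|]; intros l; cbn [BinList.nth].
  - destruct (IH (BinList.jump j (tl l))) as [E|E]; [now left|]. right. apply (Tl l), (J j _), E.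
  - destruct (IH (BinList.jump j l)) as [E|E]; [now left|]. right. apply (J j _), E.
  - destruct l; cbn; auto.
Qed.

Lemma polyfun_evalP (T U : R -> C) (p : pe) : polyfun T -> polyfun U ->
  polyfun (fun s => evalP (T s) (U s) p).
Proof.
  intros HT HU. induction p as [| |c|j|p1 IH1 p2 IH2|p1 IH1 p2 IH2|p1 IH1 p2 IH2|p IH|p IH n].
  - exact (polyfun_const 0).
  - exact (polyfun_const 1).
  - exact (polyfun_const (RtoC (IZR c))).
  - apply polyfun_ext with (BinList.nth (fun _ => RtoC 0) j [T; U]).
    + intros s. symmetry.
      exact (BinList_nth_map (fun F : R -> C => F s) (fun _ => RtoC 0) j [T; U]).
    + destruct (BinList_nth_in (fun _ => RtoC 0) j [T; U]) as [E|E]; [rewrite -E; exact (polyfun_const 0)|].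
      destruct E as [<-|[<-|[]]]; assumption.
  - now apply (polyfun_plus (fun s => evalP (T s) (U s) p1) (fun s => evalP (T s) (U s) p2)).
  - now apply (polyfun_minus (fun s => evalP (T s) (U s) p1) (fun s => evalP (T s) (U s) p2)).
  - now apply (polyfun_mult (fun s => evalP (T s) (U s) p1) (fun s => evalP (T s) (U s) p2)).
  - apply polyfun_ext with (fun s => -1 * evalP (T s) (U s) p)%C; [|now apply polyfun_scal].
    intros s. change (evalP (T s) (U s) (PEopp p)) with (- evalP (T s) (U s) p)%C. ring.
  - exact (polyfun_pow (fun s => evalP (T s) (U s) p) (N.to_nat n) IH).
Qed.

Lemma polyfun_Cder (F : R -> C) (s : R) : polyfun F -> exists l, Cder F s l.
Proof.
  intros [p Hp].
  enough (H : exists l, Cder (peval p) s l).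
  { destruct H as [l Hl]. exists l. apply Cder_ext with (peval p) => //. }
  clear F Hp. induction p as [|a p [l IH]].
  - exists 0%C. apply Cder_const.
  - eexists. apply (Cder_plus (fun _ => a)); [apply Cder_const|].
    apply Cder_mult; [apply Cder_id | exact IH].
Qed.

Lemma peval_factor (p : list C) (r : R) : exists q, (length q <= pred (length p))%nat /\
  forall s : R, peval p s = (peval p r + (s - r) * peval q s)%C.
Proof.
  induction p as [|a p [q [Hl Hq]]].
  - exists []; split; [cbn; lia|]. intros s. cbn [peval]. ring.
  - destruct p as [|b p].
    + exists []; split; [cbn; lia|]. intros s. cbn [peval]. ring.
    + exists (peval (b :: p) r :: q); split; [cbn in *; lia|].
      intros s. cbn [peval] in *. rewrite (Hq s). ring.
Qed.

Lemma polyfun_zeros (F : R -> C) : polyfun F ->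
  (forall s, F s = 0%C) \/ exists l : list R, forall s, F s = 0%C -> In s l.
Proof.
  intros [p Hp].
  enough (H : (forall s, peval p s = 0%C) \/ exists l : list R, forall s, peval p s = 0%C -> In s l).
  { destruct H as [H|[l H]]; [left => s; now rewrite Hp | right; exists l => s; rewrite Hp; apply H]. }
  clear F Hp. remember (length p) as n eqn:Hn. apply Nat.eq_le_incl in Hn as Hn'. rewrite Hn in Hn'.
  assert (G : forall n p, (length p <= n)%nat ->
    (forall s, peval p s = 0%C) \/ exists l : list R, forall s, peval p s = 0%C -> In s l).
  { clear. induction n as [|n IH]; intros p Hp.
    - left => s. destruct p; [reflexivity | cbn in Hp; lia].
    - destruct (classic (exists r, peval p r = 0%C)) as [[r Hr]|N].
      + destruct (peval_factor p r) as [q [Hl Hq]].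
        destruct (IH q) as [Z|[l Hl']]; [lia| |].
        * left => s. rewrite Hq Hr Z. ring.
        * right. exists (r :: l) => s Hs. rewrite Hq Hr Cplus_0_l in Hs.
          destruct (Req_dec s r) as [->|Hne]; [now left|]. right. apply Hl'.
          apply NNPP => Hqs. refine (Cmult_neq_0 _ _ _ Hqs Hs).
          rewrite -RtoC_minus => E. apply RtoC_inj in E. lra.
      + right. exists [] => s Hs. apply N. now exists s. }
  now apply (G (length p)).
Qed.

(** * Constancy along a path *)

Definition arg (t u : C) (x : term) : C := evM (gensC t u) (targ x).

Fixpoint cdot (e : list Z) (a : list C) : C :=
  match e, a with
  | k :: e', z :: a' => (IZR k * z + cdot e' a')%C
  | _, _ => 0%C
  end.

Lemma Re_cdot (e : list Z) (a : list C) : Re (cdot e a) = dot e (map Re a).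
Proof.
  revert a; induction e as [|k e IH]; intros [|z a]; try reflexivity.
  - now rewrite dot_nil.
  - cbn [cdot dot map hd tl]. rewrite -IH /Re /=. ring.
Qed.

Lemma Im_cdot (e : list Z) (a : list C) : Im (cdot e a) = dot e (map Im a).
Proof.
  revert a; induction e as [|k e IH]; intros [|z a]; try reflexivity.
  - now rewrite dot_nil.
  - cbn [cdot dot map hd tl]. rewrite -IH /Im /=. ring.
Qed.

Definition csum (F : nat -> C) (l : list nat) : C := fold_right (fun i s => F i + s)%C 0%C l.

Lemma Re_csum (F : nat -> C) (l : list nat) : Re (csum F l) = lsum (fun i => Re (F i)) l.
Proof. induction l as [|i l IH]; [reflexivity|]. cbn [lsum]. now rewrite -IH. Qed.

Lemma Im_csum (F : nat -> C) (l : list nat) : Im (csum F l) = lsum (fun i => Im (F i)) l.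
Proof. induction l as [|i l IH]; [reflexivity|]. cbn [lsum]. now rewrite -IH. Qed.

Definition logder (r : R) (F : R -> C) (eta : C) : Prop :=
  F r <> 0%C /\ Cder F r (F r * eta)%C.

Lemma Cder_Cpowz (F : R -> C) (r : R) (eta : C) (k : Z) : F r <> 0%C ->
  Cder F r (F r * eta)%C -> Cder (fun s => Cpowz (F s) k) r (Cpowz (F r) k * (IZR k * eta))%C.
Proof.
  intros H0 HF.
  assert (P : forall p : positive, Cder (fun s => Cpow (F s) (Pos.to_nat p)) r
     (Cpow (F r) (Pos.to_nat p) * (IZR (Zpos p) * eta))%C).
  { intros p. rewrite -positive_nat_Z -INR_IZR_INZ. destruct (Pos2Nat.is_succ p) as [n ->].
    eapply Cder_eq; [apply Cder_pow, HF|]. rewrite Cpow_S. ring. }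
  destruct k as [|p|p].
  - eapply Cder_eq; [apply (Cder_const 1)|]. cbn [Cpowz]. ring.
  - apply P.
  - assert (Hp : Cpow (F r) (Pos.to_nat p) <> 0%C) by now apply Cpow_nz.
    eapply Cder_eq; [apply Cder_inv; [apply P | exact Hp]|]. cbv beta.
    cbn [Cpowz]. change (Zneg p) with (- Zpos p)%Z. rewrite opp_IZR RtoC_opp. now field.
Qed.

Lemma Cder_mono (Fs : list (R -> C)) (etas : list C) (r : R) (e : list Z) :
  List.Forall2 (logder r) Fs etas ->
  Cder (fun s => mono (map (fun F => F s) Fs) e) r (mono (map (fun F => F r) Fs) e * cdot e etas)%C.
Proof.
  intros H. revert e. induction H as [|F eta Fs etas [H0 HF] H IH]; intros e.
  - eapply Cder_eq; [apply (Cder_const 1)|]. destruct e; cbn [mono map cdot]; ring.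
  - destruct e as [|k e].
    + eapply Cder_eq; [apply (Cder_const 1)|]. cbn [mono map cdot]; ring.
    + eapply Cder_eq; [apply (Cder_mult (fun s => Cpowz (F s) k) (fun s => mono (map (fun F0 => F0 s) Fs) e));
        [apply Cder_Cpowz; [exact H0 | exact HF] | apply (IH e)]|].
      cbv beta. change (cdot (k :: e) (eta :: etas)) with (IZR k * eta + cdot e etas)%C.
      change (mono (map (fun F0 => F0 r) (F :: Fs)) (k :: e)) with (Cpowz (F r) k * mono (map (fun F0 => F0 r) Fs) e)%C. ring.
Qed.

Lemma ln_Cmod_Cpowz (z : C) (k : Z) : z <> 0%C -> ln (Cmod (Cpowz z k)) = IZR k * ln (Cmod z).
Proof.
  intros Hz. apply Cmod_gt_0 in Hz as Hm.
  assert (P : forall n, ln (Cmod (Cpow z n)) = INR n * ln (Cmod z)).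
  { intros n. now rewrite Cmod_pow ln_pow. }
  destruct k as [|p|p].
  - cbn [Cpowz]. rewrite Cmod_1 ln_1. ring.
  - rewrite Cpowz_pos P INR_IZR_INZ positive_nat_Z. reflexivity.
  - rewrite Cpowz_neg Cmod_inv; [|now apply Cpow_nz].
    rewrite ln_Rinv; [|apply Cmod_gt_0; now apply Cpow_nz].
    rewrite P INR_IZR_INZ positive_nat_Z. change (Zneg p) with (- Zpos p)%Z. rewrite opp_IZR. ring.
Qed.

Lemma ln_Cmod_mult (z w : C) : z <> 0%C -> w <> 0%C -> ln (Cmod (z * w)%C) = ln (Cmod z) + ln (Cmod w).
Proof. intros Hz Hw. rewrite Cmod_mult ln_mult //; now apply Cmod_gt_0. Qed.

Lemma ln_Cmod_mono (gs : list C) (e : list Z) : nonzero gs ->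
  ln (Cmod (mono gs e)) = dot e (map (fun g => ln (Cmod g)) gs).
Proof.
  intros H. revert e; induction H as [|g gs Hg H IH]; intros [|k e]; cbn [mono map dot hd tl].
  1-3: rewrite Cmod_1 ln_1 ?dot_nil; ring.
  rewrite ln_Cmod_mult; [|now apply Cpowz_neq_0 | now apply mono_neq_0].
  now rewrite ln_Cmod_Cpowz // IH.
Qed.

Lemma ln_Cmod_evM (gs : list C) (x : smono) : nonzero gs -> wfM x ->
  ln (Cmod (evM gs x)) = dot (snd x) (map (fun g => ln (Cmod g)) gs).
Proof.
  intros H Hx. unfold evM. rewrite Cmod_mult.
  rewrite (_ : Cmod (RtoC (IZR (fst x))) = 1).
  - now rewrite Rmult_1_l ln_Cmod_mono.
  - rewrite Cmod_R. destruct (wfM_sign x Hx) as [-> | ->]; [apply Rabs_R1|].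
    rewrite Rabs_left; lra.
Qed.

Lemma ln_Cmod_prodC (F : nat -> C) (l : list nat) : (forall i, In i l -> F i <> 0%C) ->
  prodC F l <> 0%C /\ ln (Cmod (prodC F l)) = lsum (fun i => ln (Cmod (F i))) l.
Proof.
  induction l as [|i l IH]; intros H.
  - cbn. split; [apply C1_nz|]. rewrite Cmod_1. apply ln_1.
  - destruct IH as [A B]; [intros; apply H; now right|].
    assert (Hi : F i <> 0%C) by (apply H; now left).
    change (prodC F (i :: l)) with (F i * prodC F l)%C. cbn [lsum]. split.
    + now apply Cmult_neq_0.
    + now rewrite ln_Cmod_mult // B.
Qed.

Lemma prodC_eq_0 (F : nat -> C) (l : list nat) : prodC F l = 0%C -> exists i, In i l /\ F i = 0%C.
Proof.
  intros H. apply NNPP => N. apply (proj1 (ln_Cmod_prodC F l (fun i Hi E => N (ex_intro _ i (conj Hi E))))), H.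
Qed.

Lemma prodC_zero (F : nat -> C) (l : list nat) (i : nat) : In i l -> F i = 0%C -> prodC F l = 0%C.
Proof.
  induction l as [|j l IH]; [easy|]. intros [->|Hi] E;
  change (prodC F (?a :: l)) with (F a * prodC F l)%C.
  - rewrite E. ring.
  - rewrite IH //. ring.
Qed.

Lemma Cder_prodC (F : nat -> R -> C) (delta : nat -> C) (l : list nat) (r : R) :
  (forall i, In i l -> Cder (F i) r (F i r * delta i)%C) ->
  Cder (fun s => prodC (fun i => F i s) l) r (prodC (fun i => F i r) l * csum delta l)%C.
Proof.
  induction l as [|i l IH]; intros H.
  - eapply Cder_eq; [apply (Cder_const 1)|]. cbn; ring.
  - eapply Cder_eq.
    + apply (Cder_mult (F i) (fun s => prodC (fun i => F i s) l)); [apply H; now left | apply IH; intros; apply H; now right].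
    + change (csum delta (i :: l)) with (delta i + csum delta l)%C.
      change (prodC (fun i => F i r) (i :: l)) with (F i r * prodC (fun i => F i r) l)%C. ring.
Qed.

Lemma Cder_evM (Fs : list (R -> C)) (etas : list C) (r : R) (x : smono) :
  List.Forall2 (logder r) Fs etas ->
  Cder (fun s => evM (map (fun F => F s) Fs) x) r (evM (map (fun F => F r) Fs) x * cdot (snd x) etas)%C.
Proof.
  intros H. unfold evM. eapply Cder_eq.
  - apply (Cder_mult (fun _ => RtoC (IZR (fst x))) (fun s => mono (map (fun F => F s) Fs) (snd x)));
      [apply Cder_const | apply (Cder_mono _ _ _ _ H)].
  - cbv beta. ring.
Qed.

(* If [arg] is identically 1 then [rho = 0] and [eta = 0], so the formula for
   the derivative remains valid there, whatever the junk values of [sigma]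
   and [delta] for the vanishing factors. *)
Lemma is_derive_svlog_arg (m : nat) (T U : R -> C) (etas : list C) (delta : nat -> C) (r d : R) (x : term) :
  (2 <= m <= 7)%nat -> In x terms -> 0 < d ->
  (forall s, Rabs (s - r) < d -> nonzero (gensC (T s) (U s))) ->
  List.Forall2 (logder r)
    [T; (fun s => 1 - T s)%C; (fun s => den (T s)); U; (fun s => 1 - U s)%C; (fun s => den (U s))] etas ->
  (forall l, (l < 51)%nat -> relC (T r) (U r) l <> 0%C ->
     Cder (fun s => relC (T s) (U s) l) r (relC (T r) (U r) l * delta l)%C) ->
  (forall l, (l < 51)%nat -> relC (T r) (U r) l = 0%C -> forall s, relC (T s) (U s) l = 0%C) ->
  let rhos := map (fun g => ln (Cmod g)) (gensC (T r) (U r)) in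
  is_derive (fun s => svlog m (arg (T s) (U s) x)) r
    (dform m (dot (snd (targ x)) rhos)
       (dot (snd (tcomp x)) rhos + lsum (fun l => ln (Cmod (relC (T r) (U r) l))) (trels x))
       (cdot (snd (targ x)) etas) (cdot (snd (tcomp x)) etas + csum delta (trels x))
       (fun k => svlog k (arg (T r) (U r) x))).
Proof.
  intros Hm Hx Hd Hnz HF Hrel Hrel0 rhos.
  destruct (term_wf x Hx) as [Hs1 [He [Hs2 [Hdl Hl]]]].
  assert (Hnzr : nonzero (gensC (T r) (U r))) by (apply Hnz; rewrite Rminus_eq_0 Rabs_R0; lra).
  pose proof (Cder_evM _ _ _ (targ x) HF) as HA.
  change (Cder (fun s => arg (T s) (U s) x) r (arg (T r) (U r) x * cdot (snd (targ x)) etas)%C) in HA.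
  pose proof (Cder_evM _ _ _ (tcomp x) HF) as HC.
  change (Cder (fun s => evM (gensC (T s) (U s)) (tcomp x)) r
    (evM (gensC (T r) (U r)) (tcomp x) * cdot (snd (tcomp x)) etas)%C) in HC.
  assert (Hrho : ln (Cmod (arg (T r) (U r) x)) = dot (snd (targ x)) rhos) by (now apply ln_Cmod_evM).
  assert (H0 : arg (T r) (U r) x <> 0%C) by (now apply evM_neq_0).
  assert (E1 : forall s, Rabs (s - r) < d -> (1 - arg (T s) (U s) x =
     evM (gensC (T s) (U s)) (tcomp x) * prodC (relC (T s) (U s)) (trels x))%C).
  { intros s Hs. apply one_minus_arg => //. now apply Hnz. }
  assert (Hloc : locally r (fun s => Rabs (s - r) < d)) by (now exists (mkposreal d Hd)).
  assert (E1r := E1 r ltac:(rewrite Rminus_eq_0 Rabs_R0; lra)).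
  set (eta := cdot (snd (targ x)) etas) in *.
  destruct (classic (arg (T r) (U r) x = 1%C)) as [H1|H1].
  - assert (Hp : prodC (relC (T r) (U r)) (trels x) = 0%C).
    { apply NNPP => N. apply (Cmult_neq_0 _ _ (evM_neq_0 _ (tcomp x) Hnzr (conj Hs2 Hdl)) N).
      rewrite -E1r H1. ring. }
    (* Some factor of 1 - x vanishes at [r], hence by [Hrel0] along the whole path, and x is
       constantly 1 near [r]. *)
    apply prodC_eq_0 in Hp as [l [Hlx Hl0]].
    assert (Hone : forall s, Rabs (s - r) < d -> arg (T s) (U s) x = 1%C).
    { intros s Hs. specialize (E1 s Hs).
      rewrite (prodC_zero _ _ l Hlx (Hrel0 l (Hl l Hlx) Hl0 s)) in E1.
      rewrite (_ : (arg (T s) (U s) x = 1 - (1 - arg (T s) (U s) x))%C); [|ring]. rewrite E1. ring. }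
    assert (Heta : eta = 0%C).
    { assert (Hc : Cder (fun s => arg (T s) (U s) x) r 0%C).
      { apply Cder_ext_loc with (fun _ => RtoC 1); [|apply Cder_const].
        apply: filter_imp Hloc => s Hs. now rewrite Hone. }
      pose proof (Cder_unique _ _ _ _ HA Hc) as E. rewrite H1 in E. rewrite -E. ring. }
    rewrite -Hrho H1 Cmod_1 ln_1 Heta.
    apply is_derive_ext_loc with (fun _ => svlog m 1).
    { apply: filter_imp Hloc => s Hs. now rewrite Hone. }
    eapply is_derive_eq; [apply: is_derive_const|].
    change (@zero _) with 0.
    assert (Re 0%C = 0 /\ Im 0%C = 0) as [Z1 Z2] by (split; reflexivity).
    do 8 (destruct m as [|m]; [cbn [dform]; rewrite ?Z1 ?Z2; cbn; ring|]). lia.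
  - assert (H1' : (1 - arg (T r) (U r) x <> 0)%C).
    { intros E. apply H1. rewrite (_ : (arg (T r) (U r) x = 1 - (1 - arg (T r) (U r) x))%C); [|ring]. rewrite E. ring. }
    assert (Hrl : forall l, In l (trels x) -> relC (T r) (U r) l <> 0%C).
    { intros l Hlx E. apply H1'. rewrite E1r (prodC_zero _ _ l Hlx E). ring. }
    destruct (ln_Cmod_prodC _ _ Hrl) as [Hp Hlnp].
    assert (Hlam : ln (Cmod (1 - arg (T r) (U r) x)%C) =
       dot (snd (tcomp x)) rhos + lsum (fun l => ln (Cmod (relC (T r) (U r) l))) (trels x)).
    { rewrite E1r ln_Cmod_mult //; [|now apply evM_neq_0]. rewrite Hlnp. f_equal. now apply ln_Cmod_evM. }
    (* Both sides are the logarithmic derivative of 1 - x, computed once from x and once from the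
       factorization. *)
    assert (Hdelta : (- (arg (T r) (U r) x * eta / (1 - arg (T r) (U r) x)) =
       cdot (snd (tcomp x)) etas + csum delta (trels x))%C).
    { assert (D1 : Cder (fun s => 1 - arg (T s) (U s) x)%C r (0 - arg (T r) (U r) x * eta)%C).
      { apply (Cder_minus (fun _ => RtoC 1)); [apply Cder_const | exact HA]. }
      assert (D2 : Cder (fun s => 1 - arg (T s) (U s) x)%C r
         ((1 - arg (T r) (U r) x) * (cdot (snd (tcomp x)) etas + csum delta (trels x)))%C).
      { apply Cder_ext_loc with (fun s => evM (gensC (T s) (U s)) (tcomp x) * prodC (relC (T s) (U s)) (trels x))%C.
        { apply: filter_imp Hloc => s Hs. symmetry. now apply E1. }
        eapply Cder_eq.
        - apply Cder_mult; [exact HC|].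
          apply (Cder_prodC (fun l s => relC (T s) (U s) l) delta). intros l Hlx. apply Hrel; auto.
        - cbv beta. rewrite E1r.
          change (fun i => relC (T r) (U r) i) with (relC (T r) (U r)). ring. }
      pose proof (Cder_unique _ _ _ _ D1 D2) as E.
      rewrite (_ : (cdot (snd (tcomp x)) etas + csum delta (trels x) =
        ((1 - arg (T r) (U r) x) * (cdot (snd (tcomp x)) etas + csum delta (trels x))) / (1 - arg (T r) (U r) x))%C);
        [|now field].
      rewrite -E. now field. }
    pose proof (is_derive_svlog m _ r _ Hm HA H0 H1) as HD.
    eapply is_derive_eq; [exact HD|].
    unfold dsvlog. rewrite Hdelta Hlam Hrho. f_equal. now field.
Qed.

(* After expanding [dform], a factor [rho] or [eta], being linear in the
   exponents, can be moved into the list of weights. *)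
Lemma sum_dform_0 (m : nat) (rhos eR eI : list R) (sg dR dI : nat -> R) (L : term -> nat -> R)
    (eta delta : term -> C) (vs : list (list R)) : (2 <= m <= 7)%nat -> length vs = (7 - m)%nat ->
  (forall x, Re (eta x) = dot (snd (targ x)) eR) -> (forall x, Im (eta x) = dot (snd (targ x)) eI) ->
  (forall x, Re (delta x) = dot (snd (tcomp x)) eR + lsum dR (trels x)) ->
  (forall x, Im (delta x) = dot (snd (tcomp x)) eI + lsum dI (trels x)) ->
  (forall k ws, (2 <= k < m)%nat -> length ws = (7 - k)%nat ->
     lsum (fun x => IZR (twt x) * dots ws (snd (targ x)) * L x k) terms = 0) ->
  lsum (fun x => IZR (twt x) * dots vs (snd (targ x)) *
    dform m (dot (snd (targ x)) rhos) (dot (snd (tcomp x)) rhos + lsum sg (trels x)) (eta x) (delta x) (L x)) terms = 0.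
Proof.
  intros Hm Hvs H1 H2 H3 H4 IH.
  pose proof (fun ws b d Hws => symbol_vanishes ws rhos b sg d Hws) as SV.
  set (w := fun ws x => IZR (twt x) * dots ws (snd (targ x))) in *.
  set (A := fun x => dot (snd (targ x)) rhos) in *.
  set (lam := fun x => dot (snd (tcomp x)) rhos + lsum sg (trels x)) in *.
  set (BR := fun x => dot (snd (targ x)) eR). set (BI := fun x => dot (snd (targ x)) eI).
  set (DR := fun x => dot (snd (tcomp x)) eR + lsum dR (trels x)).
  set (DI := fun x => dot (snd (tcomp x)) eI + lsum dI (trels x)).
  assert (Comb : forall (c1 c2 c3 c4 : R) F1 F2 F3 F4, lsum F1 terms = 0 -> lsum F2 terms = 0 ->
    lsum F3 terms = 0 -> lsum F4 terms = 0 ->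
    lsum (fun x => c1 * F1 x + (c2 * F2 x + (c3 * F3 x + c4 * F4 x))) terms = 0).
  { intros c1 c2 c3 c4 F1 F2 F3 F4 E1 E2 E3 E4. rewrite !lsum_plus !lsum_scal E1 E2 E3 E4. ring. }
  assert (Z : lsum (fun _ : term => 0) terms = 0) by now apply lsum_0.
  (* The numbers of weights match. The symbol term of weight m comes with rho^(m-2), so m - 2 copies
     of [rhos] and the 7 - m forms of [vs] make five for m = 2, 3, 5, 7. In [I1], [I2], [I4] the
     weight drops by 1, 2, 4 and as many forms are added. *)
  pose proof (SV (rhos :: vs) eR dR) as S1. pose proof (SV vs eI dI) as S0.
  pose proof (SV (rhos :: rhos :: rhos :: vs) eR dR) as S3.
  pose proof (SV (rhos :: rhos :: rhos :: rhos :: rhos :: vs) eR dR) as S5.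
  pose proof (fun k => IH k (eI :: vs)) as I1.
  pose proof (fun k => IH k (rhos :: eR :: vs)) as I2.
  pose proof (fun k => IH k (rhos :: rhos :: rhos :: eR :: vs)) as I4.
  do 2 (destruct m as [|m]; [lia|]).
  destruct m as [|m].
  { rewrite -(S0 Hvs). apply lsum_ext => x _. cbn [dform]. rewrite H2 H4. reflexivity. }
  destruct m as [|m].
  { rewrite -(Comb (-1) (- / 3) 0 0 _ _ _ _ (I1 2%nat ltac:(lia) ltac:(cbn; lia)) (S1 ltac:(cbn; lia)) Z Z).
    apply lsum_ext => x _. cbn [dform]. unfold w. cbn [dots]. rewrite H1 H2 H3. unfold lam, A. ring. }
  destruct m as [|m].
  { rewrite -(Comb 1 (- / 3) 0 0 _ _ _ _ (I1 3%nat ltac:(lia) ltac:(cbn; lia)) (I2 2%nat ltac:(lia) ltac:(cbn; lia)) Z Z).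
    apply lsum_ext => x _. cbn [dform]. unfold w. cbn [dots]. rewrite H1 H2. unfold lam, A. ring. }
  destruct m as [|m].
  { rewrite -(Comb (-1) (- / 3) (/ 45) 0 _ _ _ _ (I1 4%nat ltac:(lia) ltac:(cbn; lia)) (I2 3%nat ltac:(lia) ltac:(cbn; lia)) (S3 ltac:(cbn; lia)) Z).
    apply lsum_ext => x _. cbn [dform]. unfold w. cbn [dots]. rewrite H1 H2 H3. unfold lam, A. ring. }
  destruct m as [|m].
  { rewrite -(Comb 1 (- / 3) (/ 45) 0 _ _ _ _ (I1 5%nat ltac:(lia) ltac:(cbn; lia)) (I2 4%nat ltac:(lia) ltac:(cbn; lia))
      (I4 2%nat ltac:(lia) ltac:(cbn; lia)) Z).
    apply lsum_ext => x _. cbn [dform]. unfold w. cbn [dots]. rewrite H1 H2. unfold lam, A. ring. }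
  destruct m as [|m]; [|lia].
  rewrite -(Comb (-1) (- / 3) (/ 45) (- (2 / 945)) _ _ _ _ (I1 6%nat ltac:(lia) ltac:(cbn; lia)) (I2 5%nat ltac:(lia) ltac:(cbn; lia))
      (I4 3%nat ltac:(lia) ltac:(cbn; lia)) (S5 ltac:(cbn; lia))).
  apply lsum_ext => x _. cbn [dform]. unfold w. cbn [dots]. rewrite H1 H2 H3. unfold lam, A. ring.
Qed.

(** * Paths to the zeros of [den], the primitive sixth roots of unity *)

Definition root6 (w : C) : Prop := (w * w = w - 1)%C.

(** The path is run backwards: the root is at [r = 0] and the given point at [r = 1]. The parameter
    is complex so that [Cpow r 4] can be inserted. *)
Definition to_root (w t0 : C) (r : C) : C := (w + r * (t0 - w))%C.

Lemma den_factor (w z : C) : root6 w -> den z = ((z - w) * (z - (1 - w)))%C.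
Proof.
  intros Hw. unfold den.
  rewrite (_ : ((z - w) * (z - (1 - w)) = z * z - z + (w - w * w))%C); [|ring].
  rewrite Hw. ring.
Qed.

(* For [t0] in the closed upper half plane, the segment from [t0] to the root
   [w] of [den] in the upper half plane avoids 0, 1 and the other root; the
   lower half plane is symmetric. *)
Lemma exists_root_path (t0 : C) : t0 <> 0%C -> (1 - t0 <> 0)%C -> den t0 <> 0%C ->
  exists w, root6 w /\ forall r, 0 < r <= 1 ->
    to_root w t0 r <> 0%C /\ (1 - to_root w t0 r <> 0)%C /\ den (to_root w t0 r) <> 0%C.
Proof.
  intros H0 H1 Hd.
  set (q := sqrt 3 / 2).
  assert (Hq : q * q = 3 / 4).
  { unfold q. pose proof (sqrt_sqrt 3 ltac:(lra)). nra. }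
  assert (Hq0 : 0 < q) by (unfold q; pose proof (sqrt_lt_R0 3 ltac:(lra)); lra).
  assert (Gen : forall e : R, e * e = 1 -> 0 <= e * Im t0 -> exists w, root6 w /\ forall r, 0 < r <= 1 ->
    to_root w t0 r <> 0%C /\ (1 - to_root w t0 r <> 0)%C /\ den (to_root w t0 r) <> 0%C).
  { intros e He Ht. set (w := (/ 2, e * q) : C). exists w.
    assert (Hw : root6 w).
    { apply C_eq; unfold w, Re, Im; cbn; [|field].
      replace (e * q * (e * q)) with ((e * e) * (q * q)) by ring. rewrite He Hq. field. }
    split; [exact Hw|]. intros r Hr. set (z := to_root w t0 r).
    destruct (Req_dec r 1) as [E1|Hr1].
    { assert (Ez : z = t0) by (unfold z, to_root; rewrite E1; ring). rewrite Ez. auto. }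
    assert (HIm : 0 < e * Im z).
    { unfold z, to_root. rewrite (_ : Im (w + r * (t0 - w))%C = (1 - r) * (e * q) + r * Im t0);
        [|unfold w, Im; cbn; ring].
      replace (e * ((1 - r) * (e * q) + r * Im t0)) with ((1 - r) * q * (e * e) + r * (e * Im t0)) by ring.
      rewrite He. assert (0 < (1 - r) * q) by (apply Rmult_lt_0_compat; lra). nra. }
    split; [|split].
    - intros E. rewrite E (_ : Im 0%C = 0) in HIm; [lra | reflexivity].
    - intros E. rewrite (_ : Im z = - Im (1 - z)%C) in HIm; [|unfold Im; cbn; ring].
      rewrite E (_ : Im 0%C = 0) in HIm; [lra | reflexivity].
    - rewrite (den_factor w z Hw). apply Cmult_neq_0.
      + unfold z, to_root. rewrite (_ : (w + r * (t0 - w) - w = r * (t0 - w))%C); [|ring].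
        apply Cmult_neq_0.
        * intros E. apply RtoC_inj in E. lra.
        * intros E. apply Hd. rewrite (den_factor w t0 Hw) E. ring.
      + intros E.
        rewrite (_ : Im z = Im (z - (1 - w))%C - e * q) in HIm; [|unfold w, Im; cbn; ring].
        rewrite E (_ : Im 0%C = 0) in HIm; [|reflexivity].
        assert (0 < q * (e * e)) by (rewrite He; lra). nra. }
  destruct (Rle_dec 0 (Im t0)); [apply (Gen 1) | apply (Gen (-1))]; lra.
Qed.

Lemma exists_logder (Fs : list (R -> C)) (r : R) :
  List.Forall (fun F : R -> C => polyfun F /\ F r <> 0%C) Fs -> exists etas, List.Forall2 (logder r) Fs etas.
Proof.
  intros H. induction H as [|F Fs [HF H0] H [etas IH]].
  - exists []. constructor.
  - destruct (polyfun_Cder F r HF) as [l Hl]. exists ((l / F r)%C :: etas). constructor; [|exact IH].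
    split; [exact H0|]. eapply Cder_eq; [exact Hl|]. now field.
Qed.

(** The total function [Derive] provides the logarithmic derivatives for all indices at once,
    without a choice. *)
Lemma exists_delta (H : nat -> R -> C) (r : R) : (forall l, polyfun (H l)) ->
  exists delta : nat -> C, forall l, H l r <> 0%C -> Cder (H l) r (H l r * delta l)%C.
Proof.
  intros HP. exists (fun l => (Derive (fun s => Re (H l s)) r, Derive (fun s => Im (H l s)) r) / H l r)%C.
  intros l Hl. destruct (polyfun_Cder (H l) r (HP l)) as [d Hd].
  eapply Cder_eq; [exact Hd|]. destruct Hd as [D1 D2].
  apply is_derive_unique in D1. apply is_derive_unique in D2.
  rewrite D1 D2. rewrite (_ : (Re d, Im d) = d); [now field | now destruct d].
Qed.

(** The union of the finite zero sets of those functions that are not identically zero. *)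
Lemma exceptional_set (H : nat -> R -> C) (n : nat) : (forall l, polyfun (H l)) ->
  exists E : list R, forall r, ~ In r E -> forall l, (l < n)%nat -> H l r = 0%C -> forall s, H l s = 0%C.
Proof.
  intros HP. induction n as [|n [E IH]].
  - exists []. intros; lia.
  - destruct (polyfun_zeros (H n) (HP n)) as [Z|[E' Z]].
    + exists E => r Hr l Hl. destruct (Nat.eq_dec l n) as [->|Hne]; [auto|]. apply IH; [exact Hr | lia].
    + exists (E ++ E') => r Hr l Hl Hz. destruct (Nat.eq_dec l n) as [->|Hne].
      * exfalso. apply Hr, in_or_app. right. auto.
      * apply (IH r) => //; [|lia]. intros Hi. apply Hr, in_or_app. now left.
Qed.

Lemma is_derive_lsum {A : Type} (F : A -> R -> R) (F' : A -> R) (r : R) (l : list A) :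
  (forall x, In x l -> is_derive (F x) r (F' x)) -> is_derive (fun s => lsum (fun x => F x s) l) r (lsum F' l).
Proof.
  induction l as [|x l IH]; intros H.
  - apply: is_derive_const.
  - apply is_derive_plusR; [apply H; now left | apply IH; intros; apply H; now right].
Qed.

Lemma filterlim_lsum {A : Type} (F : A -> R -> R) (L : A -> R) (G : (R -> Prop) -> Prop) (l : list A) :
  Filter G -> (forall x, In x l -> filterlim (F x) G (locally (L x))) ->
  filterlim (fun s => lsum (fun x => F x s) l) G (locally (lsum L l)).
Proof.
  intros HG. induction l as [|x l IH]; intros H.
  - apply filterlim_const.
  - apply (filterlim_comp_2 (G := locally (L x)) (H := locally (lsum L l)) _ _ Rplus).
    + apply H; now left.
    + apply IH; intros; apply H; now right.
    + apply (filterlim_plus (V := R_NormedModule)).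
Qed.

(** * The weighted sums along the path *)

Section Path.
Variables (w1 w2 t0 u0 : C) (m : nat) (vs : list (list R)).
Hypotheses (Hm : (2 <= m <= 7)%nat) (Hvs : length vs = (7 - m)%nat).
Hypotheses (Hw1 : root6 w1) (Hw2 : root6 w2).

Let T (r : R) : C := to_root w1 t0 r.
(* The exponent 4 makes [den (U r)] vanish at a different rate from any power
   of [den (T r)] occurring in the arguments. *)
Let U (r : R) : C := to_root w2 u0 (Cpow r 4).

Hypothesis Hdom : forall r, 0 < r <= 1 -> nonzero (gensC (T r) (U r)).
Hypothesis IH : forall k, (2 <= k < m)%nat -> forall t u, nonzero (gensC t u) ->
  forall ws, length ws = (7 - k)%nat ->
  lsum (fun x => IZR (twt x) * dots ws (snd (targ x)) * svlog k (arg t u x)) terms = 0.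

Let F (r : R) : R := lsum (fun x => IZR (twt x) * dots vs (snd (targ x)) * svlog m (arg (T r) (U r) x)) terms.

Lemma polyfun_T : polyfun T.
Proof.
  apply (polyfun_plus (fun _ => w1)); [apply polyfun_const|].
  apply polyfun_mult; [apply polyfun_id | apply polyfun_const].
Qed.

Lemma polyfun_U : polyfun U.
Proof.
  apply (polyfun_plus (fun _ => w2)); [apply polyfun_const|].
  apply (polyfun_mult (fun r : R => Cpow r 4)); [apply (polyfun_pow RtoC), polyfun_id | apply polyfun_const].
Qed.

Lemma polyfun_one_minus (G : R -> C) : polyfun G -> polyfun (fun r => 1 - G r)%C.
Proof. intros H. apply (polyfun_minus (fun _ => RtoC 1)); [apply polyfun_const | exact H]. Qed.

Lemma polyfun_den (G : R -> C) : polyfun G -> polyfun (fun r => den (G r)).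
Proof.
  intros H. apply (polyfun_plus (fun r => 1 - G r)%C); [now apply polyfun_one_minus | now apply polyfun_pow].
Qed.

Lemma path_logder (r : R) : nonzero (gensC (T r) (U r)) -> exists etas, List.Forall2 (logder r)
  [T; (fun s => 1 - T s)%C; (fun s => den (T s)); U; (fun s => 1 - U s)%C; (fun s => den (U s))] etas.
Proof.
  intros H. apply exists_logder.
  pose proof polyfun_T. pose proof polyfun_U.
  unfold nonzero, gensC in H. rewrite !List.Forall_cons_iff in H.
  destruct H as (A1 & A2 & A3 & A4 & A5 & A6 & _).
  repeat constructor; try assumption; try (now apply polyfun_one_minus); now apply polyfun_den.
Qed.

Lemma path_sum_derive_0 (r d : R) : 0 < d -> (forall s, Rabs (s - r) < d -> 0 < s <= 1) ->
  (forall l, (l < 51)%nat -> relC (T r) (U r) l = 0%C -> forall s, relC (T s) (U s) l = 0%C) ->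
  is_derive F r 0.
Proof.
  intros Hd Hs Hrel.
  assert (Hr : 0 < r <= 1) by (apply Hs; rewrite Rminus_eq_0 Rabs_R0; lra).
  destruct (path_logder r (Hdom r Hr)) as [etas Hetas].
  destruct (exists_delta (fun l s => relC (T s) (U s) l) r) as [delta Hdelta].
  { intros l. apply polyfun_evalP; [apply polyfun_T | apply polyfun_U]. }
  set (rhos := map (fun g => ln (Cmod g)) (gensC (T r) (U r))).
  eapply is_derive_eq.
  - apply (is_derive_lsum (fun x s => IZR (twt x) * dots vs (snd (targ x)) * svlog m (arg (T s) (U s) x))).
    intros x Hx. apply is_derive_scalR.
    apply (is_derive_svlog_arg m T U etas delta r d x) => //.
    + intros s Hsd. apply Hdom. now apply Hs.
    + intros l _ Hl. now apply Hdelta.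
  - apply (sum_dform_0 m rhos (map Re etas) (map Im etas) (fun l => ln (Cmod (relC (T r) (U r) l)))
      (fun l => Re (delta l)) (fun l => Im (delta l)) (fun x k => svlog k (arg (T r) (U r) x))
      (fun x => cdot (snd (targ x)) etas) (fun x => cdot (snd (tcomp x)) etas + csum delta (trels x))%C) => //.
    + intros x. apply Re_cdot.
    + intros x. apply Im_cdot.
    + intros x. rewrite -Re_cdot -Re_csum. reflexivity.
    + intros x. rewrite -Im_cdot -Im_csum. reflexivity.
    + intros k ws Hk Hws. apply IH => //. now apply Hdom.
Qed.

Lemma path_sum_continuous (r : R) : 0 < r <= 1 -> continuous F r.
Proof.
  intros Hr. destruct (path_logder r (Hdom r Hr)) as [etas Hetas].
  apply (filterlim_lsum (fun x s => IZR (twt x) * dots vs (snd (targ x)) * svlog m (arg (T s) (U s) x))).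
  { apply locally_filter. }
  intros x Hx. change (continuous (fun s => IZR (twt x) * dots vs (snd (targ x)) * svlog m (arg (T s) (U s) x)) r).
  apply (continuous_multR (fun _ => IZR (twt x) * dots vs (snd (targ x)))); [apply continuous_const|].
  apply (continuous_comp (fun s => arg (T s) (U s) x : C_UniformSpace) (svlog m)).
  - eapply Cder_continuous. apply (Cder_evM _ _ _ (targ x) Hetas).
  - apply continuous_svlog; [lia|]. destruct (term_wf x Hx) as [A [B _]].
    apply evM_neq_0; [now apply Hdom | now split].
Qed.

Lemma path_sum_const (r : R) : 0 < r <= 1 -> F r = F 1.
Proof.
  intros Hr.
  destruct (exceptional_set (fun l s => relC (T s) (U s) l) 51) as [E HE].
  { intros l. apply polyfun_evalP; [apply polyfun_T | apply polyfun_U]. }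
  assert (H : Rabs (F 1 - F r - 0 * (1 - r)) <= 0 * (1 - r)).
  { apply (mean_value_except E F (fun _ => 0)); [lra| |].
    - intros s Hs. apply path_sum_continuous. lra.
    - intros s Hs HsE. split; [|rewrite Rminus_0_r Rabs_R0; lra].
      apply path_sum_derive_0 with (Rmin s (1 - s)); [apply Rmin_pos; lra| |now apply HE].
      intros y Hy. pose proof (Rmin_l s (1 - s)). pose proof (Rmin_r s (1 - s)).
      apply Rabs_lt_between in Hy. lra. }
  rewrite !Rmult_0_l Rminus_0_r in H. pose proof (Rabs_pos (F 1 - F r)).
  assert (Rabs (F 1 - F r) = 0) by lra. apply Rabs_eq_0 in H1. lra.
Qed.

End Path.

(** * The limit at the end of the path *)

Lemma svlog_1_even (m : nat) : Nat.odd m = false -> svlog m 1 = 0.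
Proof.
  intros Hm. unfold svlog. rewrite (Series_ext _ (fun _ => 0 * 0)).
  - rewrite Series_scal_l. ring.
  - intros n. unfold svlog_term. rewrite (_ : into_disc 1 = 1%C).
    + rewrite Cpow_1_l. unfold Re_parity. rewrite Hm. rewrite (_ : Im 1%C = 0) //. unfold Rdiv; ring.
    + unfold into_disc. destruct Rle_dec as [|N] => //. exfalso. apply N. rewrite Cmod_1. lra.
Qed.

(** The exponents of [den t] and [den u] are at most 3 in absolute value, so [kappa] is 0 only if
    both vanish. The other conditions say, through [Cpowz_root6], that the remaining signed monomial
    takes the value 1 at every pair of zeros of [den]. *)
Definition base_ok (x : term) : bool :=
  let e := snd (targ x) in
  let c i j := ((nth i e 0 - nth j e 0) / 3)%Z in
  if (kappa e =? 0)%Z then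
    ((nth 2 e 0 =? 0) && (nth 5 e 0 =? 0) && (nth 0 e 0 - nth 1 e 0 =? c 0%nat 1%nat * 3) &&
     (nth 3 e 0 - nth 4 e 0 =? c 3%nat 4%nat * 3) &&
     (fst (targ x) * (if Z.even (c 0%nat 1%nat) then 1 else -1) * (if Z.even (c 3%nat 4%nat) then 1 else -1) =? 1))%Z
  else true.

Lemma terms_base_ok : forallb base_ok terms = true.
Proof. vm_compute. reflexivity. Qed.

(** From w (1 - w) = 1 the product is w^(a-b), and w^3 = -1. *)
Lemma Cpowz_root6 (w : C) (a b k : Z) : root6 w -> w <> 0%C -> (a - b = k * 3)%Z ->
  (Cpowz w a * Cpowz (1 - w) b)%C = RtoC (IZR (if Z.even k then 1 else -1)%Z).
Proof.
  intros Hw H0 Hab.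
  assert (E : (1 - w = / w)%C).
  { rewrite (_ : (1 - w = w * (1 - w) * / w)%C); [|now field].
    rewrite (_ : (w * (1 - w) = w - w * w)%C); [|ring]. rewrite Hw. now field. }
  rewrite E (_ : (/ w)%C = Cpowz w (-1)).
  - rewrite Cpowz_Cpowz // -Cpowz_add // (_ : (a + b * -1 = k * 3)%Z); [|lia].
    rewrite -Cpowz_Cpowz // (_ : Cpowz w 3 = RtoC (IZR (-1))).
    + apply Cpowz_sign. now right.
    + change (w * (w * (w * 1)) = RtoC (-1))%C.
      rewrite (_ : (w * (w * (w * 1)) = w * (w * w))%C); [|ring]. rewrite Hw.
      rewrite (_ : (w * (w - 1) = w * w - w)%C); [|ring]. rewrite Hw. ring.
  - rewrite Cpowz_neg. change (Pos.to_nat 1) with 1%nat. now rewrite Cpow_1_r.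
Qed.

Lemma root6_neq (w : C) : root6 w -> w <> 0%C /\ (1 - w <> 0)%C /\ (w - (1 - w) <> 0)%C.
Proof.
  intros Hw. unfold root6 in Hw.
  assert (N : forall a : R, a <> 0 -> RtoC a <> 0%C) by (intros a Ha E; apply Ha; now apply RtoC_inj).
  split; [|split]; intros E.
  - rewrite E in Hw. apply (N (-1)); [lra|].
    rewrite (_ : RtoC (-1) = (0 - 1)%C); [rewrite -Hw; ring | ring].
  - assert (E' : w = 1%C) by (rewrite (_ : w = (1 - (1 - w))%C); [rewrite E; ring | ring]).
    rewrite E' in Hw. apply (N 1); [lra|]. rewrite (_ : RtoC 1 = (1 * 1)%C); [rewrite Hw; ring | ring].
  - apply (N (-3)); [lra|].
    rewrite (_ : RtoC (-3) = ((w - (1 - w)) * (w - (1 - w)))%C); [rewrite E; ring|].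
    rewrite (_ : ((w - (1 - w)) * (w - (1 - w)) = 4 * (w * w) - 4 * w + 1)%C); [|ring].
    rewrite Hw. ring.
Qed.

Lemma filterlim_at_right_continuous (F : R -> R) : continuous F 0 -> filterlim F (at_right 0) (locally (F 0)).
Proof. intros H. apply (filterlim_filter_le_1 (F := locally 0)); [apply filter_le_within | exact H]. Qed.

Lemma filterlim_at_right_ext (F G : R -> R) (l : R) : (forall r, 0 < r <= 1 -> F r = G r) ->
  filterlim F (at_right 0) (locally l) -> filterlim G (at_right 0) (locally l).
Proof.
  intros H. apply filterlim_ext_loc. exists (mkposreal 1 Rlt_0_1) => r Hr Hr0. apply H.
  rewrite /ball /= /AbsRing_ball /abs /minus /plus /opp /= Ropp_0 Rplus_0_r in Hr.
  apply Rabs_lt_between in Hr. lra.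
Qed.

Lemma continuous_dot (e : list Z) (fs : list (R -> R)) (x : R) : List.Forall (fun f => continuous f x) fs ->
  continuous (fun r => dot e (map (fun f => f r) fs)) x.
Proof.
  intros H. revert e. induction H as [|f fs Hf H IH]; intros e.
  - cbn [map]. apply continuous_const.
  - destruct e as [|k e]; [apply continuous_const|].
    apply (continuous_plus (fun r => IZR k * f r) (fun r => dot e (map (fun f => f r) fs))).
    + apply (continuous_multR (fun _ => IZR k)); [apply continuous_const | exact Hf].
    + apply IH.
Qed.

Section Limit.
Variables (w1 w2 t0 u0 : C) (m : nat).
Hypotheses (Hm : (2 <= m <= 7)%nat) (Hw1 : root6 w1) (Hw2 : root6 w2).

Let T (r : R) : C := to_root w1 t0 r.
Let U (r : R) : C := to_root w2 u0 (Cpow r 4).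

Hypothesis Hdom : forall r, 0 < r <= 1 -> nonzero (gensC (T r) (U r)).

Lemma Ccont_polyfun (G : R -> C) (r : R) : polyfun G -> Ccont G r.
Proof.
  intros H. destruct (polyfun_Cder G r H) as [l [H1 H2]].
  split; apply: ex_derive_continuous; eexists; eassumption.
Qed.

Lemma ends : T 0 = w1 /\ U 0 = w2.
Proof. unfold T, U, to_root. split; [ring | cbn; ring]. Qed.

Lemma lim_arg_nondegenerate (x : term) : In x terms -> kappa (snd (targ x)) = 0%Z ->
  filterlim (fun r => svlog m (arg (T r) (U r) x)) (at_right 0) (locally (svlog m 1)).
Proof.
  intros Hx Hk. destruct (term_wf x Hx) as [_ [He _]].
  pose proof (proj1 (forallb_forall _ _) terms_base_ok x Hx) as HB. unfold base_ok in HB.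
  rewrite Hk Z.eqb_refl in HB. unfold arg, evM.
  destruct (targ x) as [s e]. cbn [fst snd] in *.
  do 7 (destruct e as [|? e]; try discriminate He). cbn [nth] in HB.
  apply andb_prop in HB as [HB H5]. apply andb_prop in HB as [HB H4]. apply andb_prop in HB as [HB H3].
  apply andb_prop in HB as [H1 H2].
  apply Z.eqb_eq in H1, H2, H3, H4, H5. subst z1 z4.
  destruct (root6_neq w1 Hw1) as [A1 [A2 _]]. destruct (root6_neq w2 Hw2) as [B1 [B2 _]].
  destruct ends as [ET EU].
  assert (HT := polyfun_T w1 t0). assert (HU := polyfun_U w2 u0).
  fold T in HT. fold U in HU.
  (* The factors [den (T r)] and [den (U r)], which vanish at [r = 0], have exponent 0 and are left
     out; what remains is differentiable and nonzero at the end point. *)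
  set (G := fun r => evM (map (fun F : R -> C => F r) [T; (fun s => 1 - T s)%C; U; (fun s => 1 - U s)%C])
     (s, [z; z0; z2; z3])).
  assert (EG : forall r, G r = (IZR s * mono (gensC (T r) (U r)) [z; z0; 0%Z; z2; z3; 0%Z])%C).
  { intros r. unfold G, evM, gensC. cbn [fst snd map mono Cpowz]. ring. }
  assert (G0 : G 0 = 1%C).
  { unfold G, evM. cbn [fst snd map mono]. rewrite ET EU.
    rewrite (_ : (IZR s * (Cpowz w1 z * (Cpowz (1 - w1) z0 * (Cpowz w2 z2 * (Cpowz (1 - w2) z3 * 1)))) =
       IZR s * (Cpowz w1 z * Cpowz (1 - w1) z0) * (Cpowz w2 z2 * Cpowz (1 - w2) z3))%C); [|ring].
    rewrite (Cpowz_root6 _ _ _ _ Hw1 A1 H3) (Cpowz_root6 _ _ _ _ Hw2 B1 H4).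
    now rewrite -!RtoC_mult -!mult_IZR H5. }
  apply filterlim_ext with (fun r => svlog m (G r)); [intros r; now rewrite EG|].
  rewrite -G0. apply (filterlim_at_right_continuous (fun r => svlog m (G r))).
  apply (continuous_comp (fun r => G r : C_UniformSpace) (svlog m)).
  - destruct (exists_logder [T; (fun s => 1 - T s)%C; U; (fun s => 1 - U s)%C] 0) as [etas Hetas].
    { repeat constructor; try assumption; try (now apply polyfun_one_minus);
        rewrite ?ET ?EU; assumption. }
    eapply Cder_continuous. apply (Cder_evM _ _ _ (s, [z; z0; z2; z3]) Hetas).
  - apply continuous_svlog; [lia|]. rewrite G0. apply C1_nz.
Qed.

Hypotheses (Ht0 : den t0 <> 0%C) (Hu0 : den u0 <> 0%C).

Let Ta (r : R) : C := ((t0 - w1) * (T r - (1 - w1)))%C.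
Let Ua (r : R) : C := ((u0 - w2) * (U r - (1 - w2)))%C.

Lemma den_T (r : R) : den (T r) = (r * Ta r)%C.
Proof. rewrite (den_factor w1 _ Hw1). unfold Ta, T, to_root. ring. Qed.

Lemma den_U (r : R) : den (U r) = (Cpow r 4 * Ua r)%C.
Proof. rewrite (den_factor w2 _ Hw2). unfold Ua, U, to_root. ring. Qed.

(** Up to a function continuous at 0, log|x| is [kappa] times log r, hence unbounded; [svlog_bound]
    then gives the limit 0, whether x tends to 0 or to infinity. *)
Lemma lim_arg_degenerate (x : term) : In x terms -> kappa (snd (targ x)) <> 0%Z ->
  filterlim (fun r => svlog m (arg (T r) (U r) x)) (at_right 0) (locally 0).
Proof.
  intros Hx Hk. destruct (term_wf x Hx) as [Hs [He _]].
  destruct (root6_neq w1 Hw1) as [A1 [A2 A3]]. destruct (root6_neq w2 Hw2) as [B1 [B2 B3]].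
  destruct ends as [ET EU].
  assert (HT := polyfun_T w1 t0). assert (HU := polyfun_U w2 u0).
  fold T in HT. fold U in HU.
  set (lns := [(fun r => ln (Cmod (T r))); (fun r => ln (Cmod (1 - T r)%C)); (fun r => ln (Cmod (Ta r)));
    (fun r => ln (Cmod (U r))); (fun r => ln (Cmod (1 - U r)%C)); (fun r => ln (Cmod (Ua r)))]).
  set (c := fun r : R => dot (snd (targ x)) (map (fun f => f r) lns)).
  assert (Ct : Ta 0 <> 0%C).
  { unfold Ta. rewrite ET. apply Cmult_neq_0; [|exact A3].
    intros E. apply Ht0. rewrite (den_factor w1 _ Hw1) E. ring. }
  assert (Cu : Ua 0 <> 0%C).
  { unfold Ua. rewrite EU. apply Cmult_neq_0; [|exact B3].
    intros E. apply Hu0. rewrite (den_factor w2 _ Hw2) E. ring. }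
  assert (PTa : polyfun Ta).
  { apply polyfun_scal. apply polyfun_minus; [exact HT | apply polyfun_const]. }
  assert (PUa : polyfun Ua).
  { apply polyfun_scal. apply polyfun_minus; [exact HU | apply polyfun_const]. }
  assert (Hc : continuous c 0).
  { apply continuous_dot. repeat constructor; apply continuous_ln_Cmod; rewrite ?ET ?EU //;
      apply Ccont_polyfun; try assumption; now apply polyfun_one_minus. }
  assert (Hrho : forall r, 0 < r <= 1 ->
    ln (Cmod (arg (T r) (U r) x)) = IZR (kappa (snd (targ x))) * ln r + c r).
  { intros r Hr. pose proof (Hdom r Hr) as Hnz. unfold arg. rewrite ln_Cmod_evM //.
    unfold gensC, nonzero in *. rewrite !List.Forall_cons_iff in Hnz.
    destruct Hnz as (_ & _ & D3 & _ & _ & D6 & _). rewrite den_T in D3. rewrite den_U in D6.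
    assert (Hr0 : RtoC r <> 0%C) by (intros E; apply RtoC_inj in E; lra).
    assert (N1 : Ta r <> 0%C) by (intros E; apply D3; rewrite E; ring).
    assert (N2 : Ua r <> 0%C) by (intros E; apply D6; rewrite E; ring).
    unfold c, lns, kappa. cbn [map]. rewrite den_T den_U.
    rewrite (ln_Cmod_mult r) // (ln_Cmod_mult (r ^ 4)%C) //; [|now apply Cpow_nz].
    rewrite Cmod_pow Cmod_R Rabs_pos_eq; [|lra]. rewrite ln_pow; [|lra].
    destruct (snd (targ x)) as [|e0 [|e1 [|e2 [|e3 [|e4 [|e5 [|? ?]]]]]]]; try discriminate He.
    cbn [dot hd tl nth]. rewrite plus_IZR mult_IZR. cbn [INR]. ring. }
  destruct (svlog_bound m ltac:(lia)) as [K HK].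
  apply filterlim_locally => eps.
  assert (He0 := cond_pos eps).
  assert (L1 : locally 0 (fun r => Rabs (c r - c 0) < 1)).
  { exact (proj1 (filterlim_locally _ _) Hc (mkposreal 1 Rlt_0_1)). }
  (* Near 0 one has |c r| <= |c 0| + 1, so log r < - M leaves |log|x|| > |K| / eps, which is what
     [svlog_bound] needs to give |L_m(x)| < eps. *)
  set (M := Rabs (c 0) + 1 + Rabs K / eps).
  assert (L2 : locally 0 (fun r => r < exp (- M))).
  { apply (open_lt (exp (- M))). apply exp_pos. }
  assert (L3 : locally 0 (fun r => r < 1)) by (apply (open_lt 1); apply Rlt_0_1).
  apply: filter_imp (filter_and _ _ L1 (filter_and _ _ L2 L3)) => r [C1 [C2 C3]] Hr.
  assert (Hr' : 0 < r <= 1) by lra.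
  rewrite /ball /= /AbsRing_ball /abs /minus /plus /opp /= Ropp_0 Rplus_0_r.
  assert (Hln : ln r < - M) by (rewrite -(ln_exp (- M)); apply ln_increasing; lra).
  assert (Hka : 1 <= Rabs (IZR (kappa (snd (targ x))))).
  { rewrite -abs_IZR. apply IZR_le. lia. }
  assert (Hbig : Rabs K / eps < Rabs (ln (Cmod (arg (T r) (U r) x)))).
  { rewrite Hrho //. pose proof (Rabs_pos (c 0)). pose proof (Rabs_pos K).
    assert (0 <= Rabs K / eps) by (apply Rdiv_le_0_compat; lra).
    assert (Q1 : Rabs (IZR (kappa (snd (targ x))) * ln r) >= - ln r).
    { rewrite Rabs_mult (Rabs_left (ln r)); unfold M in Hln; nra. }
    assert (Q2 : Rabs (c r) <= Rabs (c 0) + 1).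
    { rewrite (_ : c r = (c r - c 0) + c 0); [|ring]. eapply Rle_trans; [apply Rabs_triang|]. lra. }
    pose proof (Rabs_triang_inv (IZR (kappa (snd (targ x))) * ln r) (- c r)) as Q3.
    rewrite Rabs_Ropp in Q3. unfold Rminus in Q3. rewrite Ropp_involutive in Q3.
    unfold M in Hln. lra. }
  assert (Hne : arg (T r) (U r) x <> 0%C) by (apply evM_neq_0; [now apply Hdom | now split]).
  specialize (HK _ Hne). set (Lv := svlog m (arg (T r) (U r) x)) in *.
  set (rho := Rabs (ln (Cmod (arg (T r) (U r) x)))) in *.
  pose proof (Rle_abs K). pose proof (Rabs_pos Lv).
  apply Rlt_div_l in Hbig; [|exact He0].
  destruct (Rlt_dec (Rabs Lv) eps) as [|Hge]; [assumption|]. exfalso.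
  pose proof (Rabs_pos (ln (Cmod (arg (T r) (U r) x)))). fold rho in H1. nra.
Qed.

Lemma lim_sum (vs : list (list R)) : length vs = (7 - m)%nat ->
  filterlim (fun r => lsum (fun x => IZR (twt x) * dots vs (snd (targ x)) * svlog m (arg (T r) (U r) x)) terms)
    (at_right 0) (locally 0).
Proof.
  intros Hvs.
  assert (E : lsum (fun x => IZR (twt x) * dots vs (snd (targ x)) *
     (if Z.eqb (kappa (snd (targ x))) 0 then svlog m 1 else 0)) terms = 0).
  { rewrite (lsum_ext _ (fun x => svlog m 1 * (IZR (base_coef x) * dots vs (snd (targ x))))).
    (* Even weights contribute 0 because L_m(1) = 0; for odd weights 7 - m is 0, 2 or 4 and the
       coefficients cancel. *)
    - rewrite lsum_scal. destruct (Nat.odd m) eqn:Ho; [|rewrite svlog_1_even //; ring].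
      apply Rmult_eq_0_compat_l. apply (vanish_terms_correct base_coef (7 - m)) => //.
      apply (proj1 (forallb_forall _ _) base_checks (7 - m)%nat).
      do 8 (destruct m as [|m']; [try discriminate Ho; cbn; try tauto; lia | try clear m; rename m' into m]).
      lia.
    - intros x _. unfold base_coef. destruct Z.eqb; ring. }
  refine (eq_ind _ (fun l => filterlim _ (at_right 0) (locally l)) _ _ E).
  apply (filterlim_lsum (fun x r => IZR (twt x) * dots vs (snd (targ x)) * svlog m (arg (T r) (U r) x))).
  { apply within_filter, locally_filter. }
  intros x Hx.
  apply (filterlim_comp _ _ _ (fun r => svlog m (arg (T r) (U r) x)) (fun y => IZR (twt x) * dots vs (snd (targ x)) * y)
    _ (locally (if (kappa (snd (targ x)) =? 0)%Z then svlog m 1 else 0))).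
  - destruct (Z.eqb_spec (kappa (snd (targ x))) 0) as [Hk|Hk].
    + now apply lim_arg_nondegenerate.
    + now apply lim_arg_degenerate.
  - apply (filterlim_scal_r (V := R_NormedModule) (IZR (twt x) * dots vs (snd (targ x)))).
Qed.

End Limit.

(** All points (t, u) and all weight vectors are treated together, since the derivative at a point
    of the path involves the lower weights at that point, with other vectors. *)
Lemma sum_svlog_0 (m : nat) : (2 <= m <= 7)%nat -> forall t u, nonzero (gensC t u) ->
  forall vs, length vs = (7 - m)%nat ->
  lsum (fun x => IZR (twt x) * dots vs (snd (targ x)) * svlog m (arg t u x)) terms = 0.
Proof.
  induction m as [m IH] using lt_wf_ind. intros Hm t0 u0 Hnz vs Hvs.
  pose proof Hnz as Hnz'. unfold nonzero, gensC in Hnz'. rewrite !List.Forall_cons_iff in Hnz'.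
  destruct Hnz' as (A1 & A2 & A3 & B1 & B2 & B3 & _).
  destruct (exists_root_path t0 A1 A2 A3) as [w1 [Hw1 P1]].
  destruct (exists_root_path u0 B1 B2 B3) as [w2 [Hw2 P2]].
  set (T := fun r : R => to_root w1 t0 r). set (U := fun r : R => to_root w2 u0 (Cpow r 4)).
  assert (Hdom : forall r, 0 < r <= 1 -> nonzero (gensC (T r) (U r))).
  { intros r Hr. destruct (P1 r Hr) as [D1 [D2 D3]].
    assert (Hr4 : 0 < r ^ 4 <= 1).
    { split; [apply pow_lt; lra|]. rewrite -(pow1 4). apply pow_incr; lra. }
    destruct (P2 (r ^ 4) Hr4) as [D4 [D5 D6]]. rewrite RtoC_pow in D4 D5 D6.
    repeat constructor; assumption. }
  set (F := fun r => lsum (fun x => IZR (twt x) * dots vs (snd (targ x)) * svlog m (arg (T r) (U r) x)) terms).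
  assert (Hconst : forall r, 0 < r <= 1 -> F r = F 1).
  { apply (path_sum_const w1 w2 t0 u0 m vs Hm Hvs Hdom). intros k Hk. apply IH; lia. }
  pose proof (lim_sum w1 w2 t0 u0 m Hm Hw1 Hw2 Hdom A3 B3 vs Hvs) as HL. fold T U in HL.
  assert (E1 : F 1 = lsum (fun x => IZR (twt x) * dots vs (snd (targ x)) * svlog m (arg t0 u0 x)) terms).
  { unfold F. rewrite (_ : T 1 = t0); [|unfold T, to_root; ring].
    rewrite (_ : U 1 = u0); [reflexivity|]. unfold U, to_root. rewrite Cpow_1_l. ring. }
  rewrite -E1.
  apply (filterlim_locally_unique (F := at_right 0) (V := R_NormedModule) F).
  - apply filterlim_at_right_ext with (fun _ => F 1); [intros r Hr; now rewrite Hconst | apply filterlim_const].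
  - exact HL.
Qed.

Theorem theorem5p1 (t u : C)
  (ht : fj_avoid_0_infty t) (hu : fj_avoid_0_infty u) :
  polylog_linear 7 (xi7 t u) = 0%R.
Proof.
  assert (N : forall z, fj_avoid_0_infty z -> z <> 0%C /\ (1 - z <> 0)%C /\ den z <> 0%C).
  (* The numerator of [f3] is z (1 - z), so its nonvanishing excludes both 0 and 1. *)
  { intros z [Hd Hf]. split; [|split; [|exact Hd]]; intros E; apply (Hf f3).
    - cbn; tauto.
    - unfold f3. rewrite E. unfold Cdiv. ring.
    - cbn; tauto.
    - unfold f3. rewrite E. unfold Cdiv. ring. }
  destruct (N t ht) as [A1 [A2 A3]]. destruct (N u hu) as [B1 [B2 B3]].
  assert (H : nonzero (gensC t u)) by (repeat constructor; assumption).
  rewrite (polylog_linear_xi7 t u H).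
  rewrite (lsum_ext _ (fun x => IZR (twt x) * dots [] (snd (targ x)) * svlog 7 (arg t u x))).
  - rewrite sum_svlog_0 //; [ring | lia].
  - intros x _. cbn [dots]. unfold arg. ring.
Qed.
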